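(* Let $p$ be a prime number and $q=p^m$ with $m>1$. Let $G$ be one of the following finite quasisimple groups: $\mathrm{SL}_2(q)$, $\mathrm{PSL}_2(q)$, $\mathrm{SL}_3(p)$, or the Suzuki group ${}^2\!B_2(q)$ (in the latter case, $p=2$ and $m$ is odd). Let $M$ be any non-trivial abelian $p$-subgroup of $G$ of central type. Let $K$ be a number field with ring of integers $\mathcal{O}_K$, large enough so that $KM\cong K^{|M|}$ as algebras, let $R\subset K$ be a Dedekind domain such that $\mathcal{O}_K\subseteq R$, and let $\omega:\widehat{M}\times\widehat{M}\to K^{\times}$ be any normalized non-degenerate $2$-cocycle. If $(KG)_{\Omega_{M,\omega}}$ admits a Hopf order over $R$, then $\frac{1}{|M|}\in R$. Hence, $(KG)_{\Omega_{M,\omega}}$ does not admit a Hopf order over $\mathcal{O}_K$.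
   Context: Central type: a finite abelian group $M$ is of central type if $M\cong E\times E$ for some group $E$ (equivalently, $\widehat M$ admits a non-degenerate $2$-cocycle). Twists: let $M$ be an abelian subgroup of a finite group $G$ and $K$ a field of characteristic not dividing $|M|$ such that $KM\cong K^{|M|}$. Let $\widehat M$ be the group of homomorphisms $M\to K^\times$, and for $\phi\in\widehat M$ put $e_\phi=\frac{1}{|M|}\sum_{v\in M}\phi(v^{-1})v\in KM$. A $2$-cocycle $\omega:\widehat M\times\widehat M\to K^\times$ (trivial action) is normalized if $\omega(\phi,\varepsilon)=\omega(\varepsilon,\phi)=1$ for the trivial character $\varepsilon$ and all $\phi$; it is non-degenerate if the skew-symmetric pairing $(\phi,\psi)\mapsto\omega(\phi,\psi)/\omega(\psi,\phi)$ on $\widehat M$ is non-degenerate. Put $\Omega=\Omega_{M,\omega}=\sum_{\phi,\psi\in\widehat M}\omega(\phi,\psi)\,e_\phi\otimes e_\psi\in KG\otimes KG$. The Hopf algebra $(KG)_{\Omega}$ has the algebra structure and counit of $KG$, coproduct $\Delta_\Omega(g)=\Omega(g\otimes g)\Omega^{-1}$ and antipode $S_\Omega(g)=Q\,g^{-1}Q^{-1}$ for $g\in G$, where $Q=\sum\Omega^{(1)}S(\Omega^{(2)})$, $\Omega=\sum\Omega^{(1)}\otimes\Omega^{(2)}$ and $S$ is the antipode of $KG$. Hopf orders: let $H$ be a finite-dimensional Hopf algebra over a field $K$ and $R$ a subring of $K$. A Hopf order of $H$ over $R$ is a finitely generated projective $R$-submodule $X\subseteq H$ such that the natural map $X\otimes_R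 K\to H$ is an isomorphism and $1_H\in X$, $XX\subseteq X$, $\Delta(X)\subseteq X\otimes_R X$, $\varepsilon(X)\subseteq R$, $S(X)\subseteq X$. Suzuki group: for $q=2^{2n+1}$, $n\ge 1$, let $\theta$ be the automorphism $x\mapsto x^{2^{n+1}}$ of $\mathbb F_q$. Then ${}^2\!B_2(q)$ is the subgroup of $\mathrm{SL}_4(\mathbb F_q)$ generated by the matrices $u(a,b)=\begin{pmatrix}1&0&0&0\\ a&1&0&0\\ a\theta(a)+b&\theta(a)&1&0\\ a^2\theta(a)+ab+\theta(b)&b&a&1\end{pmatrix}$ ($a,b\in\mathbb F_q$), the matrices $\mathrm{diag}(a_1,a_2,a_2^{-1},a_1^{-1})$ with $\theta(a_1)=\kappa\theta(\kappa)$, $\theta(a_2)=\kappa$ ($\kappa\in\mathbb F_q^\times$), and the permutation matrix with $1$'s on the antidiagonal. Its order is $q^2(q-1)(q^2+1)$. *)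

(* Defs.v *)
From HB Require Import structures.
From mathcomp Require Import all_boot all_order all_fingroup all_algebra.
From mathcomp Require Import all_solvable all_field ring_quotient sesquilinear.
From mathcomp Require Import boolp.

Set Implicit Arguments.
Unset Strict Implicit.
Unset Printing Implicit Defensive.

Import GRing.Theory.
Local Open Scope ring_scope.

(* [group_algebra K gT] is K[gT]; the function [a] stands for the sum of the
   [a g *: g].  It is a copy of [{ffun gT -> K}] because the latter carries
   the pointwise product. *)
Definition group_algebra (K : fieldType) (gT : finGroupType) : Type :=
  {ffun gT -> K}.

Section GroupAlgebra.
Variables (K : fieldType) (gT : finGroupType).
Local Notation KG := (group_algebra K gT).

HB.instance Definition _ := Choice.copy KG {ffun gT -> K}.
HB.instance Definition _ := GRing.Zmodule.copy KG {ffun gT -> K}.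
HB.instance Definition _ := GRing.Lmodule.copy KG {ffun gT -> K^o}.
HB.instance Definition _ := Vector.copy KG {ffun gT -> K^o}.

Fact galg_addE (a b : KG) x : (a + b) x = a x + b x.
Proof. exact: ffunE. Qed.

Fact galg_scaleE (k : K) (a : KG) x : (k *: a) x = k * a x.
Proof. exact: ffunE. Qed.

Definition galg_elt (g : gT) : KG := [ffun x => (x == g)%:R].

Definition galg_mul (a b : KG) : KG :=
  [ffun x => \sum_(y : gT) a y * b (y^-1 * x)%g].

Fact galg_mulA : associative galg_mul.
Proof.
move=> a b c; apply/ffunP=> x; rewrite !ffunE.
under eq_bigr => y _ do rewrite ffunE big_distrr /=.
under [RHS]eq_bigr => y _ do rewrite ffunE big_distrl /=.
rewrite [RHS]exchange_big /=; apply: eq_bigr => y _.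
rewrite (reindex (fun z : gT => y^-1 * z)%g) /=; last first.
  by apply: onW_bij; exists (fun z => y * z)%g => z; rewrite ?mulKVg ?mulKg.
by apply: eq_bigr => z _; rewrite mulrA invMg invgK -mulgA mulKVg.
Qed.

Fact galg_mul1l : left_id (galg_elt 1) galg_mul.
Proof.
move=> a; apply/ffunP=> x; rewrite ffunE (bigD1 1%g) //= ffunE eqxx mul1r.
by rewrite invg1 mul1g big1 ?addr0 // => y /negPf y1; rewrite ffunE y1 mul0r.
Qed.

Fact galg_mul1r : right_id (galg_elt 1) galg_mul.
Proof.
move=> a; apply/ffunP=> x; rewrite ffunE (bigD1 x) //= ffunE mulVg eqxx mulr1.
rewrite big1 ?addr0 // => y /negPf yx.
by rewrite ffunE -eq_mulVg1 yx mulr0.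
Qed.

Fact galg_mulDl : left_distributive galg_mul +%R.
Proof.
move=> a b c; apply/ffunP=> x; rewrite galg_addE !ffunE -big_split.
by apply: eq_bigr => y _; rewrite galg_addE mulrDl.
Qed.

Fact galg_mulDr : right_distributive galg_mul +%R.
Proof.
move=> a b c; apply/ffunP=> x; rewrite galg_addE !ffunE -big_split.
by apply: eq_bigr => y _; rewrite galg_addE mulrDr.
Qed.

Fact galg_1neq0 : galg_elt 1 != 0.
Proof.
by apply/eqP=> /ffunP/(_ 1%g)/eqP; rewrite !ffunE eqxx oner_eq0.
Qed.

HB.instance Definition _ := GRing.Zmodule_isNzRing.Build KG
  galg_mulA galg_mul1l galg_mul1r galg_mulDl galg_mulDr galg_1neq0.

Fact galg_scaleAl (k : K) (a b : KG) : k *: (a * b) = (k *: a) * b.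
Proof.
apply/ffunP=> x; rewrite galg_scaleE !ffunE big_distrr /=.
by apply: eq_bigr => y _; rewrite galg_scaleE mulrA.
Qed.

HB.instance Definition _ := GRing.Lmodule_isLalgebra.Build K KG galg_scaleAl.

Fact galg_scaleAr (k : K) (a b : KG) : k *: (a * b) = a * (k *: b).
Proof.
apply/ffunP=> x; rewrite galg_scaleE !ffunE big_distrr /=.
by apply: eq_bigr => y _; rewrite galg_scaleE mulrCA.
Qed.

HB.instance Definition _ := GRing.Lalgebra_isAlgebra.Build K KG galg_scaleAr.
HB.instance Definition _ := Algebra_isFalgebra.Build K KG.

Definition galg_counit (a : KG) : K := \sum_(g : gT) a g.

Definition galg_antipode (a : KG) : KG := \sum_(g : gT) a g *: galg_elt g^-1%g.

(* KG (x) KG is identified with K[gT x gT]. *)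
Definition galg_tensor (a b : KG) : group_algebra K (gT * gT)%type :=
  [ffun z => a z.1 * b z.2].

End GroupAlgebra.

Definition split_group_algebra (K : fieldType) (gT : finGroupType)
    (M : {group gT}) : Prop :=
  exists f : group_algebra K (subg_of M) -> {ffun 'I_#|M| -> K^o},
    [/\ linear f, monoid_morphism f & bijective f].

Section Dual.
Variables (K : fieldType) (gT : finGroupType) (M : {group gT}).

Definition is_lin_char (phi : {ffun subg_of M -> K}) : bool :=
  [forall x, phi x != 0]
    && [forall x, forall y, phi (x * y)%g == phi x * phi y].

Record dual_group : Type :=
  Dual { dual_fun :> {ffun subg_of M -> K}; dualP : is_lin_char dual_fun }.

HB.instance Definition _ := [isSub for dual_fun].
HB.instance Definition _ := [Choice of dual_group by <:].

Lemma dual_neq0 (phi : dual_group) x : phi x != 0.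
Proof. by case: phi => phi /= /andP[/forallP]. Qed.

Lemma dualM (phi : dual_group) x y : phi (x * y)%g = phi x * phi y.
Proof. by case: phi => phi /= /andP[_ /forallP/(_ x)/forallP/(_ y)/eqP]. Qed.

Lemma dual1 (phi : dual_group) : phi 1%g = 1.
Proof. by apply: (mulfI (dual_neq0 phi 1%g)); rewrite -dualM mulg1 mulr1. Qed.

Lemma dualX (phi : dual_group) x n : phi (x ^+ n)%g = phi x ^+ n.
Proof.
by elim: n => [|n IHn]; rewrite ?expg0 ?expr0 ?dual1 // expgS exprS dualM IHn.
Qed.

Lemma dual_unity_root (phi : dual_group) x : #|M|.-unity_root (phi x).
Proof.
rewrite unity_rootE -dualX; apply/eqP; rewrite -(dual1 phi); congr (phi _).
by apply: val_inj; rewrite /= morphX ?inE //= expg_cardG ?subgP.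
Qed.

Lemma unity_root_seq :
  exists s : seq K, forall x, #|M|.-unity_root x -> x \in s.
Proof.
pose P n := `[< exists s : seq K,
  [/\ uniq s, all #|M|.-unity_root s & size s = n] >].
have P0 : exists n, P n by exists 0; apply/asboolP; exists [::].
have Pmax n : P n -> (n <= #|M|)%N.
  by case/asboolP=> s [Us Ms <-]; apply: max_unity_roots.
case: (ex_maxnP P0 Pmax) => n /asboolP[s [Us Ms sz_s]] n_max.
exists s => x Mx; apply/negPn/negP=> s'x.
have: P n.+1 by apply/asboolP; exists (x :: s); rewrite /= s'x Us Mx Ms sz_s.
by move/n_max; rewrite ltnn.
Qed.

Let roots : seq K := projT1 (cid unity_root_seq).

Let dual_code (phi : dual_group) : {ffun subg_of M -> 'I_(size roots).+1} :=
  [ffun x => inord (index (phi x) roots)].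

Let dual_decode (c : {ffun subg_of M -> 'I_(size roots).+1}) :
    option dual_group :=
  insub [ffun x => nth 0 roots (c x)].

Lemma dual_codeK : pcancel dual_code dual_decode.
Proof.
move=> phi; rewrite /dual_decode; set psi := finfun _.
suff -> : psi = val phi by rewrite valK.
apply/ffunP=> x; rewrite !ffunE inordK ?ltnS ?index_size // nth_index //.
exact: (projT2 (cid unity_root_seq) _ (dual_unity_root phi x)).
Qed.

HB.instance Definition _ := isCountable.Build dual_group
  (pcan_pickleK dual_codeK).
HB.instance Definition _ : isFinite dual_group := PCanIsFinite dual_codeK.

Fact dual_one_subproof : is_lin_char [ffun => 1].
Proof.
apply/andP; split; first by apply/forallP=> x; rewrite ffunE oner_neq0.
by apply/forallP=> x; apply/forallP=> y; rewrite !ffunE mulr1.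
Qed.

Fact dual_inv_subproof (phi : dual_group) : is_lin_char [ffun x => (phi x)^-1].
Proof.
apply/andP; split.
  by apply/forallP=> x; rewrite ffunE invr_eq0 dual_neq0.
by apply/forallP=> x; apply/forallP=> y; rewrite !ffunE dualM invfM.
Qed.

Fact dual_mul_subproof (phi psi : dual_group) :
  is_lin_char [ffun x => phi x * psi x].
Proof.
apply/andP; split.
  by apply/forallP=> x; rewrite ffunE mulf_neq0 ?dual_neq0.
by apply/forallP=> x; apply/forallP=> y; rewrite !ffunE !dualM mulrACA.
Qed.

Definition dual_one : dual_group := Dual dual_one_subproof.
Definition dual_inv (phi : dual_group) : dual_group :=
  Dual (dual_inv_subproof phi).
Definition dual_mul (phi psi : dual_group) : dual_group :=
  Dual (dual_mul_subproof phi psi).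

Fact dual_mulA : associative dual_mul.
Proof.
by move=> a b c; apply/val_inj/ffunP=> x; rewrite /= !ffunE mulrA.
Qed.

Fact dual_mul1 : left_id dual_one dual_mul.
Proof.
by move=> a; apply/val_inj/ffunP=> x; rewrite /= !ffunE mul1r.
Qed.

Fact dual_mulV : left_inverse dual_one dual_inv dual_mul.
Proof.
move=> a; apply/val_inj/ffunP=> x.
by rewrite /= !ffunE mulVf ?dual_neq0.
Qed.

HB.instance Definition _ :=
  Finite_isGroup.Build dual_group dual_mulA dual_mul1 dual_mulV.

End Dual.

Section Twist.
Variables (K : fieldType) (gT : finGroupType) (M : {group gT}).
Implicit Type omega : dual_group K M -> dual_group K M -> K.

(* A K^x-valued function is a K-valued function without zeros. *)
Definition cocycle2 omega : Prop :=
  (forall phi psi, omega phi psi != 0) /\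
  (forall phi psi chi,
     omega phi psi * omega (phi * psi)%g chi =
     omega psi chi * omega phi (psi * chi)%g).

Definition normalized_cocycle omega : Prop :=
  forall phi, omega phi 1%g = 1 /\ omega 1%g phi = 1.

(* The pairing is skew-symmetric, so one radical is enough. *)
Definition nondegenerate_cocycle omega : Prop :=
  forall phi, (forall psi, omega phi psi / omega psi phi = 1) -> phi = 1%g.

Definition char_idempotent (phi : dual_group K M) : group_algebra K gT :=
  #|M|%:R^-1 *: \sum_(v : subg_of M) phi v^-1%g *: galg_elt K (sgval v).

Definition twist_elt omega : group_algebra K (gT * gT)%type :=
  \sum_(phi : dual_group K M) \sum_(psi : dual_group K M)
    omega phi psi *: galg_tensor (char_idempotent phi) (char_idempotent psi).

End Twist.

(* Structure maps of a Hopf algebra whose underlying algebra is K[gT]; the Hopf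
   axioms, which hold for the twists below, are not recorded. *)
Record galg_hopf (K : fieldType) (gT : finGroupType) : Type := GalgHopf {
  coproduct : group_algebra K gT -> group_algebra K (gT * gT)%type;
  counit : group_algebra K gT -> K;
  antipode : group_algebra K gT -> group_algebra K gT
}.

Section TwistedHopf.
Variables (K : fieldType) (gT : finGroupType).
Variable Omega : group_algebra K (gT * gT)%type.
Implicit Type a : group_algebra K gT.

Definition twisted_coproduct a : group_algebra K (gT * gT)%type :=
  \sum_(g : gT)
    a g *: (Omega * galg_tensor (galg_elt K g) (galg_elt K g) * Omega^-1).

Definition twist_Q : group_algebra K gT :=
  \sum_(z : gT * gT)
    Omega z *: (galg_elt K z.1 * galg_antipode (galg_elt K z.2)).

Definition twisted_antipode a : group_algebra K gT :=
  \sum_(g : gT) a g *: (twist_Q * galg_elt K g^-1%g * twist_Q^-1).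

Definition twisted_galg : galg_hopf K gT :=
  GalgHopf twisted_coproduct (@galg_counit K gT) twisted_antipode.

End TwistedHopf.

Definition subring_type (K : fieldType) (R : subringClosed K) : Type :=
  {x : K | x \in R}.

Section SubringType.
Variables (K : fieldType) (R : subringClosed K).
HB.instance Definition _ := SubChoice.copy (subring_type R) {x : K | x \in R}.
HB.instance Definition _ := [SubChoice_isSubComNzRing of subring_type R by <:].
End SubringType.

Definition restrict_scalars (K : fieldType) (R : subringClosed K)
    (V : lmodType K) : Type := V.

Section Restriction.
Variables (K : fieldType) (R : subringClosed K) (V : lmodType K).

HB.instance Definition _ := GRing.Zmodule.copy (restrict_scalars R V) V.

Definition restr_scale (r : subring_type R) (v : restrict_scalars R V) :
    restrict_scalars R V :=
  (val r : K) *: (v : V).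

Fact restr_scaleA r s v :
  restr_scale r (restr_scale s v) = restr_scale (r * s) v.
Proof. by rewrite /restr_scale scalerA rmorphM. Qed.

Fact restr_scale1 : left_id 1 restr_scale.
Proof. by move=> v; rewrite /restr_scale rmorph1 scale1r. Qed.

Fact restr_scaleDr : right_distributive restr_scale +%R.
Proof. by move=> r u v; apply: scalerDr. Qed.

Fact restr_scaleDl v : {morph restr_scale^~ v : r s / r + s}.
Proof. by move=> r s; rewrite /restr_scale rmorphD scalerDl. Qed.

HB.instance Definition _ := GRing.Zmodule_isLmodule.Build
  (subring_type R) (restrict_scalars R V)
  restr_scaleA restr_scale1 restr_scaleDr restr_scaleDl.

End Restriction.

Definition submod_type (A : comNzRingType) (V : lmodType A)
    (X : submodClosed V) : Type := {x : V | x \in X}.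

Section SubmodType.
Variables (A : comNzRingType) (V : lmodType A) (X : submodClosed V).
HB.instance Definition _ := SubChoice.copy (submod_type X) {x : V | x \in X}.
HB.instance Definition _ := [SubChoice_isSubLmodule of submod_type X by <:].
End SubmodType.

Section Modules.
Variable A : comNzRingType.

Definition fin_gen (U : lmodType A) : Prop :=
  exists n (e : 'I_n -> U), forall u,
    exists c : 'I_n -> A, u = \sum_(i < n) c i *: e i.

Definition projective (U : lmodType A) : Prop :=
  forall (V W : lmodType A) (g : {linear V -> W}) (f : {linear U -> W}),
    (forall w, exists v, g v = w) ->
    exists h : {linear U -> V}, forall u, g (h u) = f u.

(* [b] identifies W with the tensor product of U and V over A, i.e. the linear
   map from that tensor product to W induced by [b] is an isomorphism. *)
Definition is_tensor_product (U V W : lmodType A) (b : U -> V -> W) : Prop :=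
  bilinear_for *:%R *:%R b /\
  forall (P : lmodType A) (f : {bilinear U -> V -> P}),
    exists g : {linear W -> P},
      (forall u v, g (b u v) = f u v) /\
      (forall g' : {linear W -> P},
         (forall u v, g' (b u v) = f u v) -> g' =1 g).

End Modules.

(* A subring R of a field K is a domain, and its field of fractions is the set
   of the quotients a / b in K.  As [idealr_closed] requires the ideal to be
   proper, the unit ideal (which is principal) is left out of the first
   clause, and the last one says that a nonzero prime ideal is maximal.
   Fields are allowed. *)
Definition dedekind_domain (K : fieldType) (R : subringClosed K) : Prop :=
  [/\ (forall I : {pred subring_type R}, idealr_closed I ->
         exists n (e : 'I_n -> subring_type R), (forall i, e i \in I) /\
           forall x, x \in I ->
             exists c : 'I_n -> subring_type R, x = \sum_(i < n) c i * e i),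
      (forall a b : K, a \in R -> b \in R -> b != 0 ->
         integralOver (val : subring_type R -> K) (a / b) -> a / b \in R)
    & (forall P : {pred subring_type R},
         idealr_closed P -> prime_idealr_closed P ->
         (exists2 x, x \in P & x != 0) ->
         forall I : {pred subring_type R}, idealr_closed I ->
           {subset P <= I} -> {subset I <= P})].

Section RingOfIntegers.
Variable K : fieldType.

Definition ring_of_integers_pred : {pred K} :=
  [pred x | `[< integralOver (intr : int -> K) x >]].

Fact ring_of_integers_subproof : subring_closed ring_of_integers_pred.
Proof.
split=> [|x y /asboolP Ix /asboolP Iy|x y /asboolP Ix /asboolP Iy].
- by apply/asboolP/integral1.
- by apply/asboolP/integral_sub.
- by apply/asboolP/integral_mul.
Qed.

HB.instance Definition _ :=
  GRing.isSubringClosed.Build K ring_of_integers_pred ring_of_integers_subproof.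

Definition ring_of_integers : subringClosed K := ring_of_integers_pred.

End RingOfIntegers.

Section HopfOrder.
Variables (K : fieldType) (gT : finGroupType) (H : galg_hopf K gT).
Variable R : subringClosed K.
Local Notation KG := (group_algebra K gT).

(* Membership in X (x)_R X, seen inside KG (x)_K KG.  For a Hopf order X this
   is no loss: X is projective, hence flat, so that the abstract X (x)_R X
   embeds into X (x)_R KG = (X (x)_R K) (x)_K KG = KG (x)_K KG. *)
Definition in_tensor_square (X : submodClosed (restrict_scalars R KG))
    (z : group_algebra K (gT * gT)%type) : Prop :=
  exists n (x y : 'I_n -> submod_type X),
    z = \sum_(i < n) galg_tensor (val (x i) : KG) (val (y i) : KG).

Record hopf_order (X : submodClosed (restrict_scalars R KG)) : Prop :=
  HopfOrder {
  ho_fin_gen : fin_gen (submod_type X);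
  ho_projective : projective (submod_type X);
  ho_extension : is_tensor_product
    (fun (x : submod_type X) (k : restrict_scalars R K^o) =>
       (k : K) *: (val x : KG) : restrict_scalars R KG);
  ho_one : (1 : KG) \in X;
  ho_mul : forall x y : KG, x \in X -> y \in X -> x * y \in X;
  ho_coproduct : forall x : KG, x \in X -> in_tensor_square X (coproduct H x);
  ho_counit : forall x : KG, x \in X -> counit H x \in R;
  ho_antipode : forall x : KG, x \in X -> antipode H x \in X
}.

Definition admits_hopf_order : Prop :=
  exists X : submodClosed (restrict_scalars R KG), hopf_order X.

End HopfOrder.

Definition central_type (gT : finGroupType) (M : {group gT}) : Prop :=
  abelian M /\ exists eT : finGroupType, M \isog [set: (eT * eT)%type].

Section SpecialLinear.
Variables (n : nat) (F : finFieldType).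

Definition special_linear : {set {'GL_n[F]}} := [set u | \det (GLval u) == 1].

Fact special_linear_group_set : group_set special_linear.
Proof.
apply/group_setP; split=> [|u v]; rewrite !inE; first by rewrite GL_1E det1.
by move=> /eqP du /eqP dv; rewrite GL_MxE det_mulmx du dv mulr1.
Qed.

Canonical special_linear_group := Group special_linear_group_set.

End SpecialLinear.

Section Suzuki.
Variables (n : nat) (F : finFieldType).

Definition suzuki_theta (x : F) : F := x ^+ (2 ^ n.+1).
Local Notation theta := suzuki_theta.

Definition mx4_of_rows (s : seq (seq F)) : 'M[F]_4 :=
  \matrix_(i < 4, j < 4) nth 0 (nth [::] s i) j.

Definition suzuki_u (a b : F) : 'M[F]_4 := mx4_of_rows
  [:: [:: 1; 0; 0; 0];
      [:: a; 1; 0; 0];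
      [:: a * theta a + b; theta a; 1; 0];
      [:: a ^+ 2 * theta a + a * b + theta b; b; a; 1]].

Definition suzuki_diag (a1 a2 : F) : 'M[F]_4 := mx4_of_rows
  [:: [:: a1; 0; 0; 0];
      [:: 0; a2; 0; 0];
      [:: 0; 0; a2^-1; 0];
      [:: 0; 0; 0; a1^-1]].

Definition suzuki_anti : 'M[F]_4 := mx4_of_rows
  [:: [:: 0; 0; 0; 1];
      [:: 0; 0; 1; 0];
      [:: 0; 1; 0; 0];
      [:: 1; 0; 0; 0]].

(* The subgroup generated by these is 2B2(q) if F has order q = 2 ^ (2 * n + 1);
   all of them have determinant 1. *)
Definition suzuki_gens : {set {'GL_4[F]}} :=
  [set u : {'GL_4[F]} | [exists a : F, exists b : F,
        GLval u == suzuki_u a b :> 'M[F]_4]]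
  :|: [set u : {'GL_4[F]} | [exists a1 : F, exists a2 : F, exists k : F,
        [&& k != 0, theta a1 == k * theta k, theta a2 == k
          & GLval u == suzuki_diag a1 a2 :> 'M[F]_4]]]
  :|: [set u : {'GL_4[F]} | GLval u == suzuki_anti :> 'M[F]_4].

Definition suzuki_group : {group {'GL_4[F]}} := <<suzuki_gens>>%G.

End Suzuki.

(* The finite field with q elements is any [finFieldType] of cardinality q. *)
Inductive listed_quasisimple (p m : nat) (gT : finGroupType) : Prop :=
| ListedSL2 (F : finFieldType) of #|F| = (p ^ m)%N
    & [set: gT] \isog special_linear 2 F
| ListedPSL2 (F : finFieldType) of #|F| = (p ^ m)%N
    & [set: gT] \isog (special_linear 2 F / 'Z(special_linear 2 F))%g
| ListedSL3 (F : finFieldType) of #|F| = p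
    & [set: gT] \isog special_linear 3 F
| ListedSuzuki (n : nat) (F : finFieldType) of p = 2%N & m = (2 * n + 1)%N
    & #|F| = (p ^ m)%N & [set: gT] \isog suzuki_group n F.

(* Main.v *)
From HB Require Import structures.
Require Import Defs.
From mathcomp Require Import all_boot all_order all_fingroup all_algebra.
From mathcomp Require Import all_solvable all_field sesquilinear.
From mathcomp Require Import boolp ring.

(** Let e be the idempotent of the trivial character of M and X a Hopf order of
    the twisted algebra over R.  The proof rests on one divisibility statement:
    for every g in G and every character chi of a rational representation of G,
    with S the sum of chi over the coset g M,

      S ^ 2 / |M| belongs to R.                                            (1)

    To see (1), let A be the twisted group algebra of the dual of M.  It is a
    bimodule over itself, and this makes A a comodule over the span of the
    double coset M g M in the twisted coalgebra, with matrix coefficients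
    [comatrix].  By non-degeneracy of omega its character is |M| e g e
    ([comatrix_trace]).  Characters of comodules lie in X, because a form that
    is integral on X takes on them the trace of an integral matrix
    ([comatrix_trace_in]).  Dually chi is integral on X, hence X contains
    B = (chi (x) id) Delta (|M| e g e), and e B = B e = |M| chi(g e) e g e.  The
    element e B is integral because B is, so chi(e B) = |M| chi(g e) ^ 2 is in R
    ([coset_sum_square]), and S = |M| chi(g e).

    Take for chi the permutation character of G on its elements y with y ^ p = 1,
    for conjugation.  By theorems of Frobenius and Cauchy, chi(x) is 0 or 1
    modulo p according to whether p divides |C(x)| or not.  So (1) gives 1 / |M|
    in R as soon as some coset h M contains a number prime to p of elements h v
    such that p divides |C(h v)| ([regular_coset], [regular_coset_inv]).  It
    remains to find such a coset in each of the listed groups.  In a linear group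
    over a field of characteristic p, a matrix x with a cyclic vector satisfies
    p | |C(x)| exactly if its characteristic polynomial is not separable
    ([GL_cyclic_cent]), and conjugation puts M in unitriangular form.

    - In SL_2, h is antidiagonal, the polynomials are X^2 - b s X + 1 with b free
      and s in an additive subgroup of F_q, and b can be chosen such that one or
      two of them, according to the parity of p, have discriminant 0
      ([SL2_regular]).  The result passes to PSL_2 because the centre has order
      prime to p ([PSL2_regular]).
    - In SL_3(p), M has order p ^ 2 and h is monomial, chosen such that the
      polynomials of the h v are all the X^3 - t1 X^2 + t2 X - 1, each once.  The
      p - 1 polynomials (X - r)^2 (X - r^-2) are the non-separable ones
      ([SL3_regular]).
    - In a Suzuki group, M fixes a point of the ovoid, whose cardinality
      q ^ 2 + 1 is odd, and so is conjugate to a group of matrices u(a, b).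
      Being of central type it has exponent 2, that is a = 0.  For the
      antidiagonal involution w, the polynomial of w u(0, b) is separable except
      if b = 0 ([suzuki_regular]).

    Finally R is integrally closed, as is the ring of integers of K, and 1 / |M|
    is not an algebraic integer ([natr_inv_integral]). *)

Set Implicit Arguments.
Unset Strict Implicit.
Unset Printing Implicit Defensive.

Import GRing.Theory.
Local Open Scope ring_scope.

(** * Integrally closed subrings and traces of matrices *)

(** Speaks of polynomials over K with coefficients in R and not of polynomials
    over the type [subring_type R]; [integralOver_subringP] relates the two. *)
Definition integrally_closed (K : fieldType) (R : subringClosed K) : Prop :=
  forall (P : {poly K}) x,
    P \is monic -> P \is a polyOver R -> root P x -> x \in R.

Lemma polyOver_subring (K : fieldType) (R : subringClosed K) (P : {poly K}) :
  P \is a polyOver R ->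
  exists Q : {poly subring_type R}, P = map_poly (val : subring_type R -> K) Q.
Proof.
move=> /polyOverP RP.
exists (\poly_(i < size P) (Sub (P`_i) (RP i) : subring_type R)).
apply/polyP => i; rewrite coef_map coef_poly; case: ltnP => [_|/leq_sizeP->] //=.
Qed.

Lemma subring_map_monic (K : fieldType) (R : subringClosed K)
    (Q : {poly subring_type R}) :
  (map_poly (val : subring_type R -> K) Q \is monic) = (Q \is monic).
Proof.
by rewrite !qualifE /= lead_coef_map_inj ?rmorph0 //; first exact: val_inj.
Qed.

Lemma integralOver_subringP (K : fieldType) (R : subringClosed K) x :
  integralOver (val : subring_type R -> K) x <->
  exists P : {poly K}, [/\ P \is monic, P \is a polyOver R & root P x].
Proof.
split=> [[Q Qmon Qx]|[P [Pmon /polyOver_subring[Q defP]]]].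
  exists (map_poly (val : subring_type R -> K) Q); split=> //.
    by rewrite subring_map_monic.
  by apply/polyOverP=> i; rewrite coef_map; apply: valP.
by move: Pmon; rewrite defP subring_map_monic => Qmon Px; exists Q.
Qed.

Lemma char_poly_polyOver (K : fieldType) (R : subringClosed K) n
    (A : 'M[K]_n) : (forall i j, A i j \in R) -> char_poly A \is a polyOver R.
Proof.
move=> RA; pose B : 'M[subring_type R]_n := \matrix_(i, j) Sub (A i j) (RA i j).
have ->: A = map_mx (val : subring_type R -> K) B.
  by apply/matrixP=> i j; rewrite !mxE.
rewrite -map_char_poly; apply/polyOverP=> i; rewrite coef_map; exact: valP.
Qed.

Section NumberField.
Variable K : fieldExtType rat.

(** A number field is countable, being a rational vector space of finite
    dimension, so the algebraic closure of a countable field applies to it. *)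
Lemma closed_extension :
  exists (L : closedFieldType) (s : {rmorphism K -> L}), True.
Proof.
pose cK := PCanIsCountable (pcan_pickleK (can_pcan (@VectorInternalTheory.v2rK rat K))).
pose Kc : countFieldType := HB.pack K cK.
have [L [s _]] := countable_algebraic_closure Kc.
by exists L, s.
Qed.

(** Over an algebraic closure the trace is the sum of the roots of the
    characteristic polynomial.  They are roots of the minimal polynomial, hence
    of P, hence integral over R. *)
Lemma mxtrace_integral (R : subringClosed K) n (A : 'M[K]_n.+1) (P : {poly K}) :
  integrally_closed R -> P \is monic -> P \is a polyOver R ->
  horner_mx A P = 0 -> \tr A \in R.
Proof.
move=> icR Pmon RP PA0; have [L [s _]] := closed_extension.
pose sv : {rmorphism _ -> L} := s \o (val : subring_type R -> K).
have [Q defP] := polyOver_subring RP.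
pose B := map_mx s A.
have Bint r : root (char_poly B) r -> integralOver sv r.
  rewrite -root_mxminpoly => mr.
  exists Q; first by move: Pmon; rewrite defP subring_map_monic.
  rewrite map_poly_comp -defP.
  have: mxminpoly B %| map_poly s P.
    by apply: mxminpoly_min; rewrite -map_horner_mx PA0 map_mx0.
  by move/dvdpP=> [q ->]; rewrite rootM mr orbT.
have [rs defcp] := closed_field_poly_normal (char_poly B).
move: defcp; rewrite (monicP (char_poly_monic B)) scale1r => defcp.
have rsint : forall r, r \in rs -> integralOver sv r.
  by move=> r r_rs; apply: Bint; rewrite defcp root_prod_XsubC.
have trB : \tr B = \sum_(r <- rs) r.
  have szrs : size rs = n.+1.
    by have := size_char_poly B; rewrite defcp size_prod_XsubC => -[].
  have := char_poly_trace B (ltn0Sn n).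
  rewrite defcp /= -[n in _`_n]/(n.+1.-1) -{1}szrs.
  rewrite coefPn_prod_XsubC ?szrs //.
  by move/oppr_inj.
have: integralOver sv (\tr B).
  rewrite trB big_seq; elim/big_ind: _ => //; first exact: integral0.
  by move=> x y; apply: integral_add.
rewrite trace_map_mx => -[q qmon qr].
apply: (icR (map_poly (val : subring_type R -> K) q)).
- by rewrite subring_map_monic.
- by apply/polyOverP=> i; rewrite coef_map; apply: valP.
- by move: qr; rewrite map_poly_comp fmorph_root.
Qed.

End NumberField.

(** * Dual bases of orders *)

(** The uniqueness half of the universal property, for the bilinear map that
    sends u and v to g1 (b u v). *)
Lemma tensor_product_ext (A : comNzRingType) (U V W : lmodType A)
    (b : U -> V -> W) (P : lmodType A) (g1 g2 : {linear W -> P}) :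
  is_tensor_product b -> (forall u v, g1 (b u v) = g2 (b u v)) -> g1 =1 g2.
Proof.
move=> [bb tp] eqg; pose f u v := g1 (b u v).
have fb : bilinear_for *:%R *:%R f.
  split=> [u' a u v|u a u' v]; rewrite /f -linearP; congr (g1 _).
    exact: bb.1.
  exact: bb.2.
pose F : {bilinear U -> V -> P} :=
  HB.pack f (bilinear_isBilinear.Build _ _ _ _ _ _ _ fb).
have [g [_ uniq_g]] := tp _ F.
move=> w; rewrite (uniq_g g1) // (uniq_g g2) //.
by move=> u v; rewrite -eqg.
Qed.

Section DualBasis.
Variables (K : fieldType) (gT : finGroupType) (R : subringClosed K).
Local Notation KG := (group_algebra K gT).
Variable X : submodClosed (restrict_scalars R KG).
Local Notation b := (fun (x : submod_type X) (k : restrict_scalars R K^o) =>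
       (k : K) *: (val x : KG) : restrict_scalars R KG).

(** The bilinear map (x, k) |-> k c(x) induces an R-linear form on KG.  It
    commutes with the scaling by k in K because this holds on the elements
    l x with l in K and x in X, and [tensor_product_ext] applies. *)
Lemma extend_functional (c : {linear submod_type X -> (subring_type R)^o}) :
  is_tensor_product b ->
  exists f : {scalar KG}, forall x : submod_type X, f (val x : KG) = val (c x).
Proof.
move=> tp; pose W : lmodType _ := restrict_scalars R K^o.
pose h (x : submod_type X) (k : W) : W := (val (c x) : K) * (k : K).
have hb : bilinear_for *:%R *:%R h.
  split=> [k a x y|x a k l]; rewrite /h.
    by rewrite linearP /= mulrDl -mulrA.
  by rewrite mulrDr /= mulrCA.
pose H : {bilinear submod_type X -> W -> W} :=
  HB.pack h (bilinear_isBilinear.Build _ _ _ _ _ _ _ hb).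
have [g [gE _]] := tp.2 _ H.
have gZ (k : K) (z : KG) : g (k *: z) = k * (g z : K) :> K.
  pose g1 (w : restrict_scalars R KG) : W := g (k *: (w : KG)).
  pose g2 (w : restrict_scalars R KG) : W := k * (g w : K).
  have l1 : linear g1.
    move=> a u v; rewrite /g1 -linearP; congr (g _).
    rewrite [LHS]scalerDr; congr (_ + _).
    change (k *: ((val a : K) *: (u : KG)) = (val a : K) *: (k *: (u : KG))).
    by rewrite !scalerA mulrC.
  have l2 : linear g2.
    move=> a u v; rewrite /g2 linearP /= mulrDr; congr (_ + _).
    by rewrite [LHS]mulrCA.
  pose G1 : {linear restrict_scalars R KG -> W} :=
    HB.pack g1 (GRing.isLinear.Build _ _ _ _ _ l1).
  pose G2 : {linear restrict_scalars R KG -> W} :=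
    HB.pack g2 (GRing.isLinear.Build _ _ _ _ _ l2).
  apply: (@tensor_product_ext _ _ _ _ _ _ G1 G2 tp) => u v.
  rewrite /= /g1 /g2 scalerA.
  have e1 := gE u (k * v); have e2 := gE u v; rewrite /= in e1 e2.
  by rewrite e1 e2 /h mulrCA.
have glin : scalar (g : KG -> K).
  move=> k u v; rewrite -gZ; exact: raddfD.
pose f : {scalar KG} := HB.pack (g : KG -> K) (GRing.isLinear.Build _ _ _ _ _ glin).
exists f => x; have := gE x 1; rewrite /= scale1r => ->.
by rewrite /h mulr1.
Qed.

(** Projectivity splits the surjection from R^n to X given by generators, and
    the coordinates of a splitting extend to KG. *)
Lemma dual_basis :
  fin_gen (submod_type X) -> projective (submod_type X) ->
  is_tensor_product b ->
  exists N (e : 'I_N -> KG) (f : 'I_N -> {scalar KG}),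
    [/\ forall i, e i \in X, forall i x, x \in X -> f i x \in R
      & forall z, z = \sum_i f i z *: e i].
Proof.
move=> [n [e gen]] proj tp; pose A : comNzRingType := subring_type R.
pose g (v : 'rV[A]_n) : submod_type X := \sum_i v 0 i *: e i.
have gl : linear g.
  move=> a u v; rewrite /g scaler_sumr -big_split; apply: eq_bigr => i _ /=.
  by rewrite !mxE scalerDl scalerA.
pose G : {linear 'rV[A]_n -> submod_type X} :=
  HB.pack g (GRing.isLinear.Build _ _ _ _ _ gl).
have [|h hK] := proj _ _ G (idfun : {linear submod_type X -> submod_type X}).
  move=> w; have [c ->] := gen w; exists (\row_i c i).
  by rewrite /= /g; apply: eq_bigr => i _; rewrite mxE.
have coordl i : linear (fun u => h u 0 i : A^o).
  by move=> a u v; rewrite linearP !mxE.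
pose c i : {linear submod_type X -> A^o} :=
  HB.pack (fun u => h u 0 i : A^o) (GRing.isLinear.Build _ _ _ _ _ (coordl i)).
have /fin_all_exists[f fE] i := extend_functional (c i) tp.
exists n, (fun i => val (e i)), f; split=> [i|i x xX|z].
- exact: valP.
- by rewrite (fE i (Sub x xX)); apply: valP.
pose g2 (w : restrict_scalars R KG) : restrict_scalars R KG :=
  \sum_i f i w *: (val (e i) : KG).
have l2 : linear g2.
  move=> a u v; rewrite /g2 scaler_sumr -big_split; apply: eq_bigr => i _ /=.
  by rewrite [f i _]linearP scalerDl -scalerA.
pose G2 : {linear restrict_scalars R KG -> restrict_scalars R KG} :=
  HB.pack g2 (GRing.isLinear.Build _ _ _ _ _ l2).
apply: (@tensor_product_ext _ _ _ _ _ _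
  (idfun : {linear restrict_scalars R KG -> _}) G2 tp) => x k.
rewrite /= /g2.
under eq_bigr => i _ do rewrite linearZ /= fE -scalerA.
rewrite -scaler_sumr; congr (_ *: _).
transitivity (val (g (h x)) : KG); first by rewrite -[g _]/(G (h x)) hK.
by rewrite /g raddf_sum; apply: eq_bigr.
Qed.

End DualBasis.

(** * Group algebras and their tensor squares *)

Lemma horner_mx_sum (K : comNzRingType) n (A : 'M[K]_n.+1) (P : {poly K}) :
  horner_mx A P = \sum_(k < size P) P`_k *: A ^+ k.
Proof.
rewrite -{1}[P]coefK poly_def raddf_sum; apply: eq_bigr => k _ /=.
by rewrite linearZ /= rmorphXn /= horner_mx_X.
Qed.

Section GroupAlgebraTheory.
Variables (K : fieldType) (gT : finGroupType).
Local Notation KG := (group_algebra K gT).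
Local Notation elt := (galg_elt K).
Implicit Types (a b c d : KG) (g h : gT).

Lemma galg_expand a : a = \sum_g a g *: elt g.
Proof.
apply/ffunP=> x; rewrite sum_ffunE (bigD1 x) //= galg_scaleE ffunE eqxx mulr1.
rewrite big1 ?addr0 // => g ngx.
by rewrite galg_scaleE ffunE eq_sym (negPf ngx) mulr0.
Qed.

Lemma galg_eltM g h : elt g * elt h = elt (g * h)%g.
Proof.
apply/ffunP=> x; rewrite ffunE (bigD1 g) //= !ffunE eqxx mul1r.
rewrite big1 ?addr0 => [|y nyg]; last by rewrite ffunE (negPf nyg) mul0r.
congr ((_ : bool)%:R).
by apply/eqP/eqP=> [<-|->]; rewrite ?mulKVg ?mulKg.
Qed.

Lemma galg_tensorDr a : linear (galg_tensor a).
Proof.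
move=> k b b'; apply/ffunP=> z; rewrite galg_addE galg_scaleE !ffunE.
by rewrite mulrDr mulrCA.
Qed.

HB.instance Definition _ a := GRing.isLinear.Build K KG
  (group_algebra K (gT * gT)%type) _ (galg_tensor a) (galg_tensorDr a).

Lemma galg_tensor_elt g h : galg_tensor (elt g) (elt h) = elt (g, h).
Proof.
apply/ffunP=> -[x y]; rewrite !ffunE /= xpair_eqE.
by case: (x == g); rewrite ?mul1r ?mul0r.
Qed.

Lemma galg_tensorZl k a b : galg_tensor (k *: a) b = k *: galg_tensor a b.
Proof.
apply/ffunP=> z; rewrite [LHS]ffunE [RHS]galg_scaleE galg_scaleE.
by rewrite [galg_tensor _ _ _]ffunE mulrA.
Qed.

Lemma galg_tensorZr k a b : galg_tensor a (k *: b) = k *: galg_tensor a b.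
Proof. exact: linearZ. Qed.

Lemma galg_tensor_suml I r (P : pred I) (F : I -> KG) b :
  galg_tensor (\sum_(i <- r | P i) F i) b
    = \sum_(i <- r | P i) galg_tensor (F i) b.
Proof.
apply: (big_morph (fun a => galg_tensor a b)) => [a a'|].
  apply/ffunP=> z; rewrite [LHS]ffunE [RHS]galg_addE galg_addE mulrDl.
  by rewrite ![galg_tensor _ _ _]ffunE.
by apply/ffunP=> z; rewrite !ffunE mul0r.
Qed.

Lemma galg_tensor_sumr I r (P : pred I) (F : I -> KG) a :
  galg_tensor a (\sum_(i <- r | P i) F i)
    = \sum_(i <- r | P i) galg_tensor a (F i).
Proof. exact: raddf_sum. Qed.

Lemma galg_tensorM a b c d :
  galg_tensor a b * galg_tensor c d = galg_tensor (a * c) (b * d).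
Proof.
apply/ffunP=> -[x y]; rewrite !ffunE /= big_distrlr /= pair_bigA /=.
by apply: eq_bigr => -[g h] _; rewrite !ffunE /= mulrACA.
Qed.

(** The map f (x) id from the tensor square of KG to KG. *)
Definition slice (f : {scalar KG}) (z : group_algebra K (gT * gT)%type) : KG :=
  \sum_w z w *: (f (elt w.1) *: elt w.2).

Lemma slice_is_linear f : linear (slice f).
Proof.
move=> k z z'; rewrite /slice scaler_sumr -big_split; apply: eq_bigr => w _ /=.
by rewrite galg_addE galg_scaleE scalerDl !scalerA.
Qed.

HB.instance Definition _ f := GRing.isLinear.Build K
  (group_algebra K (gT * gT)%type) KG _ (slice f) (slice_is_linear f).

Lemma slice_tensor f a b : slice f (galg_tensor a b) = f a *: b.
Proof.
transitivity (\sum_g \sum_h (a g * b h) *: (f (elt g) *: elt h)).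
  by rewrite pair_bigA; apply: eq_bigr => -[g h] _; rewrite ffunE.
rewrite {2}[a]galg_expand linear_sum /= scaler_suml; apply: eq_bigr => g _.
rewrite {2}[b]galg_expand scaler_sumr; apply: eq_bigr => h _.
by rewrite [f (_ *: _)]linearZ /= !scalerA mulrAC.
Qed.

Lemma galg_counit_scalar : scalar (@galg_counit K gT).
Proof.
move=> k a b; rewrite /galg_counit mulr_sumr -big_split; apply: eq_bigr => g _.
by rewrite galg_addE galg_scaleE.
Qed.
HB.instance Definition _ := GRing.isLinear.Build K KG K *%R (@galg_counit K gT)
  galg_counit_scalar.

Lemma galg_counit_elt g : galg_counit (elt g) = 1.
Proof.
rewrite /galg_counit (bigD1 g) //= ffunE eqxx big1 ?addr0 // => h nhg.
by rewrite ffunE (negPf nhg).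
Qed.

Lemma galg_counitM a b : galg_counit (a * b) = galg_counit a * galg_counit b.
Proof.
rewrite {1}[a]galg_expand {1}[b]galg_expand mulr_suml linear_sum /=.
rewrite /(galg_counit a) mulr_suml; apply: eq_bigr => g _.
rewrite mulr_sumr linear_sum mulr_sumr; apply: eq_bigr => h _.
rewrite -scalerAl -scalerAr galg_eltM !linearZ /= galg_counit_elt.
by rewrite mulr1.
Qed.

End GroupAlgebraTheory.

(** * Characters and idempotents of an abelian subgroup *)

Section Characters.
Variables (K : fieldType) (gT : finGroupType) (M : {group gT}).
Hypothesis M_unit : #|M|%:R != 0 :> K.
Hypothesis K_large : split_group_algebra K M.
Local Notation KG := (group_algebra K gT).
Local Notation elt := (galg_elt K).
Local Notation dual := (dual_group K M).
Local Notation e := (@char_idempotent K gT M).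
Implicit Types phi psi : dual.

Lemma dual_eqP phi psi : (forall v, phi v = psi v) -> phi = psi.
Proof. by move=> eq_pp; apply/val_inj/ffunP. Qed.

Lemma dual_mulE phi psi v : (phi * psi)%g v = phi v * psi v.
Proof. exact: ffunE. Qed.

Lemma dual_oneE v : (1%g : dual) v = 1.
Proof. exact: ffunE. Qed.

Lemma dual_mulC phi psi : (phi * psi = psi * phi)%g.
Proof. by apply: dual_eqP => v; rewrite !dual_mulE mulrC. Qed.

Lemma dualV phi v : phi v^-1%g = (phi v)^-1.
Proof.
apply: (mulIf (dual_neq0 phi v)); rewrite -dualM mulVg dual1 mulVf //.
exact: dual_neq0.
Qed.

(** First orthogonality relation: if phi(u) <> 1, then translation by u multiplies
    the sum by phi(u). *)
Lemma dual_sum phi : \sum_v phi v = #|M|%:R * (phi == 1%g)%:R.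
Proof.
have [->|phi_neq1] := eqVneq; last rewrite mulr0.
  under eq_bigr => v _ do rewrite dual_oneE.
  by rewrite sumr_const -cardsT -(card_isog (isog_subg M)) mulr1.
have [/existsP[u phiu]|] := boolP [exists u, phi u != 1]; last first.
  rewrite negb_exists => /forallP phi1; case/eqP: phi_neq1.
  by apply: dual_eqP => v; rewrite dual_oneE; apply/eqP; have := phi1 v; rewrite negbK.
apply: (mulfI (_ : phi u - 1 != 0)); first by rewrite subr_eq0.
rewrite mulr0 mulrBl mul1r; apply/eqP; rewrite subr_eq0 mulr_sumr; apply/eqP.
rewrite [RHS](reindex_inj (mulgI u)) /=.
by apply: eq_bigr => v _; rewrite dualM.
Qed.

(** The coordinates of an isomorphism from KM to a power of K restrict to
    characters of M, and they separate the elements of M. *)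
Lemma dual_separates (v : subg_of M) : v != 1%g -> exists phi, phi v != 1.
Proof.
move=> v_neq1; have [f [flin [f1 fM] fbij]] := K_large.
pose w := @galg_elt K (subg_of M).
have [i fi] : exists i, f (w v) i != f (w 1%g) i.
  apply/existsP; apply: contraNT v_neq1; rewrite negb_exists => /forallP eqf.
  have /(bij_inj fbij)/ffunP/(_ v) : f (w v) = f (w 1%g).
    by apply/ffunP=> i; apply/eqP; have := eqf i; rewrite negbK.
  by rewrite !ffunE eqxx; case: eqP => // _ /eqP; rewrite oner_eq0.
have fw1 : f (w 1%g) i = 1 by transitivity (f 1 i); rewrite // f1 ffunE.
have fwM x y : f (w (x * y)%g) i = f (w x) i * f (w y) i.
  by rewrite /w -galg_eltM fM ffunE.
have Phi : @is_lin_char K gT M [ffun x => f (w x) i].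
  apply/andP; split.
    apply/forallP=> x; rewrite ffunE; apply/eqP=> fx0.
    have := fwM x x^-1%g; rewrite mulgV fw1 fx0 mul0r => /eqP.
    by rewrite oner_eq0.
  by apply/forallP=> x; apply/forallP=> y; rewrite !ffunE fwM.
by exists (Dual Phi); rewrite /= ffunE -fw1.
Qed.

Lemma dual_sum_at (v : subg_of M) :
  \sum_(phi : dual) phi v = #|{: dual}|%:R * (v == 1%g)%:R.
Proof.
have [->|v_neq1] := eqVneq; last rewrite mulr0.
  under eq_bigr => phi _ do rewrite dual1.
  by rewrite sumr_const mulr1.
have [psi psiv] := dual_separates v_neq1.
apply: (mulfI (_ : psi v - 1 != 0)); first by rewrite subr_eq0.
rewrite mulr0 mulrBl mul1r; apply/eqP; rewrite subr_eq0 mulr_sumr; apply/eqP.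
rewrite [RHS](reindex_inj (mulgI psi)) /=.
by apply: eq_bigr => phi _; rewrite dual_mulE.
Qed.

(** Both sides are the sum of the phi(v) over all pairs (phi, v). *)
Lemma card_dual : #|{: dual}|%:R = #|M|%:R :> K.
Proof.
transitivity (\sum_(phi : dual) \sum_v phi v).
  rewrite exchange_big (bigD1 1%g) //= dual_sum_at eqxx mulr1.
  by rewrite big1 ?addr0 // => v /negPf v1; rewrite dual_sum_at v1 mulr0.
under eq_bigr => phi _ do rewrite dual_sum.
rewrite (bigD1 1%g) //= eqxx mulr1.
by rewrite big1 ?addr0 // => phi /negPf ->; rewrite mulr0.
Qed.

Lemma elt_idem (v : subg_of M) phi : elt (sgval v) * e phi = phi v *: e phi.
Proof.
rewrite /char_idempotent -scalerAr scalerA mulrC -scalerA; congr (_ *: _).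
rewrite [in RHS](reindex_inj (mulgI v)) /= mulr_sumr scaler_sumr.
apply: eq_bigr => u _; rewrite -scalerAr galg_eltM scalerA invMg dualM.
by rewrite !dualV mulrCA mulfV ?dual_neq0 // mulr1.
Qed.

Lemma idem_elt (v : subg_of M) phi : e phi * elt (sgval v) = phi v *: e phi.
Proof.
rewrite /char_idempotent -scalerAl scalerA mulrC -scalerA; congr (_ *: _).
rewrite [in RHS](reindex_inj (mulIg v)) /= mulr_suml scaler_sumr.
apply: eq_bigr => u _; rewrite -scalerAl galg_eltM scalerA invMg dualM.
by rewrite !dualV mulrA mulfV ?dual_neq0 // mul1r.
Qed.

Lemma idemM phi psi : e phi * e psi = (phi == psi)%:R *: e phi.
Proof.
rewrite {1}/char_idempotent -scalerAl mulr_suml.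
under eq_bigr => v _ do
  rewrite -scalerAl elt_idem scalerA -[phi _ * _]/((phi v^-1)%g * psi v).
rewrite -scaler_suml scalerA.
have -> : \sum_(v : subg_of M) (phi v^-1)%g * psi v
          = \sum_v (phi^-1 * psi)%g v.
  by apply: eq_bigr => v _; rewrite dual_mulE ffunE dualV.
rewrite dual_sum mulKf // -eq_mulVg1.
by case: eqP => [->|]; rewrite ?scale0r.
Qed.

Lemma sum_idem : \sum_phi e phi = 1.
Proof.
rewrite /char_idempotent -scaler_sumr exchange_big /=.
under eq_bigr => v _ do rewrite -scaler_suml dual_sum_at.
rewrite (bigD1 1%g) //= big1 => [|v /negPf v1]; last first.
  by rewrite (inv_eq invgK) invg1 v1 mulr0 scale0r.
by rewrite addr0 invg1 eqxx mulr1 card_dual scalerA mulVf // scale1r.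
Qed.

Lemma counit_idem phi : galg_counit (e phi) = (phi == 1%g)%:R.
Proof.
rewrite /char_idempotent linearZ /= linear_sum /=.
under eq_bigr => v _ do rewrite linearZ /= galg_counit_elt mulr1 dualV.
have -> : \sum_(v : subg_of M) (phi v)^-1 = \sum_v (phi^-1)%g v.
  by apply: eq_bigr => v _; rewrite ffunE.
by rewrite dual_sum mulKf // (inv_eq invgK) invg1.
Qed.

End Characters.

(** * The twisted coalgebra of a double coset *)

Section CoproductLinear.
Variables (K : fieldType) (gT : finGroupType).
Variable Omega : group_algebra K (gT * gT)%type.

Lemma twisted_coproduct_is_linear : linear (twisted_coproduct Omega).
Proof.
move=> k a b; rewrite /twisted_coproduct scaler_sumr -big_split.
apply: eq_bigr => g _ /=.
by rewrite galg_addE galg_scaleE scalerDl scalerA.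
Qed.

HB.instance Definition _ := GRing.isLinear.Build K (group_algebra K gT)
  (group_algebra K (gT * gT)%type) _ (twisted_coproduct Omega)
  twisted_coproduct_is_linear.

End CoproductLinear.

Section Twisting.
Variables (K : fieldType) (gT : finGroupType) (M : {group gT}).
Hypothesis M_unit : #|M|%:R != 0 :> K.
Hypothesis K_large : split_group_algebra K M.
Local Notation KG := (group_algebra K gT).
Local Notation KGG := (group_algebra K (gT * gT)%type).
Local Notation elt := (galg_elt K).
Local Notation dual := (dual_group K M).
Local Notation e := (@char_idempotent K gT M).
Implicit Types phi psi : dual.

Variable omega : dual -> dual -> K.
Hypothesis omega_cocycle : cocycle2 omega.
Hypothesis omega_normalized : normalized_cocycle omega.
Hypothesis omega_nondegenerate : nondegenerate_cocycle omega.
Local Notation Om := (twist_elt omega).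

Definition twist_elt_inv : KGG :=
  \sum_phi \sum_psi (omega phi psi)^-1 *: galg_tensor (e phi) (e psi).
Local Notation Om' := twist_elt_inv.

Lemma omega_neq0 phi psi : omega phi psi != 0.
Proof. exact: omega_cocycle.1. Qed.

Lemma omegaP phi psi chi :
  omega phi psi * omega (phi * psi)%g chi =
  omega psi chi * omega phi (psi * chi)%g.
Proof. exact: omega_cocycle.2. Qed.

Lemma tensor_idemM phi psi phi' psi' :
  galg_tensor (e phi) (e psi) * galg_tensor (e phi') (e psi')
    = ((phi == phi') && (psi == psi'))%:R *: galg_tensor (e phi) (e psi).
Proof.
rewrite galg_tensorM !idemM // galg_tensorZl galg_tensorZr scalerA -natrM.
by rewrite mulnb.
Qed.

Lemma diag_twistM (a b : dual -> dual -> K) :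
  (\sum_phi \sum_psi a phi psi *: galg_tensor (e phi) (e psi)) *
  (\sum_phi \sum_psi b phi psi *: galg_tensor (e phi) (e psi))
  = \sum_phi \sum_psi (a phi psi * b phi psi) *: galg_tensor (e phi) (e psi).
Proof.
rewrite mulr_suml; apply: eq_bigr => phi _.
rewrite mulr_suml; apply: eq_bigr => psi _.
rewrite mulr_sumr (bigD1 phi) //= mulr_sumr (bigD1 psi) //=.
rewrite -scalerAl -scalerAr tensor_idemM !eqxx scale1r scalerA.
rewrite !big1 ?addr0 // => [phi' nphi|psi' npsi].
  rewrite mulr_sumr big1 // => psi' _.
  by rewrite -scalerAl -scalerAr tensor_idemM eq_sym (negPf nphi) scale0r !scaler0.
rewrite -scalerAl -scalerAr tensor_idemM eqxx eq_sym (negPf npsi).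
by rewrite scale0r !scaler0.
Qed.

Lemma sum_tensor_idem : \sum_phi \sum_psi galg_tensor (e phi) (e psi) = 1.
Proof.
under eq_bigr => phi _ do rewrite -galg_tensor_sumr sum_idem //.
rewrite -galg_tensor_suml sum_idem //; apply/ffunP=> -[x y].
by rewrite !ffunE /= -natrM mulnb.
Qed.

Lemma twist_mulV : Om * Om' = 1.
Proof.
rewrite /twist_elt /twist_elt_inv diag_twistM -sum_tensor_idem.
apply: eq_bigr => phi _; apply: eq_bigr => psi _.
by rewrite mulfV ?omega_neq0 // scale1r.
Qed.

Lemma twist_mulVl : Om' * Om = 1.
Proof.
rewrite /twist_elt /twist_elt_inv diag_twistM -sum_tensor_idem.
apply: eq_bigr => phi _; apply: eq_bigr => psi _.
by rewrite mulVf ?omega_neq0 // scale1r.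
Qed.

Lemma twist_inv : Om^-1 = Om'.
Proof.
have Ou : Om \is a GRing.unit.
  by apply/unitrP; exists Om'; split; [apply: twist_mulVl|apply: twist_mulV].
by rewrite -[RHS](mulKr Ou) twist_mulV mulr1.
Qed.

Definition untwisted_coproduct (a : KG) : KGG :=
  \sum_g a g *: galg_tensor (elt g) (elt g).
Local Notation D0 := untwisted_coproduct.

Lemma untwisted_coproduct_is_linear : linear D0.
Proof.
move=> k a b; rewrite /D0 scaler_sumr -big_split; apply: eq_bigr => g _ /=.
by rewrite galg_addE galg_scaleE scalerDl scalerA.
Qed.
HB.instance Definition _ := GRing.isLinear.Build K KG KGG _ D0 untwisted_coproduct_is_linear.

Lemma untwisted_coproduct_elt g : D0 (elt g) = elt (g, g).
Proof.
rewrite /D0 (bigD1 g) //= ffunE eqxx scale1r galg_tensor_elt.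
by rewrite big1 ?addr0 // => h /negPf nhg; rewrite ffunE nhg scale0r.
Qed.

Lemma untwisted_coproductM a b : D0 (a * b) = D0 a * D0 b.
Proof.
rewrite {1}[a]galg_expand {1}[b]galg_expand mulr_suml linear_sum /=.
rewrite [D0 a]/D0 mulr_suml; apply: eq_bigr => g _.
rewrite mulr_sumr linear_sum [D0 b]/D0 mulr_sumr; apply: eq_bigr => h _.
rewrite -scalerAl -!scalerAr -!scalerAl galg_tensorM !galg_eltM !linearZ /=.
by rewrite untwisted_coproduct_elt galg_tensor_elt.
Qed.

Lemma twisted_coproductE a : twisted_coproduct Om a = Om * D0 a * Om'.
Proof.
rewrite /twisted_coproduct twist_inv; move: (Om) (Om') => O O'.
rewrite /D0 mulr_sumr mulr_suml; apply: eq_bigr => g _.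
by rewrite -scalerAr -scalerAl.
Qed.

(** Delta(e_phi) is the average of the phi(v)^-1 (v (x) v), so it acts on an
    eigenvector of these group-like elements by an orthogonality relation. *)
Lemma eigen_untwisted_coproduct (z : KGG) phi1 phi :
    (forall v : subg_of M, z * elt (sgval v, sgval v) = phi1 v *: z) ->
  z * D0 (e phi) = (phi1 == phi)%:R *: z.
Proof.
move=> zP; rewrite /char_idempotent linearZ linear_sum /= -scalerAr mulr_sumr.
under eq_bigr => v _ do rewrite linearZ /= untwisted_coproduct_elt -scalerAr zP scalerA dualV.
rewrite -scaler_suml scalerA.
have -> : \sum_(v : subg_of M) (phi v)^-1 * phi1 v = \sum_v (phi^-1 * phi1)%g v.
  by apply: eq_bigr => v _; rewrite [RHS]dual_mulE [in RHS]ffunE.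
by rewrite dual_sum mulKf // -eq_mulVg1 eq_sym.
Qed.

Lemma untwisted_coproduct_eigen (z : KGG) phi1 phi :
    (forall v : subg_of M, elt (sgval v, sgval v) * z = phi1 v *: z) ->
  D0 (e phi) * z = (phi1 == phi)%:R *: z.
Proof.
move=> zP; rewrite /char_idempotent linearZ linear_sum /= -scalerAl mulr_suml.
under eq_bigr => v _ do rewrite linearZ /= untwisted_coproduct_elt -scalerAl zP scalerA dualV.
rewrite -scaler_suml scalerA.
have -> : \sum_(v : subg_of M) (phi v)^-1 * phi1 v = \sum_v (phi^-1 * phi1)%g v.
  by apply: eq_bigr => v _; rewrite [RHS]dual_mulE [in RHS]ffunE.
by rewrite dual_sum mulKf // -eq_mulVg1 eq_sym.
Qed.

(** Together with [sum_tensor_idem] this says that Delta(e_phi) is the sum of the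
    e_phi1 (x) e_phi2 over phi1 phi2 = phi. *)
Lemma tensor_idem_coproduct phi1 phi2 phi :
  galg_tensor (e phi1) (e phi2) * D0 (e phi)
    = ((phi1 * phi2)%g == phi)%:R *: galg_tensor (e phi1) (e phi2).
Proof.
apply: eigen_untwisted_coproduct => v; rewrite -galg_tensor_elt galg_tensorM !idem_elt.
by rewrite galg_tensorZl galg_tensorZr scalerA dual_mulE.
Qed.

Lemma coproduct_tensor_idem phi1 phi2 phi :
  D0 (e phi) * galg_tensor (e phi1) (e phi2)
    = ((phi1 * phi2)%g == phi)%:R *: galg_tensor (e phi1) (e phi2).
Proof.
apply: untwisted_coproduct_eigen => v; rewrite -galg_tensor_elt galg_tensorM !elt_idem.
by rewrite galg_tensorZl galg_tensorZr scalerA dual_mulE.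
Qed.

Lemma twist_coproduct phi :
  Om * D0 (e phi) = \sum_phi1 omega phi1 (phi1^-1 * phi)%g *:
                      galg_tensor (e phi1) (e (phi1^-1 * phi)%g).
Proof.
rewrite /twist_elt mulr_suml; apply: eq_bigr => phi1 _.
rewrite mulr_suml (bigD1 (phi1^-1 * phi)%g) //= -scalerAl tensor_idem_coproduct.
rewrite mulKVg eqxx scale1r big1 ?addr0 // => phi2 /negPf nphi2.
rewrite -scalerAl tensor_idem_coproduct -(inj_eq (mulgI phi1^-1%g)) mulKg nphi2.
by rewrite scale0r scaler0.
Qed.

Lemma coproduct_twist phi :
  D0 (e phi) * Om' = \sum_phi1 (omega phi1 (phi1^-1 * phi)%g)^-1 *:
                      galg_tensor (e phi1) (e (phi1^-1 * phi)%g).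
Proof.
rewrite /twist_elt_inv mulr_sumr; apply: eq_bigr => phi1 _.
rewrite mulr_sumr (bigD1 (phi1^-1 * phi)%g) //= -scalerAr coproduct_tensor_idem.
rewrite mulKVg eqxx scale1r big1 ?addr0 // => phi2 /negPf nphi2.
rewrite -scalerAr coproduct_tensor_idem -(inj_eq (mulgI phi1^-1%g)) mulKg nphi2.
by rewrite scale0r scaler0.
Qed.

Section DoubleCoset.
Variable g : gT.

Definition dcoset_elt phi psi : KG := e phi * elt g * e psi.
Local Notation x := dcoset_elt.

(** Omega is diagonal on the products of idempotents on the left of g (x) g, and
    its inverse on the right.  If the elements e_phi g e_psi are independent,
    then the dual of their span is the tensor product of the twisted group
    algebras of omega and of omega^-1. *)
Lemma coproduct_dcoset phi psi :
  twisted_coproduct Om (x phi psi) = \sum_phi1 \sum_psi1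
    (omega phi1 (phi1^-1 * phi)%g / omega psi1 (psi1^-1 * psi)%g) *:
      galg_tensor (x phi1 psi1) (x (phi1^-1 * phi)%g (psi1^-1 * psi)%g).
Proof.
rewrite twisted_coproductE /x !untwisted_coproductM !mulrA twist_coproduct -!mulrA coproduct_twist.
rewrite mulr_suml; apply: eq_bigr => phi1 _.
rewrite !mulr_sumr; apply: eq_bigr => psi1 _.
have scaleM (k l : K) (a b c : KGG) : k *: a * (b * (l *: c)) = (k * l) *: (a * b * c).
  by rewrite -scalerAr -scalerAl -scalerAr scalerA mulrA.
by rewrite scaleM untwisted_coproduct_elt -galg_tensor_elt !galg_tensorM.
Qed.

Lemma counit_dcoset phi psi :
  galg_counit (x phi psi) = ((phi == 1%g) && (psi == 1%g))%:R.
Proof.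
rewrite !galg_counitM !counit_idem // galg_counit_elt mulr1 -natrM.
by rewrite mulnb.
Qed.

(** Let A be the twisted group algebra of omega, with basis (u_phi).  It is a
    bimodule over itself, and u_psi^-1 multiplies like the basis of the twisted
    group algebra of omega^-1.  As u_phi u_alpha u_psi^-1 is
    omega(phi, alpha) / omega(beta, psi) times u_beta with beta psi = phi alpha,
    the formula below is the matrix coefficient (beta, alpha) of the comodule A,
    with e_phi g e_psi as the coordinate of the operator of phi and psi. *)
Definition comatrix beta alpha : KG := \sum_phi
  (omega phi alpha / omega beta (beta^-1 * (phi * alpha))%g) *:
    x phi (beta^-1 * (phi * alpha))%g.

(** Both sides expand over triples (phi1, phi2, gamma); the coefficients agree
    by three instances of the cocycle identity. *)
Lemma comatrix_coproduct beta alpha :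
  twisted_coproduct Om (comatrix beta alpha) =
    \sum_gamma galg_tensor (comatrix beta gamma) (comatrix gamma alpha).
Proof.
transitivity (\sum_phi1 \sum_phi2 \sum_gamma
   ((omega phi1 gamma / omega beta (beta^-1 * (phi1 * gamma))%g) *
    (omega phi2 alpha / omega gamma (gamma^-1 * (phi2 * alpha))%g)) *:
   galg_tensor (x phi1 (beta^-1 * (phi1 * gamma))%g)
               (x phi2 (gamma^-1 * (phi2 * alpha))%g)); last first.
  under eq_bigr => phi1 _ do rewrite exchange_big /=.
  rewrite exchange_big /=; apply: eq_bigr => gamma _.
  rewrite /comatrix galg_tensor_suml; apply: eq_bigr => phi1 _.
  rewrite galg_tensor_sumr; apply: eq_bigr => phi2 _.
  by rewrite galg_tensorZl galg_tensorZr scalerA.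
rewrite /comatrix linear_sum /=.
under eq_bigr => phi _ do rewrite linearZ /= coproduct_dcoset.
under eq_bigr => phi _ do rewrite scaler_sumr.
rewrite exchange_big /=; apply: eq_bigr => phi1 _.
rewrite (reindex_inj (mulgI phi1)) /=; apply: eq_bigr => phi2 _.
rewrite scaler_sumr (reindex_inj (mulgI (beta^-1 * phi1)%g)) /=.
apply: eq_bigr => gamma _; rewrite scalerA mulKg -!mulgA !invMg !invgK.
rewrite -!mulgA !mulKVg !mulKg; congr (_ *: _).
have c1 := omegaP phi1 phi2 alpha.
have := omegaP beta (beta^-1 * (phi1 * gamma))%g (gamma^-1 * (phi2 * alpha))%g.
rewrite -!mulgA !mulKVg => c2.
have := omegaP phi1 gamma (gamma^-1 * (phi2 * alpha))%g.
rewrite !mulKVg => c3.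
move: c1 c2 c3.
set A := omega (phi1 * phi2)%g alpha; set B := omega beta (beta^-1 * _)%g.
set C := omega phi1 phi2; set D := omega (beta^-1 * _)%g _.
set E := omega phi1 gamma; set F := omega beta _; set G := omega phi2 alpha.
set H := omega gamma _.
set J := omega (phi1 * gamma)%g _; set I := omega phi1 (phi2 * alpha)%g.
move=> c1 c2 c3; rewrite !mulf_div; apply/eqP.
rewrite eqr_div ?mulf_neq0 ?omega_neq0 //; apply/eqP.
have -> : A * C * (B * H) = (C * A) * (B * H) by ring.
have -> : C * A * (B * H) = (H * I) * (G * B) by rewrite c1; ring.
have -> : H * I * (G * B) = (B * J) * (E * G) by rewrite -c3; ring.
by rewrite c2; ring.
Qed.

Lemma comatrix_counit beta alpha :
  galg_counit (comatrix beta alpha) = (beta == alpha)%:R.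
Proof.
rewrite /comatrix linear_sum (bigD1 1%g) //= big1 => [|phi /negPf phi1].
  rewrite addr0 linearZ /= counit_dcoset eqxx mul1g -eq_mulVg1.
  have [->|_] := eqVneq; last by rewrite mulr0.
  rewrite mulVg mulr1; have [-> ->] := omega_normalized alpha.
  by rewrite divr1.
by rewrite linearZ /= counit_dcoset phi1 mulr0.
Qed.

(** The commutator pairing of a cocycle on an abelian group is bimultiplicative. *)
Lemma pairing_mul phi alpha beta :
  omega phi (alpha * beta)%g / omega (alpha * beta)%g phi =
  (omega phi alpha / omega alpha phi) * (omega phi beta / omega beta phi).
Proof.
have c1 := omegaP phi alpha beta; have c2 := omegaP alpha beta phi.
have := omegaP alpha phi beta; rewrite (dual_mulC alpha phi) => c3.
rewrite (dual_mulC beta phi) in c2.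
move: c1 c2 c3.
set A := omega phi alpha; set B := omega _ beta; set C := omega alpha beta.
set D := omega phi (alpha * beta)%g; set E := omega (alpha * beta)%g phi.
set F := omega beta phi; set G := omega alpha _; set H := omega alpha phi.
set J := omega phi beta => c1 c2 c3.
rewrite mulf_div; apply/eqP.
rewrite eqr_div ?mulf_neq0 ?omega_neq0 //; apply/eqP.
apply: (mulfI (_ : C * G != 0)); first by rewrite mulf_neq0 ?omega_neq0.
have -> : C * G * (D * (H * F)) = (C * D) * (F * G) * H by ring.
have -> : C * D * (F * G) * H = (H * B) * (C * E) * A by rewrite -c1 -c2; ring.
by rewrite c3; ring.
Qed.

(** For alpha = beta the only terms have phi = psi, and e_phi g e_phi has as
    coefficient the sum over alpha of the values of the commutator pairing at
    (phi, alpha), which vanishes for phi <> 1 by non-degeneracy.  The factor is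
    |M| and not |M|^2, which the regular comodule would give: this is what makes
    the final divisibility nontrivial. *)
Lemma comatrix_trace :
  \sum_alpha comatrix alpha alpha = #|M|%:R *: x 1%g 1%g.
Proof.
rewrite /comatrix exchange_big /=.
have pair1 phi : \sum_alpha (omega phi alpha / omega alpha phi)
    = #|M|%:R * (phi == 1%g)%:R.
  have [->|phi_neq1] := eqVneq; last rewrite mulr0.
    under eq_bigr => alpha _.
      have [-> ->] := omega_normalized alpha; rewrite divr1; over.
    by rewrite sumr_const mulr1 card_dual.
  have [/existsP[u phiu]|] := boolP [exists u, omega phi u / omega u phi != 1].
    apply: (mulfI (_ : omega phi u / omega u phi - 1 != 0)).
      by rewrite subr_eq0.
    rewrite mulr0 mulrBl mul1r; apply/eqP; rewrite subr_eq0 mulr_sumr; apply/eqP.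
    rewrite [RHS](reindex_inj (mulgI u)) /=.
    by apply: eq_bigr => v _; rewrite pairing_mul.
  rewrite negb_exists => /forallP phi1; case/eqP: phi_neq1.
  apply: omega_nondegenerate => psi; apply/eqP.
  by have := phi1 psi; rewrite negbK.
under eq_bigr => phi _.
  under eq_bigr => alpha _ do rewrite (dual_mulC phi alpha) mulKg.
  rewrite -scaler_suml pair1; over.
rewrite (bigD1 1%g) //= eqxx mulr1 big1 ?addr0 // => phi /negPf ->.
by rewrite mulr0 scale0r.
Qed.

End DoubleCoset.
End Twisting.

(** * Elements of an order and integral functionals *)

Lemma fin_ord_bij (T : finType) (x0 : T) :
  exists n (s : 'I_n.+1 -> T), bijective s.
Proof.
have [n cardT] : exists n, #|T| = n.+1.
  by exists #|T|.-1; rewrite prednK //; apply/card_gt0P; exists x0.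
exists n, (fun i => enum_val (cast_ord (esym cardT) i)).
apply: bij_comp; first exact: enum_val_bij.
by exists (cast_ord cardT); [apply: cast_ordKV | apply: cast_ordK].
Qed.

Section OrderTheory.
Variables (K : fieldExtType rat) (gT : finGroupType) (R : subringClosed K).
Local Notation KG := (group_algebra K gT).
Variable X : submodClosed (restrict_scalars R KG).
Hypothesis icR : integrally_closed R.
Hypothesis Xfg : fin_gen (submod_type X).
Hypothesis Xproj : projective (submod_type X).
Hypothesis Xtensor : is_tensor_product
    (fun (x : submod_type X) (k : restrict_scalars R K^o) =>
       (k : K) *: (val x : KG) : restrict_scalars R KG).

Lemma order_scale (k : K) (x : KG) : k \in R -> x \in X -> k *: x \in X.
Proof. by move=> Rk Xx; apply: (@rpredZ _ _ X (Sub k Rk : subring_type R)). Qed.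

Lemma order_sum I r (P : pred I) (F : I -> KG) :
  (forall i, P i -> F i \in X) -> \sum_(i <- r | P i) F i \in X.
Proof. by move=> XF; apply: (@rpred_sum _ X). Qed.

(** By the dual basis, an order is equal to its bidual. *)
Lemma order_dualP (z : KG) :
    (forall f : {scalar KG}, (forall x, x \in X -> f x \in R) -> f z \in R) ->
  z \in X.
Proof.
move=> fz; have [N [e [f [eX fX dec]]]] := dual_basis Xfg Xproj Xtensor.
rewrite (dec z); apply: order_sum => i _; apply: order_scale => //.
exact/fz/fX.
Qed.

(** On the coordinates of a dual basis T acts by the matrix of the f_i (T e_j),
    which has entries in R, and Cayley-Hamilton applies. *)
Lemma order_annihilator (T : {linear KG -> KG}) :
    (forall x, x \in X -> T x \in X) ->
  exists P : {poly K}, [/\ P \is monic, P \is a polyOver R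
    & forall z, \sum_(k < size P) P`_k *: iter k T z = 0].
Proof.
move=> TX; have [N [e [f [eX fX dec]]]] := dual_basis Xfg Xproj Xtensor.
case: N e f eX fX dec => [|N] e f eX fX dec.
  exists 1; split; [exact: monic1 | exact: rpred1 |] => z.
  by rewrite [LHS]dec big_ord0.
pose A : 'M[K]_N.+1 := \matrix_(i, j) f i (T (e j)).
pose v (z : KG) : 'cV[K]_N.+1 := \col_i f i z.
have vT z : v (T z) = A *m v z.
  apply/matrixP=> i j; rewrite !mxE {1}[z]dec !linear_sum.
  by apply: eq_bigr => k _; rewrite !mxE !linearZ mulrC.
have viter k z : v (iter k T z) = A ^+ k *m v z.
  elim: k => [|k IHk]; first by rewrite expr0 mul1mx.
  by rewrite iterS vT IHk exprS mulmxA.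
exists (char_poly A); split; first exact: char_poly_monic.
  by apply: char_poly_polyOver => i j; rewrite mxE; apply/fX/TX/eX.
move=> z; set P := char_poly A; set y := \sum_(_ < _) _.
have y0 : v y = 0.
  transitivity (horner_mx A P *m v z); last by rewrite Cayley_Hamilton mul0mx.
  rewrite horner_mx_sum mulmx_suml; apply/matrixP=> i j; rewrite summxE mxE.
  rewrite linear_sum; apply: eq_bigr => k _.
  by rewrite -scalemxAl -viter !mxE linearZ.
rewrite [y]dec big1 // => i _; have /matrixP/(_ i 0) := y0.
by rewrite !mxE => ->; rewrite scale0r.
Qed.

Section Functional.
Variable Omega : group_algebra K (gT * gT)%type.
Hypothesis Xcoprod : forall x : KG, x \in X ->
  in_tensor_square X (twisted_coproduct Omega x).

Lemma order_slice (f : {scalar KG}) (x : KG) :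
    (forall x, x \in X -> f x \in R) -> x \in X ->
  slice f (twisted_coproduct Omega x) \in X.
Proof.
move=> fX /Xcoprod[n [y [z ->]]]; rewrite linear_sum /=.
apply: order_sum => i _; rewrite slice_tensor; apply: order_scale; last by case: (z i).
by apply: fX; case: (y i).
Qed.

(** If f is integral on X, then T = (f (x) id) Delta preserves X and is
    annihilated by some monic P over R.  As T acts on the columns of c by the
    matrix F of the f (c i j), and the counit maps c to the identity matrix, P
    annihilates F too.  So f takes an integral value, the trace of F, at the sum
    of the c i i. *)
Lemma comatrix_trace_in n (c : 'I_n.+1 -> 'I_n.+1 -> KG) :
    (forall i j, twisted_coproduct Omega (c i j)
                   = \sum_k galg_tensor (c i k) (c k j)) ->
    (forall i j, galg_counit (c i j) = (i == j)%:R) ->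
  \sum_i c i i \in X.
Proof.
move=> cD c1; apply: order_dualP => f fX.
pose F : 'M[K]_n.+1 := \matrix_(i, j) f (c i j).
pose T : {linear KG -> KG} := slice f \o twisted_coproduct Omega.
have [|P [Pmon RP PT]] := @order_annihilator T.
  by move=> x; apply: order_slice.
have iterT k i j : iter k T (c i j) = \sum_l (F ^+ k) i l *: c l j.
  elim: k i j => [|k IHk] i j.
    rewrite (bigD1 i) //= mxE eqxx scale1r big1 ?addr0 // => l.
    by rewrite mxE eq_sym => /negPf->; rewrite scale0r.
  rewrite iterS IHk linear_sum exprSr.
  under eq_bigr => l _ do rewrite linearZ /= cD [slice f _]linear_sum scaler_sumr.
  rewrite exchange_big /=; apply: eq_bigr => l _.
  rewrite [in RHS]mxE scaler_suml; apply: eq_bigr => m _.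
  by rewrite slice_tensor scalerA mxE.
have F0 : horner_mx F P = 0.
  apply/matrixP=> i j; rewrite horner_mx_sum summxE mxE.
  have := congr1 (@galg_counit K gT) (PT (c i j)).
  rewrite linear0 linear_sum /= => PT0; rewrite -[RHS]PT0.
  apply: eq_bigr => k _; rewrite linearZ /= iterT linear_sum /= mxE.
  rewrite (bigD1 j) //= linearZ /= c1 eqxx mulr1 big1 ?addr0 // => l.
  by rewrite linearZ /= c1 => /negPf->; rewrite mulr0.
have := mxtrace_integral icR Pmon RP F0.
by rewrite /mxtrace linear_sum /=; under eq_bigr do rewrite mxE.
Qed.

End Functional.

Section Trace.
Variables (n : nat) (rho : {linear KG -> 'M[K]_n.+1}).
Hypothesis rhoM : forall a b, rho (a * b) = rho a * rho b.
Hypothesis XM : forall x y : KG, x \in X -> y \in X -> x * y \in X.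

(** If P annihilates the multiplication by B, then 'X * P annihilates u B, as
    (u B) ^ k.+1 = u B ^ k.+1.  As no constant term is left, rho may
    map 1 to a proper idempotent, which the conjugation character requires. *)
Lemma corner_trace (B u : KG) :
  B \in X -> u * u = u -> u * B = B * u -> \tr (rho (u * B)) \in R.
Proof.
move=> XB uu uB; have mulB_linear : linear (fun x : KG => B * x).
  by move=> k x y; rewrite mulrDr -scalerAr.
pose T : {linear KG -> KG} :=
  HB.pack (fun x : KG => B * x) (GRing.isLinear.Build _ _ _ _ _ mulB_linear).
have [|P [Pmon RP PT]] := @order_annihilator T.
  by move=> x Xx; apply: XM.
have iterT k : iter k T 1 = B ^+ k.
  by elim: k => // k IHk; rewrite iterS IHk exprS.
apply: (@mxtrace_integral _ R _ _ (P * 'X)) => //.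
- by rewrite monicMr ?monicX.
- by rewrite rpredM // polyOverX.
rewrite rmorphM /= horner_mx_X horner_mx_sum.
have pw k : rho (u * B) ^+ k * rho (u * B) = rho (u * B ^+ k.+1).
  elim: k => [|k IHk]; first by rewrite mul1r expr1.
  rewrite exprS -mulrA IHk -rhoM; congr (rho _).
  by rewrite [B ^+ k.+2]exprS -mulrA [B * (u * _)]mulrA -uB !mulrA uu.
rewrite mulr_suml.
under eq_bigr => k _ do rewrite -scalerAl pw exprS mulrA -iterT.
transitivity (rho ((u * B) * \sum_(k < size P) P`_k *: iter k T 1)).
  rewrite mulr_sumr linear_sum; apply: eq_bigr => k _.
  by rewrite -scalerAr linearZ.
by rewrite PT mulr0 linear0.
Qed.

End Trace.
End OrderTheory.

(** * Sums of a character over a coset *)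

Lemma num_field_natr (K : fieldExtType rat) n : (n%:R == 0 :> K) = (n == 0)%N.
Proof.
rewrite -(rmorph_nat (in_alg K)) fmorph_eq0.
exact: Num.Theory.pnatr_eq0.
Qed.

Section CosetSum.
Variables (gT : finGroupType) (M : {group gT}) (K : fieldExtType rat).
Variable omega : dual_group K M -> dual_group K M -> K.
Hypothesis K_large : split_group_algebra K M.
Hypothesis omega_cocycle : cocycle2 omega.
Hypothesis omega_normalized : normalized_cocycle omega.
Hypothesis omega_nondegenerate : nondegenerate_cocycle omega.
Local Notation KG := (group_algebra K gT).
Local Notation elt := (galg_elt K).
Local Notation dual := (dual_group K M).
Local Notation e := (@char_idempotent K gT M).
Local Notation Om := (twist_elt omega).
Variable R : subringClosed K.
Hypothesis icR : integrally_closed R.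
Variable X : submodClosed (restrict_scalars R KG).
Hypothesis XH : hopf_order (twisted_galg Om) X.

Lemma card_group_unit : #|M|%:R != 0 :> K.
Proof. by rewrite num_field_natr -lt0n cardG_gt0. Qed.
Let Mu := card_group_unit.

Variable g : gT.
Local Notation x := (@dcoset_elt K gT M g).

(** The character of a comodule lies in every order. *)
Lemma dcoset_in_order : #|M|%:R *: x 1%g 1%g \in X.
Proof.
rewrite -(comatrix_trace K_large omega_cocycle omega_normalized
            omega_nondegenerate g).
have [n [s s_bij]] := fin_ord_bij (1%g : dual).
rewrite (reindex s) /=; last exact: onW_bij.
apply: (@comatrix_trace_in _ _ _ _ icR (ho_fin_gen XH) (ho_projective XH)
  (ho_extension XH) _ (ho_coproduct XH) _
  (fun i j => comatrix omega g (s i) (s j))) => i j.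
  rewrite comatrix_coproduct // (reindex s) //; exact: onW_bij.
by rewrite comatrix_counit // (bij_eq s_bij).
Qed.

Variable chi : {scalar KG}.
Hypothesis traceC : forall a b, chi (a * b) = chi (b * a).
Hypothesis chi_corner : forall B u : KG,
  B \in X -> u * u = u -> u * B = B * u -> chi (u * B) \in R.

(** The element (chi (x) id) Delta (|M| e g e). *)
Definition coset_slice : KG :=
  slice chi (twisted_coproduct Om (#|M|%:R *: x 1%g 1%g)).
Local Notation B := coset_slice.

Lemma coset_slice_in : B \in X.
Proof.
apply: (@order_slice _ _ _ _ _ (ho_coproduct XH)); last exact: dcoset_in_order.
by move=> a Xa; rewrite -[a]mul1r chi_corner ?mul1r ?mulr1.
Qed.

Lemma coset_sliceE : B = #|M|%:R *: \sum_phi \sum_psi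
    (omega phi phi^-1%g / omega psi psi^-1%g * chi (x phi psi)) *:
       x phi^-1%g psi^-1%g.
Proof.
rewrite /coset_slice linearZ [in LHS]linearZ /=; congr (_ *: _).
rewrite coproduct_dcoset // [LHS]linear_sum; apply: eq_bigr => phi _.
rewrite [LHS]linear_sum; apply: eq_bigr => psi _.
by rewrite [LHS]linearZ /= slice_tensor scalerA !mulg1.
Qed.

Lemma idem_dcoset phi psi : e 1%g * x phi psi = (phi == 1%g)%:R *: x phi psi.
Proof.
rewrite /dcoset_elt !mulrA idemM // -!scalerAl eq_sym.
by case: eqP => [->|]; rewrite ?scale0r.
Qed.

Lemma dcoset_idem phi psi : x phi psi * e 1%g = (psi == 1%g)%:R *: x phi psi.
Proof. by rewrite /dcoset_elt -!mulrA idemM // -!scalerAr. Qed.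

(** As chi is central, e_phi g e_psi has the same trace as g e_psi e_phi. *)
Lemma trace_dcoset phi psi : phi != psi -> chi (x phi psi) = 0.
Proof.
move=> npp; rewrite /dcoset_elt traceC mulrA idemM // eq_sym (negPf npp).
by rewrite scale0r mul0r linear0.
Qed.

(** Multiplication by e leaves the terms with phi = 1, and among these
    [trace_dcoset] leaves the one with psi = 1. *)
Lemma idem_slice :
  e 1%g * B = (#|M|%:R * chi (x 1%g 1%g)) *: x 1%g 1%g.
Proof.
rewrite coset_sliceE -scalerAr -scalerA; congr (_ *: _).
rewrite pair_bigA mulr_sumr (bigD1 (1%g, 1%g)) //= big1 => [|[phi psi] /=].
  rewrite addr0 -scalerAr idem_dcoset invg1 eqxx scale1r.
  by rewrite mulfV ?mul1r // omega_neq0.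
rewrite xpair_eqE -scalerAr idem_dcoset (inv_eq invgK) invg1.
have [->|_ _] := eqVneq phi 1%g; last by rewrite scale0r scaler0.
by move=> npsi; rewrite trace_dcoset 1?eq_sym // mulr0 scale0r.
Qed.

Lemma slice_idem :
  B * e 1%g = (#|M|%:R * chi (x 1%g 1%g)) *: x 1%g 1%g.
Proof.
rewrite coset_sliceE -scalerAl -scalerA; congr (_ *: _).
rewrite pair_bigA mulr_suml (bigD1 (1%g, 1%g)) //= big1 => [|[phi psi] /=].
  rewrite addr0 -scalerAl dcoset_idem invg1 eqxx scale1r.
  by rewrite mulfV ?mul1r // omega_neq0.
rewrite xpair_eqE -scalerAl dcoset_idem (inv_eq invgK) invg1.
have [->|_ _] := eqVneq psi 1%g; last by rewrite scale0r scaler0.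
by rewrite andbT => nphi; rewrite trace_dcoset // mulr0 scale0r.
Qed.

Lemma trace_dcoset1 :
  chi (x 1%g 1%g) = #|M|%:R^-1 * \sum_(v in M) chi (elt (g * v)%g).
Proof.
rewrite /dcoset_elt traceC mulrA idemM // eqxx scale1r traceC.
rewrite /char_idempotent -scalerAr linearZ; congr (_ * _).
rewrite mulr_sumr linear_sum [RHS](reindex (@sgval gT M)) /=.
  apply: eq_big => [v|v _]; first by rewrite subgP.
  by rewrite -scalerAr linearZ dual_oneE galg_eltM /= mul1r.
exists (subg M) => v; first by rewrite sgvalK.
by move=> Mv; rewrite subgK.
Qed.

(** By the corner property of chi, R contains the value of chi at
    e B = |M| chi(g e) e g e, which is |M| chi(g e)^2; and |M| chi(g e) is the sum
    of chi over g M. *)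
Lemma coset_sum_square :
  (\sum_(v in M) chi (elt (g * v)%g)) ^+ 2 / #|M|%:R \in R.
Proof.
have := chi_corner coset_slice_in (_ : e 1%g * e 1%g = e 1%g).
rewrite idem_slice slice_idem idemM // eqxx scale1r => /(_ erefl erefl).
rewrite linearZ /= trace_dcoset1; congr (_ \in R).
set S := \sum_(v in M) _; rewrite (mulrA #|M|%:R _ S) mulfV // mul1r.
by rewrite mulrCA -expr2 mulrC.
Qed.

End CosetSum.

(** * The conjugation character *)

(** For M <> 1 a p-group this says that the conjugation character, which sends x
    to the number of the y in C(x) with y ^ p = 1, has a sum prime to p over some
    coset h M; see [card_Ldiv_modp]. *)
Definition regular_coset (p : nat) (gT : finGroupType) (G M : {group gT}) :=
  exists2 h, h \in G &
    ~~ (p %| #|[set v in M | p %| #|'C_G[h * v]%g|]|)%N.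

Section ConjugationCharacter.
Variables (K : fieldType) (gT : finGroupType) (p n : nat) (s : 'I_n.+1 -> gT).
Hypothesis s_bij : bijective s.
Local Notation KG := (group_algebra K gT).

(** Conjugation by g on the y with y ^ p = 1, extended by zero to all of gT.  So
    the identity element acts by a projection. *)
Definition conj_mx (g : gT) : 'M[K]_n.+1 :=
  \matrix_(i, j) (((s i ^+ p)%g == 1%g) && (s j == (s i ^ g)%g))%:R.

Lemma conj_mxM g h : conj_mx (g * h)%g = conj_mx g * conj_mx h.
Proof.
apply/matrixP=> i k; have [t sK tK] := s_bij.
rewrite !mxE (bigD1 (t (s i ^ g)%g)) //= !mxE tK eqxx andbT big1 => [|j].
  by rewrite addr0 -conjXg conjg_eq1 -conjgM -natrM mulnb andbA andbb.
rewrite -(inj_eq (can_inj sK)) tK => /negPf nj.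
by rewrite !mxE nj andbF mul0r.
Qed.

Lemma conj_mx_trace g : \tr (conj_mx g) = #|'Ldiv_p('C[g])%g|%:R.
Proof.
transitivity (\sum_(y : gT) ((y ^+ p == 1)%g && (y == y ^ g)%g)%:R : K).
  rewrite [RHS](reindex s) /=; last exact: onW_bij.
  by apply: eq_bigr => i _; rewrite mxE.
rewrite -natr_sum -sum1_card; congr _%:R; rewrite [RHS]big_mkcond /=.
apply: eq_bigr => y _; have -> : (y == y ^ g)%g = (y \in 'C[g])%g.
  by rewrite eq_sym conjg_fix; apply/commgP/cent1P.
by rewrite andbC !in_setI !inE; case: (_ && _).
Qed.

Definition conj_rep (a : KG) : 'M[K]_n.+1 := \sum_g a g *: conj_mx g.

Lemma conj_rep_is_linear : linear conj_rep.
Proof.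
move=> k a b; rewrite /conj_rep scaler_sumr -big_split; apply: eq_bigr => g _ /=.
by rewrite galg_addE galg_scaleE scalerDl scalerA.
Qed.
HB.instance Definition _ :=
  GRing.isLinear.Build K KG 'M[K]_n.+1 _ conj_rep conj_rep_is_linear.

Lemma conj_rep_elt g : conj_rep (galg_elt K g) = conj_mx g.
Proof.
rewrite /conj_rep (bigD1 g) //= ffunE eqxx scale1r big1 ?addr0 // => h.
by move/negPf=> nhg; rewrite ffunE nhg scale0r.
Qed.

Lemma conj_repM a b : conj_rep (a * b) = conj_rep a * conj_rep b.
Proof.
rewrite {1}[a]galg_expand {1}[b]galg_expand mulr_suml linear_sum /=.
rewrite [conj_rep a]/conj_rep mulr_suml; apply: eq_bigr => g _.
rewrite mulr_sumr linear_sum [conj_rep b]/conj_rep mulr_sumr.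
apply: eq_bigr => h _.
rewrite -scalerAl -!scalerAr -!scalerAl galg_eltM !linearZ /=.
by rewrite conj_rep_elt conj_mxM.
Qed.

Lemma conj_trace_is_scalar : scalar (fun a => \tr (conj_rep a)).
Proof. by move=> k a b; rewrite linearP mxtraceD mxtraceZ. Qed.

Definition conj_character : {scalar KG} :=
  HB.pack (fun a => \tr (conj_rep a))
    (GRing.isLinear.Build _ _ _ _ _ conj_trace_is_scalar).

Lemma conj_characterC a b : conj_character (a * b) = conj_character (b * a).
Proof. by rewrite /= !conj_repM mxtrace_mulC. Qed.

Lemma conj_character_elt g :
  conj_character (galg_elt K g) = #|'Ldiv_p('C[g])%g|%:R.
Proof. by rewrite /= conj_rep_elt conj_mx_trace. Qed.

End ConjugationCharacter.

(** If p divides |G| this is a theorem of Frobenius; otherwise 1 is the only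
    solution of y ^ p = 1. *)
Lemma card_Ldiv_modp (p : nat) (gT : finGroupType) (G : {group gT}) :
  prime p -> #|'Ldiv_p(G)%g| = ~~ (p %| #|G|)%N %[mod p].
Proof.
move=> p_pr; have [pG|p'G] := boolP (p %| #|G|)%N.
  by apply/eqP; rewrite eqn_mod_dvd // subn0; apply: Frobenius_Ldiv.
suff -> : 'Ldiv_p(G)%g = 1%g by rewrite cards1.
apply/setP=> y; rewrite !inE; apply/andP/eqP => [[Gy /eqP yp]|->]; last first.
  by rewrite group1 expg1n.
apply/eqP; rewrite -order_eq1 -dvdn1.
have <- : gcdn p #|G| = 1%N by apply/eqP; rewrite -/(coprime p #|G|) prime_coprime.
by rewrite dvdn_gcd order_dvdn yp eqxx order_dvdG.
Qed.

(** Modulo p, the sum N of the conjugation character over h M is the number of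
    the v in M such that |C(h v)| is prime to p, hence the opposite of the number
    in [regular_coset].  So N is prime to |M|, and as R contains N ^ 2 / |M|, a
    Bezout relation gives 1 / |M|. *)
Lemma regular_coset_inv (p : nat) (gT : finGroupType) (M : {group gT})
    (K : fieldExtType rat) (omega : dual_group K M -> dual_group K M -> K)
    (R : subringClosed K) :
    prime p -> (p.-group M)%g -> regular_coset p [set: gT] M ->
    split_group_algebra K M ->
    cocycle2 omega -> normalized_cocycle omega -> nondegenerate_cocycle omega ->
    integrally_closed R ->
    admits_hopf_order (twisted_galg (twist_elt omega)) R ->
  #|M|%:R^-1 \in R.
Proof.
move=> p_pr pM [h _ hreg] Kl oc on ond icR [X XH].
have [n [s s_bij]] := fin_ord_bij (1%g : gT).
pose chi := conj_character K p s.
have chiC a b : chi (a * b) = chi (b * a) by apply: conj_characterC.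
have := coset_sum_square Kl oc on ond icR XH h chiC.
have corner (B u : group_algebra K gT) :
    B \in X -> u * u = u -> u * B = B * u -> chi (u * B) \in R.
  apply: (@corner_trace _ _ _ _ icR (ho_fin_gen XH) (ho_projective XH)
    (ho_extension XH)) => [a b|]; first exact: conj_repM.
  exact: ho_mul XH.
move=> /(_ corner).
under eq_bigr => v _ do rewrite /chi conj_character_elt //.
rewrite -natr_sum; set N := (\sum_(v in M) _)%N.
have cop : coprime (N ^ 2) #|M|.
  have [k cardM] := p_natP pM; rewrite cardM.
  case: k cardM => [|k] cardM; first by rewrite expn0 coprimen1.
  apply/coprimeXl/coprimeXr; rewrite coprime_sym prime_coprime //.
  apply: contra hreg => pN; set D := [set v in M | _].
  pose b v := (p %| #|'C[h * v]%g|)%N.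
  have pnb : (p %| \sum_(v in M) ~~ b v)%N.
    rewrite /dvdn -modn_summ.
    under eq_bigr => v _ do rewrite -(card_Ldiv_modp [group of 'C[h * v]%g] p_pr).
    by rewrite modn_summ.
  have cardD : #|D| = (\sum_(v in M) b v)%N.
    rewrite -sum1_card big_mkcond [RHS]big_mkcond; apply: eq_bigr => v _.
    by rewrite inE setTI; case: (v \in M).
  rewrite cardD -(dvdn_addr _ pnb) -big_split /=.
  rewrite (eq_bigr (fun=> 1%N)) => [|v _]; last by case: (b v).
  by rewrite sum1_card cardM expnS dvdn_mulr.
have [a _ /dvdnP[c Ec]] := Bezoutl (N ^ 2) (cardG_gt0 M).
have Mu := card_group_unit M K; rewrite -natrX => RN.
have -> : #|M|%:R^-1 = c%:R - a%:R * ((N ^ 2)%:R / #|M|%:R) :> K.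
  apply: (mulIf Mu); rewrite mulVf // mulrBl -!mulrA mulVf // mulr1.
  rewrite -!natrM -Ec gcdnC (eqP cop) natrD.
  by rewrite addrK.
by apply: rpredB (rpred_nat _ _) (rpredM (rpred_nat _ _) RN).
Qed.

(** * Integers of number fields *)

Section RingOfIntegersTheory.
Variable K : fieldExtType rat.
Local Notation OK := (ring_of_integers K).

Lemma ring_of_integersP x : reflect (integralOver (intr : int -> K) x) (x \in OK).
Proof. exact: asboolP. Qed.

(** Integrality is transitive. *)
Lemma ring_of_integers_closed : integrally_closed OK.
Proof.
move=> P x Pmon /polyOverP RP Px; apply/ring_of_integersP.
apply: integral_root_monic Pmon Px _; apply/integral_poly => i.
exact/ring_of_integersP.
Qed.

(** If p is a monic equation of degree n for x, and a p has integer coefficients,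
    then a x is a root of the monic polynomial with integer coefficients
    p_i a ^ (n - i). *)
Lemma integral_denominator_of (io : {rmorphism rat -> K}) (x : K) :
  integralOver io x -> exists2 a : int, a != 0 & a%:~R * x \in OK.
Proof.
move=> [p pmon px].
have [q [a a_neq0 defp]] := rat_poly_scale p.
exists a => //; apply/ring_of_integersP.
have [n sz_p] : exists n, size p = n.+1.
  by exists (size p).-1; rewrite prednK // size_poly_gt0 monic_neq0.
have pn : p`_n = 1 by have := monicP pmon; rewrite lead_coefE sz_p.
pose c i : rat := p`_i * a%:~R ^+ (n - i).
pose P : {poly K} := \poly_(i < n.+1) io (c i).
have cn : c n = 1 by rewrite /c pn subnn expr0 mulr1.
have Pmon : P \is monic.
  apply/eqP; rewrite lead_coef_poly ?cn ?rmorph1 //.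
  exact: oner_neq0.
apply: (integral_root_monic Pmon); last first.
  apply/integral_poly => i; rewrite coef_poly; case: ltnP => [|_]; last exact: integral0.
  rewrite ltnS leq_eqVlt => /orP[/eqP->|lt_in].
    by rewrite cn rmorph1; apply: integral1.
  have -> : c i = (q`_i * a ^+ (n - i).-1)%:~R.
    rewrite /c defp coefZ coef_map /= intrM rmorphXn /=.
    rewrite -[in LHS](prednK (_ : 0 < n - i)%N) ?subn_gt0 //.
    by rewrite exprS mulrACA mulrA mulVf ?intr_eq0 // mul1r.
  by rewrite rmorph_int; apply: integral_id.
rewrite /root horner_poly.
have : root (map_poly (io) p) x by [].
rewrite /root (@horner_coef_wide _ n.+1) ?size_map_poly ?sz_p // => /eqP px0.
apply/eqP; transitivity (a%:~R ^+ n * 0 : K); last by rewrite mulr0.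
rewrite -[in RHS]px0 mulr_sumr.
apply: eq_bigr => -[i /= lt_in] _; rewrite coef_map /c rmorphM rmorphXn /=.
rewrite rmorph_int exprMn mulrA -!mulrA [RHS]mulrCA; congr (_ * _).
by rewrite mulrA -exprD subnK.
Qed.

Lemma integral_denominator (x : K) :
  exists2 a : int, a != 0 & a%:~R * x \in OK.
Proof. exact: integral_denominator_of (alg_integral x). Qed.

(** The definition of a Dedekind domain speaks of quotients of elements of R;
    every element of K is one by [integral_denominator]. *)
Lemma dedekind_integrally_closed (R : subringClosed K) :
  dedekind_domain R -> {subset OK <= R} -> integrally_closed R.
Proof.
move=> [_ closedR _] OKR P x Pmon RP Px.
have [a a_neq0 ax] := integral_denominator x.
have a'_neq0 : a%:~R != 0 :> K.
  by rewrite -(rmorph_int (in_alg K)) fmorph_eq0 intr_eq0.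
have Ra : (a%:~R : K) \in R by apply: rpred_int.
rewrite -[x](mulKf a'_neq0) mulrC; apply: closedR => //; first exact: OKR.
by rewrite [_ / _]mulrC mulKf //; apply/integralOver_subringP; exists P.
Qed.

(** Clearing the denominators of an equation for 1 / n shows that n divides its
    leading coefficient 1. *)
Lemma natr_inv_integral n : (n%:R^-1 : K) \in OK -> (n <= 1)%N.
Proof.
case: n => // n /ring_of_integersP[q qmon].
rewrite /root -(rmorph_nat (in_alg K)) -fmorphV.
have -> : map_poly (intr : int -> K) q = map_poly (in_alg K) (map_poly intr q).
  by rewrite -map_poly_comp; apply: eq_map_poly => z; rewrite -[LHS](rmorph_int (in_alg K)).
rewrite horner_map fmorph_eq0 => /eqP q0.
have [d sz_q] : exists d, size q = d.+1.
  by exists (size q).-1; rewrite prednK // size_poly_gt0 monic_neq0.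
have qd : q`_d = 1 by have := monicP qmon; rewrite lead_coefE sz_q.
set N := n.+1; have NZ : N%:R != 0 :> rat by rewrite Num.Theory.pnatr_eq0.
have : \sum_(i < d.+1) q`_i * N%:Z ^+ (d - i) = 0.
  apply: (@intr_inj rat); rewrite rmorph0; transitivity (N%:R ^+ d * 0 : rat); last by rewrite mulr0.
  rewrite -[in RHS]q0.
  rewrite (@horner_coef_wide _ d.+1) ?size_map_inj_poly ?sz_q //; last exact: intr_inj.
  rewrite mulr_sumr rmorph_sum; apply: eq_bigr => -[i /= lt_id] _.
  rewrite coef_map /= intrM rmorphXn /= mulrCA; congr (_ * _).
  by rewrite exprVn -{2}(subnK (lt_id : (i <= d)%N)) exprD mulfK // expf_neq0.
rewrite big_ord_recr /= qd subnn expr0 mul1r => /eqP; rewrite addr_eq0 => /eqP S1.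
have : (N%:Z %| - (1 : int))%Z.
  rewrite -S1; apply: rpred_sum => -[i /= lt_id] _.
  apply: dvdz_mull; rewrite -(prednK (_ : 0 < d - i)%N) ?subn_gt0 // exprS.
  exact: dvdz_mulr.
by rewrite dvdzE /= dvdn1 => /eqP ->.
Qed.

End RingOfIntegersTheory.

(** * Regular cosets and cyclic matrices *)

Local Open Scope group_scope.
Local Open Scope ring_scope.

Lemma regular_coset_isog (p : nat) (gT rT : finGroupType) (M : {group gT})
    (H : {group rT}) (f : {morphism [set: gT] >-> rT}) :
    ('injm f)%g -> f @* [set: gT] = H -> regular_coset p H (f @* M)%G ->
  regular_coset p [set: gT] M.
Proof.
move=> injf imf [h]; rewrite -imf => /morphimP[g Gg _ ->] hreg.
exists g => //; congr (~~ (p %| _)%N): hreg; set D := [set v in M | _].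
have sDG : D \subset [set: gT] by apply: subsetT.
rewrite -(card_injm injf sDG); apply: eq_card => y.
apply/idP/idP; last first.
  case/morphimP=> v Gv; rewrite [v \in D]inE => /andP[Mv pv] ->.
  rewrite inE mem_morphim //= -morphM // -injm_subcent1 ?in_setT //.
  by rewrite card_injm // subsetIl.
rewrite inE => /andP[/morphimP[v Gv Mv ->]].
rewrite -morphM // -injm_subcent1 ?in_setT // card_injm ?subsetIl // => pv.
by rewrite mem_morphim // inE Mv.
Qed.

Lemma regular_coset_conj (p : nat) (gT : finGroupType) (G M : {group gT}) x :
    x \in 'N(G)%g -> M \subset G -> regular_coset p G (M :^ x)%G ->
  regular_coset p G M.
Proof.
move=> nGx sMG [h Gh hreg].
have Gc y : (y ^ x^-1 \in G)%g = (y \in G).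
  by rewrite memJ_norm // groupV.
exists (h ^ x^-1)%g; first by rewrite Gc.
congr (~~ (p %| _)%N): hreg; set D := [set v in M | _].
rewrite -(cardJg D x); apply: eq_card => y.
rewrite mem_conjg !inE -mem_conjg; congr (_ && (p %| _)%N).
by rewrite -conjMg -(cardJg 'C_G[_ ^ x^-1] x) conjIg (normP nGx) -cent1J conjgKV.
Qed.

Section CyclicMatrix.
Variables (F : fieldType) (n : nat) (A : 'M[F]_n.+1) (e : 'rV[F]_n.+1).

Definition krylov : 'M[F]_n.+1 := \matrix_(i < n.+1) (e *m A ^+ i).
Hypothesis e_cyclic : krylov \in unitmx.

Lemma mul_krylov (c : 'rV[F]_n.+1) :
  c *m krylov = e *m horner_mx A (rVpoly c).
Proof.
rewrite horner_rVpoly mulmx_sum_row.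
rewrite [c *m powers_mx _ _]mulmx_sum_row linear_sum mulmx_sumr.
by apply: eq_bigr => i _; rewrite !rowK linearZ /= mxvecK -scalemxAr.
Qed.

(** A matrix that commutes with A vanishes on the basis e A ^ i if it vanishes
    on e. *)
Lemma cyclic_inj (B : 'M[F]_n.+1) : A * B = B * A -> e *m B = 0 -> B = 0.
Proof.
move=> AB eB; suff: krylov *m B = 0.
  by move/(congr1 (mulmx (invmx krylov))); rewrite mulKmx // mulmx0.
apply/row_matrixP=> i; rewrite row_mul rowK row0 -mulmxA.
have -> : A ^+ i *m B = B *m A ^+ i by apply/esym/commrX/esym.
by rewrite mulmxA eB mul0mx.
Qed.

Variable P : {poly F}.
Hypotheses (P_monic : P \is monic) (size_P : size P = n.+2).
Hypothesis eP0 : e *m horner_mx A P = 0.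

Lemma comm_horner_self Q : A * horner_mx A Q = horner_mx A Q * A.
Proof. by apply: comm_mx_horner; apply: comm_mx_refl. Qed.

(** A polynomial of smaller degree that annihilates A would be a linear relation
    between the e A ^ i. *)
Lemma cyclic_minpoly : mxminpoly A = P.
Proof.
have PA0 : horner_mx A P = 0 by apply: cyclic_inj; first exact: comm_horner_self.
have dvdP := mxminpoly_min PA0.
apply/eqP; rewrite -eqp_monic ?mxminpoly_monic // -dvdp_size_eqp // size_P.
rewrite eqn_leq -size_P dvdp_leq ?monic_neq0 //= leqNgt size_P ltnS.
apply/negP=> small; set Q := mxminpoly A in small.
have : poly_rV Q *m krylov = 0 :> 'rV[F]_n.+1.
  by rewrite mul_krylov poly_rV_K // mx_root_minpoly mulmx0.
move/(congr1 (mulmxr (invmx krylov))); rewrite /= mulmxK // mul0mx => Q0.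
have := monic_neq0 (mxminpoly_monic A).
by rewrite -/Q -(poly_rV_K small) Q0 linear0 eqxx.
Qed.

(** Q is given by the coordinates of e B in the basis e A ^ i. *)
Lemma cyclic_commute B : A * B = B * A -> exists Q, B = horner_mx A Q.
Proof.
move=> AB; exists (rVpoly (e *m B *m invmx krylov)).
apply/eqP; rewrite -subr_eq0; apply/eqP/cyclic_inj.
  by rewrite mulrBr mulrBl AB comm_horner_self.
by rewrite mulmxBr -mul_krylov mulmxKV // subrr.
Qed.

(** A separable polynomial is square-free: the cofactor c of gcd(P, Q) in P is
    coprime to Q, and it divides Q ^ k. *)
Lemma separable_dvd_exp (Q : {poly F}) k :
  separable_poly P -> P %| Q ^+ k -> P %| Q.
Proof.
move=> sepP PQk; have /dvdpP[c defP] := dvdp_gcdl P Q.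
have := sepP; rewrite defP separable_mul => /and3P[_ _ cop].
have copQ : coprimep c Q.
  apply/coprimepP=> d dc dQ; have dP : d %| P by rewrite defP dvdp_mulr.
  by move/coprimepP: cop => /(_ d dc); apply; rewrite dvdp_gcd dP.
have copQk : coprimep c (Q ^+ k) by apply: coprimep_expr.
have cQk : c %| Q ^+ k by apply: dvdp_trans PQk; rewrite defP dvdp_mulr.
have c1 : c %= 1 by move/coprimepP: copQk; apply.
apply: dvdp_trans (dvdp_gcdr P Q).
have : c * gcdp P Q %| gcdp P Q by rewrite (eqp_dvdl _ (eqp_mulr _ c1)) mul1r.
by rewrite -defP.
Qed.

(** In characteristic p the matrix B - 1 = Q(A) is nilpotent, so P divides a power
    of Q. *)
Lemma cyclic_separable_unipotent (p : nat) B :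
    p \in [pchar F] -> separable_poly P -> A * B = B * A -> B ^+ p = 1 ->
  B = 1.
Proof.
move=> charp sepP AB Bp; apply/eqP; rewrite -subr_eq0; apply/eqP.
have charM : p \in [pchar 'M[F]_n.+1] by rewrite pchar_lalg.
have Np : (B - 1) ^+ p = 0.
  have := pFrobenius_autB_comm charM (commr1 B).
  by rewrite !pFrobenius_autE expr1n Bp subrr.
have [Q defQ] : exists Q, B - 1 = horner_mx A Q.
  by apply: cyclic_commute; rewrite mulrBr mulrBl AB mulr1 mul1r.
rewrite defQ; apply/mxminpoly_minP; rewrite cyclic_minpoly.
apply: (@separable_dvd_exp Q p) => //; rewrite -cyclic_minpoly.
by apply/mxminpoly_minP; rewrite rmorphXn /= -defQ.
Qed.

(** P divides the separable polynomial 'X^k - 1. *)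
Lemma cyclic_semisimple_separable k :
  k%:R != 0 :> F -> A ^+ k = 1 -> separable_poly P.
Proof.
move=> k_neq0 Ak; apply: dvdp_separable (separable_Xn_sub_1 k_neq0).
rewrite -cyclic_minpoly mxminpoly_min // rmorphB rmorphXn /= horner_mx_X.
by rewrite Ak rmorph1 subrr.
Qed.

End CyclicMatrix.

Lemma mulmx_horner (F : fieldType) n m (A : 'M[F]_n.+1) (e : 'rV[F]_n.+1)
    (P : {poly F}) : (size P <= m)%N ->
  e *m horner_mx A P = \sum_(k < m) P`_k *: (e *m A ^+ k).
Proof.
move=> szP; rewrite -[P in LHS](coefK P) (poly_def (size P)).
rewrite [X in horner_mx A X](_ : _ = \sum_(k < m) P`_k *: 'X^k); last first.
  rewrite (big_ord_widen m (fun k => P`_k *: 'X^k)) // big_mkcond /=.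
  apply: eq_bigr => k _; case: ltnP => // /leq_sizeP-> //.
  by rewrite scale0r.
rewrite rmorph_sum mulmx_sumr; apply: eq_bigr => k _ /=.
by rewrite linearZ /= rmorphXn /= horner_mx_X scalemxAr.
Qed.

(** The coefficients are indexed by nat, so that the indices in the sums of small
    length reduce to numerals. *)
Lemma krylov_unit (F : fieldType) n (A : 'M[F]_n.+1) (e : 'rV[F]_n.+1) :
    (forall c : nat -> F,
       (forall j, \sum_(i < n.+1) c i * (e *m A ^+ i) 0 j = 0) ->
     forall i, (i < n.+1)%N -> c i = 0) ->
  krylov A e \in unitmx.
Proof.
move=> inj; rewrite -row_free_unit -kermx_eq0; apply/rowV0P=> c /sub_kermxP cK.
apply/matrixP=> i j; rewrite (ord1 i) mxE -[j]inord_val {i}.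
apply: (inj (fun i => c 0 (inord i))) => // k; move/matrixP/(_ 0 k): cK.
rewrite mulmx_sum_row summxE mxE => cK; rewrite -[RHS]cK.
by apply: eq_bigr => i _; rewrite [RHS]mxE rowK inord_val.
Qed.

(** If p divides |C(x)|, then Cauchy gives an element of order p in C(x), which
    [cyclic_separable_unipotent] excludes for separable P.  Otherwise the order
    of x is prime to p and [cyclic_semisimple_separable] applies. *)
Lemma GL_cyclic_cent (F : finFieldType) n p (G : {group {'GL_n.+1[F]}})
    (x : {'GL_n.+1[F]}) (e : 'rV[F]_n.+1) (P : {poly F}) :
    prime p -> p \in [pchar F] -> x \in G ->
    krylov (GLval x : 'M[F]_n.+1) e \in unitmx -> P \is monic ->
    size P = n.+2 -> e *m horner_mx (GLval x : 'M[F]_n.+1) P = 0 ->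
  (p %| #|'C_G[x]%g|)%N = ~~ separable_poly P.
Proof.
move=> p_pr charp Gx e_cyc Pmon szP eP0.
have GLX (u : {'GL_n.+1[F]}) k :
    GLval (u ^+ k)%g = (GLval u : 'M[F]_n.+1) ^+ k.
  by elim: k => // k IHk; rewrite expgS exprS -IHk.
apply/idP/idP => [pC|]; last first.
  apply: contraR => p'C; apply: (cyclic_semisimple_separable e_cyc Pmon szP eP0
    (k := #[x]%g)); last by rewrite -GLX expg_order.
  rewrite -(dvdn_pcharf charp); apply: contra p'C => /dvdn_trans; apply.
  by apply: order_dvdG; rewrite inE Gx cent1id.
apply/negP=> sepP; have [y /setIP[Gy /cent1P cxy] oy] := Cauchy p_pr pC.
have : GLval y = 1.
  apply: (cyclic_separable_unipotent e_cyc Pmon szP eP0 charp) => //.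
    by rewrite -[LHS]/(GLval (x * y)%g) -cxy.
  by rewrite -GLX -oy expg_order.
move=> y1; have : y = 1%g by apply: val_inj.
by move/eqP; rewrite -order_eq1 oy => /eqP p1; rewrite p1 in p_pr.
Qed.

(** * The groups SL_2 *)

Definition mx_of_rows (F : fieldType) n (s : seq (seq F)) : 'M[F]_n :=
  \matrix_(i, j) nth 0 (nth [::] s i) j.

(** Case analysis on an index below 4. *)
Ltac case_ord i :=
  let H := fresh in
  case: i => -[|[|[|[|i]]]] //= H.

Ltac mx_entries :=
  let i := fresh in let j := fresh in
  apply/matrixP=> i j; case_ord i; case_ord j;
  rewrite ?(mxE, big_ord_recl, big_ord0) /=.

Definition GL_of (F : finFieldType) n (A : 'M[F]_n.+1) : {'GL_n.+1[F]} :=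
  insubd (1%g : {'GL_n.+1[F]}) A.

Lemma GL_ofE (F : finFieldType) n (A : 'M[F]_n.+1) :
  A \in unitmx -> GLval (GL_of A) = A.
Proof. by move=> Au; exact: (@insubdK _ _ _ (1%g : {'GL_n.+1[F]}) A Au). Qed.

Lemma GL_injE (F : finFieldType) n (u v : {'GL_n.+1[F]}) :
  GLval u = GLval v -> u = v.
Proof. exact: val_inj. Qed.

Lemma det_mx22 (F : fieldType) (A : 'M[F]_2) :
  \det A = A 0 0 * A 1 1 - A 0 1 * A 1 0.
Proof.
rewrite (expand_det_row _ 0) !big_ord_recl big_ord0 addr0 /cofactor !det_mx11.
rewrite !mxE /= expr0 expr1 mul1r mulN1r mulrN.
by congr (_ * A _ _ - A _ _ * A _ _); apply: val_inj.
Qed.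

Section SL2.
Variables (F : finFieldType) (p m : nat).
Hypotheses (p_pr : prime p) (cardF : #|F| = (p ^ m)%N) (m_gt0 : (0 < m)%N).

Lemma pchar_card : p \in [pchar F].
Proof.
exact: card_finPcharP cardF p_pr.
Qed.

Definition uni2 (s : F) : 'M[F]_2 := mx_of_rows 2 [:: [:: 1; s]; [:: 0; 1]].

Lemma uni2M s t : uni2 s *m uni2 t = uni2 (s + t).
Proof. by mx_entries; ring. Qed.

Lemma uni2_unit s : uni2 s \in unitmx.
Proof.
have : uni2 s *m uni2 (- s) = 1%:M by mx_entries; ring.
by case/mulmx1_unit.
Qed.

Definition unip2 : {set {'GL_2[F]}} := [set GL_of (uni2 s) | s : F].

Lemma unip2_group : group_set unip2.
Proof.
apply/group_setP; split=> [|_ _ /imsetP[s _ ->] /imsetP[t _ ->]].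
  apply/imsetP; exists 0 => //; apply: GL_injE.
  by rewrite GL_ofE ?uni2_unit //; mx_entries.
apply/imsetP; exists (s + t) => //; apply: GL_injE.
by rewrite GL_MxE !GL_ofE ?uni2_unit // uni2M.
Qed.
Canonical unip2_groupType := Group unip2_group.

Lemma uni2_GL_inj : injective (fun s => GL_of (uni2 s)).
Proof.
move=> s t /(congr1 (@GLval 2 F)); rewrite !GL_ofE ?uni2_unit //.
by move=> /matrixP/(_ 0 1); rewrite !mxE.
Qed.

Lemma card_unip2 : #|unip2| = #|F|.
Proof. by rewrite card_imset //; apply: uni2_GL_inj. Qed.

Lemma p'nat_card_pred k : (0 < k)%N -> p^'.-nat (#|F| ^ k - 1)%N.
Proof.
move=> k_gt0; rewrite p'natE // cardF -expnM.
have : (p %| p ^ (m * k))%N by rewrite dvdn_exp // muln_gt0 m_gt0.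
move=> pd; apply/negP=> pd1; have := dvdn_sub pd pd1.
rewrite subKn ?expn_gt0 ?prime_gt0 // dvdn1 => /eqP p1.
by have := p_pr; rewrite p1.
Qed.

(** Hence the unitriangular matrices form a Sylow p-subgroup. *)
Lemma card_GL_p_part n : (#|'GL_n.+1[F]|`_p = #|F| ^ 'C(n.+1, 2))%N.
Proof.
rewrite card_GL //; set c := (\prod_(_ <= _ < _) _)%N.
have pc : p^'.-nat c.
  rewrite /c big_nat; elim/big_ind: _ => [||i /andP[i_gt0 _]] //.
    by move=> x y px py; rewrite pnatM px.
  exact: p'nat_card_pred.
have q_gt0 : (0 < #|F|)%N by rewrite cardF expn_gt0 prime_gt0.
rewrite partnM ?expn_gt0 ?q_gt0 ?(part_p'nat pc) ?muln1.
  by rewrite part_pnat_id // pnatX cardF pnatX pnat_id.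
all: by case/andP: pc.
Qed.

Lemma unip2_Sylow : p.-Sylow('GL_2[F]) unip2.
Proof. by rewrite pHallE subsetT card_unip2 card_GL_p_part binn expn1 eqxx. Qed.

Definition char_quad (t d : F) : {poly F} := 'X^2 - t%:P * 'X + d%:P.

Lemma size_char_quad t d : size (char_quad t d) = 3.
Proof.
rewrite /char_quad -addrA size_polyDl size_polyXn //.
rewrite (leq_ltn_trans (size_polyD _ _)) // gtn_max.
rewrite (leq_ltn_trans (size_polyC_leq1 _)) // andbT size_polyN.
by rewrite (leq_ltn_trans (size_mul_leq _ _)) // size_polyX size_polyC; case: eqP.
Qed.

Lemma monic_char_quad t d : char_quad t d \is monic.
Proof.
rewrite monicE lead_coefE size_char_quad /char_quad !coefD coefN coefXn coefCM.
by rewrite coefX coefC /= mulr0 subr0 addr0.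
Qed.

Lemma horner_char_quad t d r : (char_quad t d).[r] = r ^+ 2 - t * r + d.
Proof. by rewrite /char_quad !(hornerD, hornerN, hornerM, hornerXn, hornerX, hornerC). Qed.

Lemma deriv_char_quad t d : (char_quad t d)^`() = 2%:R%:P * 'X - t%:P.
Proof. by rewrite /char_quad !derivE rmorph_nat; ring. Qed.

(** For P = X^2 - t X + d the relation 4 P - P'^2 = 4 d - t^2 is a Bezout relation
    between P and P'. *)
Lemma disc_separable t d : t ^+ 2 != 4%:R * d -> separable_poly (char_quad t d).
Proof.
move=> t2; have c0 : 4%:R * d - t ^+ 2 != 0 by rewrite subr_eq0 eq_sym.
set c := 4%:R * d - t ^+ 2 in c0; rewrite separable_poly.unlock.
apply/Bezout_coprimepP.
exists ((4%:R / c)%:P, - (c^-1%:P * (char_quad t d)^`())).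
rewrite deriv_char_quad rmorph_nat /= /char_quad.
have -> : (4%:R / c)%:P * ('X^2 - t%:P * 'X + d%:P) +
   - (c^-1%:P * (2%:R * 'X - t%:P)) * (2%:R * 'X - t%:P) = (c^-1 * c)%:P.
  rewrite /c !rmorphM rmorphB /= rmorphM rmorphXn /= rmorph_nat; by ring.
by rewrite mulVf // eqpxx.
Qed.

(** If t^2 = 4, then t = 2 r with r = 1 or r = -1, and the polynomial is the
    square of X - r. *)
Lemma separable_char_quad t : separable_poly (char_quad t 1) = (t ^+ 2 != 4%:R).
Proof.
apply/idP/idP => [sepP|t2]; last by apply: disc_separable; rewrite mulr1.
apply/eqP=> t2; have [r [r2 tr]] : exists r : F, r ^+ 2 = 1 /\ t = 2%:R * r.
  have /eqP : (t - 2%:R) * (t + 2%:R) = 0 by rewrite -subr_sqr t2 -natrX subrr.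
  rewrite mulf_eq0 subr_eq0 addr_eq0 => /orP[]/eqP->; [exists 1|exists (-1)].
    by rewrite expr1n mulr1.
  by rewrite sqrrN expr1n mulrN1.
have : ('X - r%:P) ^+ 2 %| char_quad t 1.
  have -> : char_quad t 1 = ('X - r%:P) ^+ 2; last exact: dvdpp.
  rewrite /char_quad tr rmorphM /= sqrrB -rmorphXn r2 /= polyCMn -[_ *+ 2]mulr_natl.
  by ring.
by rewrite (separable_nosquare sepP) // size_XsubC.
Qed.

Definition anti2 (b : F) : 'M[F]_2 :=
  mx_of_rows 2 [:: [:: 0; - b^-1]; [:: b; 0]].

Lemma anti2_det b : b != 0 -> \det (anti2 b) = 1.
Proof.
by move=> b0; rewrite det_mx22 !mxE /= mul0r sub0r mulNr opprK mulVf.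
Qed.

Lemma anti2_unit b : b != 0 -> anti2 b \in unitmx.
Proof. by move=> b0; rewrite unitmxE anti2_det // unitr1. Qed.

Lemma anti2_uni2 b s :
  anti2 b *m uni2 s = mx_of_rows 2 [:: [:: 0; - b^-1]; [:: b; b * s]].
Proof. by mx_entries; ring. Qed.

Lemma uni2_det s : \det (uni2 s) = 1.
Proof. by rewrite det_mx22 !mxE /= mulr0 subr0 mulr1. Qed.

(** The first basis vector is cyclic, and the characteristic polynomial is
    X^2 - b s X + 1. *)
Lemma SL2_cent b s : b != 0 ->
  (p %| #|'C_(special_linear 2 F)[GL_of (anti2 b) * GL_of (uni2 s)]%g|)%N
    = ((b * s) ^+ 2 == 4%:R).
Proof.
move=> b0; rewrite -[RHS]negbK -separable_char_quad.
set x := (_ * _)%g; have xE : GLval x = anti2 b *m uni2 s.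
  by rewrite GL_MxE !GL_ofE ?uni2_unit ?anti2_unit.
apply: (@GL_cyclic_cent _ _ _ (special_linear_group 2 F) x
  (\row_j nth 0 [:: 1; 0] j)); rewrite ?p_pr ?pchar_card ?monic_char_quad ?size_char_quad //.
- by rewrite inE xE det_mulmx anti2_det // uni2_det mulr1.
- rewrite xE anti2_uni2; apply: krylov_unit => c cE.
  have := cE 0; have := cE 1; rewrite !big_ord_recl big_ord0 !expr0 !expr1 !mulmx1.
  rewrite ?(mxE, big_ord_recl, big_ord0) /=.
  rewrite !(mulr0, mul0r, mulr1, mul1r, addr0, add0r) => /eqP.
  rewrite mulf_eq0 oppr_eq0 invr_eq0 (negPf b0) orbF => /eqP c1 c0.
  by case=> [|[|i]].
rewrite xE anti2_uni2 /char_quad rmorphD rmorphB /= rmorphXn rmorphM rmorph1 /=.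
rewrite horner_mx_X horner_mx_C.
set B := (X in _ *m X); suff -> : B = 0 by rewrite mulmx0.
by rewrite /B expr2; mx_entries; field.
Qed.

Lemma GL_norm_SL n (x : {'GL_n.+1[F]}) : x \in 'N(special_linear n.+1 F)%g.
Proof.
rewrite inE; apply/subsetP=> _ /imsetP[y + ->]; rewrite !inE => /eqP dy.
rewrite conjgE !GL_MxE GL_VxE !det_mulmx dy det_inv mul1r mulVf //.
exact: GL_det.
Qed.

(** After conjugation, M consists of matrices [uni2 s].  If p is odd and
    [uni2 s0] is in M with s0 <> 0, then for b = 2 / s0 the exceptional values of
    s are s0 and - s0.  In characteristic 2, for b = 1, the only one is s = 0. *)
Lemma SL2_regular (M : {group {'GL_2[F]}}) :
    M \subset special_linear 2 F -> (p.-group M)%g -> M :!=: 1%g ->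
  regular_coset p (special_linear_group 2 F) M.
Proof.
move=> sMS pM M1; have [x _ sMU] := Sylow_subJ unip2_Sylow (subsetT M) pM.
apply: (@regular_coset_conj _ _ _ _ x^-1%g) => //; first exact: (@GL_norm_SL 1).
have {M pM M1 sMS sMU} [M [sMU M1 ->]] : exists M' : {group {'GL_2[F]}},
    [/\ M' \subset unip2, M' :!=: 1%g & (M :^ x^-1)%G = M'].
  exists (M :^ x^-1)%G; split=> //; first by rewrite sub_conjgV.
  by rewrite trivg_card1 cardJg -trivg_card1.
(* b is the parameter of the antidiagonal matrix that represents the coset *)
have [b b0 bM] : exists2 b : F, b != 0 &
    ~~ (p %| #|[set v in M | [exists s, (v == GL_of (uni2 s)) && ((b * s) ^+ 2 == 4%:R)]]|)%N.
  have uni2_1 : GL_of (uni2 0) = 1%g.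
    by apply: GL_injE; rewrite GL_ofE ?uni2_unit //; mx_entries.
  have uni2_V s : GL_of (uni2 (- s)) = (GL_of (uni2 s))^-1%g.
    apply/eqP; rewrite eq_sym eq_invg_mul; apply/eqP/GL_injE.
    by rewrite GL_MxE !GL_ofE ?uni2_unit // uni2M subrr -uni2_1 GL_ofE ?uni2_unit.
  have /trivgPn[v0 Mv0 v0_neq1] := M1.
  have /imsetP[s0 _ defv0] := subsetP sMU v0 Mv0.
  have s0_neq0 : s0 != 0.
    by apply: contraNneq v0_neq1 => s0_eq0; rewrite defv0 s0_eq0 uni2_1.
  have [two0|two_neq0] := eqVneq (2%:R : F) 0.
    exists 1; first exact: oner_neq0.
    have four0 : 4%:R = 0 :> F by rewrite (natrM _ 2 2) two0 mul0r.
    rewrite (_ : [set v in M | _] = [set 1%g]) ?cards1 ?dvdn1.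
      by apply: contraTneq p_pr => ->.
    apply/setP=> v; rewrite !inE; apply/andP/eqP => [[_ /existsP[s]]|->].
      rewrite four0 mul1r expf_eq0 /= => /andP[/eqP-> /eqP->].
      by rewrite uni2_1.
    split; first exact: group1.
    by apply/existsP; exists 0; rewrite uni2_1 eqxx mulr0 expr0n four0 /=.
  exists (2%:R / s0); first by rewrite mulf_neq0 ?invr_eq0.
  rewrite (_ : [set v in M | _] = [set v0; v0^-1%g]).
    rewrite cards2 (_ : v0 != v0^-1%g) ?(dvdn_pcharf pchar_card) //.
    rewrite defv0 -uni2_V (inj_eq uni2_GL_inj) -addr_eq0 -mulr2n -mulr_natl.
    by rewrite mulf_neq0.
  have sq s : ((2%:R / s0 * s) ^+ 2 == 4%:R) = (s == s0) || (s == - s0).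
    have e : (2%:R / s0 * s) ^+ 2 - 4%:R = (2%:R / s0) ^+ 2 * (s ^+ 2 - s0 ^+ 2).
      by field.
    rewrite -subr_eq0 e mulf_eq0 expf_eq0 /= mulf_eq0 invr_eq0.
    by rewrite (negPf two_neq0) (negPf s0_neq0) /= subr_eq0 eqf_sqr.
  apply/setP=> v; rewrite !inE; apply/andP/orP => [[_ /existsP[s]]|].
    rewrite sq => /andP[/eqP-> /orP[]/eqP->]; [left|right].
      by rewrite defv0.
    by rewrite uni2_V defv0.
  case=> /eqP->; rewrite ?groupV; split=> //; apply/existsP.
    by exists s0; rewrite sq defv0 !eqxx.
  by exists (- s0); rewrite sq defv0 uni2_V !eqxx orbT.
exists (GL_of (anti2 b)).
  by rewrite inE GL_ofE ?anti2_unit // anti2_det.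
congr (~~ (p %| _)%N): bM; apply: eq_card => v; rewrite !inE.
have [Mv|//] := boolP (v \in M).
have /imsetP[s _ ->] := subsetP sMU v Mv; rewrite SL2_cent // andTb.
apply/existsP/idP => [[t /andP[/eqP/uni2_GL_inj->]]//|bs].
by exists s; rewrite eqxx.
Qed.

End SL2.

(** * Central quotients and the groups PSL_2 *)

Local Open Scope group_scope.

Section CentralQuotient.
Variables (p : nat) (gT : finGroupType) (G Z : {group gT}).
Hypotheses (p_pr : prime p) (p'Z : p^'.-group Z) (cZ : Z \subset 'Z(G)).

Let nZG : G \subset 'N(Z).
Proof. exact: normal_norm (sub_center_normal cZ). Qed.

Let p_elt_notin y : y \in Z -> p.-elt y -> y = 1.
Proof.
move=> Zy py; apply/eqP; rewrite -order_eq1 -(part_pnat_id py).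
by rewrite part_p'nat //; apply: mem_p_elt p'Z Zy.
Qed.

(** Given an element of order p that commutes with the class of x, let y be the
    p-constituent of a lift.  Then y ^ x = z y for some z in Z.  As z is central
    and y, y ^ x are p-elements, so is z, and z = 1 because Z is a p'-group. *)
Lemma central_quotient_cent x : x \in G ->
  (p %| #|'C_(G / Z)[coset Z x]|)%N = (p %| #|'C_G[x]|)%N.
Proof.
move=> Gx; have Nx := subsetP nZG x Gx; apply/idP/idP.
  case/(Cauchy p_pr)=> yb /setIP[/morphimP[y0 Ny0 Gy0 ->] /cent1P cxy] oy.
  set y := y0.`_p; have Gy : y \in G by rewrite groupX.
  have Ny := subsetP nZG y Gy.
  have cy : coset Z y = coset Z y0.
    by rewrite morph_constt // constt_p_elt // /p_elt oy pnat_id.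
  have y1 : y != 1.
    have oy' : #[coset Z y] = p by rewrite cy.
    by apply: contraTneq p_pr => y1; rewrite -oy' y1 morph1 order1.
  have py : p.-elt y by apply: p_elt_constt.
  set z := y ^ x * y^-1.
  have Zz : z \in Z.
    rewrite -(ker_coset Z); apply/kerP; first by rewrite !in_group ?groupJ.
    rewrite morphM ?groupV ?groupJ // morphJ // morphV //= cy.
    by rewrite conjgE cxy mulKg mulgV.
  have czy : commute z y.
    by have /setIP[_ /centP/(_ y Gy)] := subsetP cZ z Zz.
  have z1 : z = 1.
    apply: p_elt_notin => //; apply: (pnat_dvd _ py).
    rewrite order_dvdn -(mulg1 (z ^+ _)) -(expg_order y) -expgMn //.
    by rewrite mulgKV -conjXg expg_order conj1g.
  have Cy : y \in 'C_G[x].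
    rewrite inE Gy; apply/cent1P/commgP/conjg_fixP; apply/eqP.
    by rewrite eq_mulgV1 -/z z1.
  apply: dvdn_trans (order_dvdG Cy).
  have [[|k] oyk] := p_natP py; last by rewrite oyk expnS dvdn_mulr.
  by rewrite -order_eq1 oyk expn0 in y1.
case/(Cauchy p_pr)=> y /setIP[Gy /cent1P cxy] oy.
have Ny := subsetP nZG y Gy.
have -> : p = #[coset Z y].
  apply/eqP; rewrite eq_sym.
  have : (#[coset Z y] %| p)%N by rewrite -oy morph_order.
  move/(primeP p_pr).2/orP => [|//]; rewrite order_eq1 => /eqP/coset_idr Zy.
  have y1 : y = 1 by apply: p_elt_notin; rewrite ?Zy // /p_elt oy pnat_id.
  by move: p_pr; rewrite -oy y1 order1.
rewrite order_dvdG // inE mem_quotient //=; apply/cent1P.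
by rewrite /commute -!morphM // cxy.
Qed.

Lemma regular_coset_quotient (P : {group gT}) :
    P \subset G -> p.-group P -> regular_coset p G P ->
  regular_coset p (G / Z)%G (P / Z)%G.
Proof.
move=> sPG pP [h Gh hreg]; exists (coset Z h); first exact: mem_quotient.
congr (~~ (p %| _)%N): hreg; set D := [set v in P | _].
have injP : {in D &, injective (coset Z)}.
  move=> u v; rewrite !inE => /andP[Pu _] /andP[Pv _] uv.
  have : coset Z (u * v^-1) = 1.
    have [Nu Nv] : u \in 'N(Z) /\ v \in 'N(Z) by rewrite !(subsetP nZG) ?(subsetP sPG).
    by rewrite morphM ?groupV // morphV //= uv mulgV.
  move/coset_idr=> Zuv; apply/eqP; rewrite eq_mulgV1; apply/eqP.
  have Puv : u * v^-1 \in P by rewrite groupM ?groupV.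
  apply: p_elt_notin (mem_p_elt pP Puv); apply: Zuv.
  by rewrite (subsetP nZG) ?(subsetP sPG).
rewrite -(card_in_imset injP); apply: eq_card => vb.
apply/imsetP/idP => [[v vD ->]|].
  move: vD; rewrite [v \in D]inE => /andP[Pv pv].
  have Gv := subsetP sPG v Pv.
  by rewrite inE mem_quotient //= -morphM ?central_quotient_cent ?groupM ?(subsetP nZG).
rewrite inE => /andP[/morphimP[v Nv Pv ->]].
have Gv := subsetP sPG v Pv.
rewrite -morphM ?(subsetP nZG) // central_quotient_cent ?groupM // => pv.
by exists v; rewrite // inE Pv.
Qed.

End CentralQuotient.

Section PSL2.
Variables (F : finFieldType) (p m : nat).
Hypotheses (p_pr : prime p) (cardF : #|F| = (p ^ m)%N) (m_gt0 : (0 < m)%N).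
Local Notation SL := (special_linear_group 2 F).

(** The centre is contained in a centralizer of order prime to p, which exists by
    [SL2_cent]. *)
Lemma SL2_center_p' : p^'.-group 'Z(SL).
Proof.
have [s sP] : exists s : F, ((1%R * s)%R ^+ 2 != 4%:R)%R.
  have [two0|two_neq0] := eqVneq (2%:R : F)%R 0%R.
    exists 1%R; rewrite mulr1 expr1n (natrM _ 2 2) two0 mul0r.
    exact: oner_neq0.
  by exists 0%R; rewrite mulr0 expr0n eq_sym (natrM _ 2 2) mulf_neq0.
rewrite /pgroup p'natE //; apply: contra sP.
rewrite -(SL2_cent p_pr cardF _ (oner_neq0 F)) => /dvdn_trans; apply.
set x := (_ * _); have Gx : x \in SL.
  rewrite groupM // !inE GL_ofE ?uni2_det ?uni2_unit ?anti2_unit ?oner_neq0 //.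
  by rewrite anti2_det ?oner_neq0.
apply: cardSg; apply/subsetP=> y /setIP[Gy /centP cGy]; rewrite inE Gy.
by apply/cent1P/cGy.
Qed.

(** A p-subgroup of the quotient is the image of a Sylow p-subgroup of its
    preimage. *)
Lemma PSL2_regular (M : {group coset_of 'Z(SL)}) :
    M \subset SL / 'Z(SL) -> p.-group M -> M :!=: 1 ->
  regular_coset p (SL / 'Z(SL))%G M.
Proof.
move=> sMG pM M1; have nZ := center_normal SL.
have [L defM sZL sLG] := inv_quotientS nZ sMG.
have nZL : L \subset 'N('Z(SL)) := subset_trans sLG (normal_norm nZ).
have [P sylP] := Sylow_exists p L.
have defMP : M :=: P / 'Z(SL).
  have := quotient_pHall (subset_trans (pHall_sub sylP) nZL) sylP.
  by rewrite -defM => /pHall_id->.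
have -> : M = (P / 'Z(SL))%G by apply: val_inj.
have sPG := subset_trans (pHall_sub sylP) sLG.
apply: regular_coset_quotient => //; first exact: SL2_center_p'.
  exact: pHall_pgroup sylP.
apply: SL2_regular cardF m_gt0 _ _ _ _ => //; first exact: pHall_pgroup sylP.
by apply: contraNneq M1 => P1; rewrite defMP P1 quotient1.
Qed.

End PSL2.

(** * The groups SL_3 over prime fields *)

Local Open Scope ring_scope.

Section Cubic.
Variables (F : finFieldType) (p : nat).
Hypotheses (p_pr : prime p) (cardF : #|F| = p).

Definition char_cubic (t1 t2 : F) : {poly F} :=
  'X^3 - t1%:P * 'X^2 + t2%:P * 'X - 1.

Lemma char_cubicE t1 t2 :
  char_cubic t1 t2 = 'X^3 + \poly_(i < 3) [:: -1; t2; - t1]`_i.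
Proof.
rewrite poly_def !big_ord_recl big_ord0 /= expr0 expr1 -!mul_polyC /char_cubic.
rewrite /bump /= !rmorphN /=; ring.
Qed.

Lemma size_char_cubic t1 t2 : size (char_cubic t1 t2) = 4.
Proof.
by rewrite char_cubicE size_polyDl size_polyXn // (leq_ltn_trans (size_poly _ _)).
Qed.

Lemma monic_char_cubic t1 t2 : char_cubic t1 t2 \is monic.
Proof.
rewrite char_cubicE monicE lead_coefDl ?lead_coefXn //.
by rewrite size_polyXn (leq_ltn_trans (size_poly _ _)).
Qed.

Lemma deriv_char_cubic t1 t2 :
  (char_cubic t1 t2)^`() = 3%:R%:P * 'X^2 - (2%:R * t1)%:P * 'X + t2%:P.
Proof. by rewrite /char_cubic !derivE rmorphM !rmorph_nat; ring. Qed.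

Lemma horner_char_cubic t1 t2 r :
  (char_cubic t1 t2).[r] = r ^+ 3 - t1 * r ^+ 2 + t2 * r - 1.
Proof.
by rewrite /char_cubic !(hornerD, hornerN, hornerM, hornerXn, hornerX, hornerC).
Qed.

Lemma horner_deriv_char_cubic t1 t2 r :
  (char_cubic t1 t2)^`().[r] = 3%:R * r ^+ 2 - 2%:R * t1 * r + t2.
Proof.
by rewrite deriv_char_cubic !(hornerD, hornerN, hornerM, hornerXn, hornerX, hornerC).
Qed.

Lemma double_root_separable t1 t2 r :
    root (char_cubic t1 t2) r -> root (char_cubic t1 t2)^`() r ->
  ~~ separable_poly (char_cubic t1 t2).
Proof.
move=> Pr P'r; rewrite separable_poly.unlock; apply/negP=> /coprimepP.
move/(_ ('X - r%:P)); rewrite !dvdp_XsubCl => /(_ Pr P'r) /eqp_size.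
by rewrite size_XsubC size_poly1.
Qed.

(** By [disc_separable], t^2 = 4 d.  In characteristic 2, where t = 0, the field is
    F_2 and d = d^2. *)
Lemma double_root_quad t d :
  ~~ separable_poly (char_quad t d) -> exists2 r : F, t = 2%:R * r & d = r ^+ 2.
Proof.
move/(contra (@disc_separable F t d)); rewrite negbK => /eqP t2.
have charp := pchar_card p_pr (etrans cardF (esym (expn1 p))).
have [two0|two_neq0] := eqVneq (2%:R : F) 0.
  exists d.
    by apply/eqP; have /eqP := t2; rewrite (natrM _ 2 2) two0 !mul0r expf_eq0.
  have p2 : p = 2%N.
    apply/eqP; rewrite -dvdn_prime2 // (dvdn_pcharf charp).
    exact/eqP.
  by rewrite -[LHS](expf_card d) cardF p2.
exists (t / 2%:R); first by field.
apply: (mulfI (_ : 4%:R != 0 :> F)); first by rewrite (natrM _ 2 2) mulf_neq0.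
by rewrite -t2; field.
Qed.

(** It is enough to find a common root r of P and P', from which t1 and t2 follow.
    A cubic without roots is irreducible, hence P' = 0, which leaves X^3 - 1 in
    characteristic 3 only, and 1 is a root.  If s is a root, then write
    P = Q (X - s): either s is a root of Q, or Q is a non-separable quadratic
    polynomial and has a double root. *)
Lemma nonseparable_cubic t1 t2 :
  ~~ separable_poly (char_cubic t1 t2) ->
  exists2 r, r != 0 & t1 = 2%:R * r + r ^- 2 /\ t2 = r ^+ 2 + 2%:R * r^-1.
Proof.
set P := char_cubic t1 t2 => nsep.
suff [r Pr P'r] : exists2 r, root P r & root P^`() r.
  move: P'r Pr; rewrite /P /root horner_char_cubic horner_deriv_char_cubic.
  move=> /eqP P'r /eqP Pr; have r0 : r != 0.
    apply/eqP=> r0; move: Pr; rewrite r0 !expr0n /= !mulr0 subrr !add0r.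
    by move/eqP; rewrite oppr_eq0 oner_eq0.
  have t2E : t2 = 2%:R * t1 * r - 3%:R * r ^+ 2.
    by apply/eqP; rewrite -subr_eq0 -P'r; apply/eqP; ring.
  have t1E : t1 = 2%:R * r + r ^- 2.
    apply: (mulIf (_ : r ^+ 2 != 0)); first by rewrite expf_neq0.
    apply/eqP; rewrite mulrDl mulVf ?expf_neq0 // -subr_eq0 -Pr t2E.
    by apply/eqP; ring.
  by exists r => //; split=> //; rewrite t2E t1E; field.
have [s Ps] : exists s, root P s.
  have [/existsP//|] := boolP [exists s, root P s].
  rewrite negb_exists => /forallP noroot.
  have irrP : irreducible_poly P.
    by apply: cubic_irreducible; rewrite ?size_char_cubic.
  have P'0 : P^`() = 0.
    move: nsep; rewrite separable_poly.unlock irreducible_poly_coprime // negbK.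
    move=> PP'; apply/eqP; apply: contraTT PP' => P'0; apply/negP=> /(dvdp_leq P'0).
    have := lt_size_deriv (monic_neq0 (monic_char_cubic t1 t2)).
    by rewrite -/P ltnNge => /negPf->.
  have c0 : 3%:R = 0 :> F /\ 2%:R * t1 = 0.
    have E i : (P^`())`_i = 0 by rewrite P'0 coef0.
    have := E 2%N; have := E 1%N.
    rewrite deriv_char_cubic !(coefD, coefN, coefCM, coefXn, coefX, coefC) /=.
    rewrite !(mulr0, mulr1, subr0, addr0, sub0r) => /eqP.
    by rewrite oppr_eq0 => /eqP.
  have [c3 c2] := c0; have t10 : t1 = 0.
    have : 3%:R * t1 - 2%:R * t1 = 0 by rewrite c3 c2 mul0r subrr.
    by rewrite -mulrBl -natrB // mul1r.
  exists 1; rewrite /root horner_char_cubic t10 !expr1n mul0r subr0 mulr1.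
  have := congr1 (fun Q : {poly F} => Q.[0]) P'0.
  rewrite horner_deriv_char_cubic expr0n /= !mulr0 subrr add0r horner0 => ->.
  by rewrite addr0 subrr.
have s0 : s != 0.
  apply/eqP=> s0; move: Ps; rewrite /root /P horner_char_cubic s0.
  by rewrite !expr0n /= !mulr0 subrr !add0r oppr_eq0 oner_eq0.
have t2E : t2 = s^-1 + t1 * s - s ^+ 2.
  move: Ps; rewrite /root /P horner_char_cubic => /eqP Ps.
  apply: (mulIf s0); apply/eqP; rewrite -subr_eq0 -Ps; apply/eqP.
  by field.
set Q := char_quad (t1 - s) s^-1.
have defP : P = Q * ('X - s%:P).
  have sV : (s^-1)%:P * s%:P = 1 :> {poly F} by rewrite -rmorphM mulVf.
  rewrite /P /char_cubic /Q /char_quad t2E !rmorphB rmorphD rmorphM /= rmorphXn.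
  by rewrite -[X in _ - X = _]sV; ring.
have := nsep; rewrite defP separable_root negb_and negbK => /orP[nsepQ|Qs].
  have [r tr dr] := double_root_quad nsepQ.
  have Qr : root Q r.
    by rewrite /root horner_char_quad tr dr; apply/eqP; ring.
  exists r; first by rewrite rootM Qr.
  rewrite derivM /root hornerD !hornerM (rootP Qr) mul0r addr0.
  rewrite (_ : Q^`().[r] = 0) ?mul0r //.
  by rewrite deriv_char_quad !(hornerD, hornerN, hornerM, hornerX, hornerC) tr subrr.
exists s; first by rewrite rootM root_XsubC eqxx orbT.
by rewrite derivM derivXsubC mulr1 /root hornerD hornerM hornerXsubC subrr mulr0 add0r.
Qed.

Lemma nonseparable_cubic_double_root (r : F) : r != 0 ->
  ~~ separable_poly (char_cubic (2%:R * r + r ^- 2) (r ^+ 2 + 2%:R * r^-1)).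
Proof.
move=> r0; apply: (@double_root_separable _ _ r).
  by rewrite /root horner_char_cubic; apply/eqP; field.
by rewrite /root horner_deriv_char_cubic; apply/eqP; field.
Qed.

(** A cubic polynomial has at most one double root. *)
Lemma double_root_inj (r u : F) : r != 0 -> u != 0 ->
  2%:R * r + r ^- 2 = 2%:R * u + u ^- 2 ->
  r ^+ 2 + 2%:R * r^-1 = u ^+ 2 + 2%:R * u^-1 -> r = u.
Proof.
move=> r0 u0 e1 e2; have [//|nru] := eqVneq r u.
have ur0 : u - r != 0 by rewrite subr_eq0 eq_sym.
have Pu : (u - r) ^+ 2 * (u - r ^- 2) = 0.
  transitivity (u ^+ 3 - (2%:R * r + r ^- 2) * u ^+ 2 + (r ^+ 2 + 2%:R * r^-1) * u - 1).
    by field.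
  by rewrite e1 e2; field.
have P'u : (u - r) * (3%:R * u - r - 2%:R * r ^- 2) = 0.
  transitivity (3%:R * u ^+ 2 - 2%:R * (2%:R * r + r ^- 2) * u
                  + (r ^+ 2 + 2%:R * r^-1)).
    by field.
  by rewrite e1 e2; field.
have us : u = r ^- 2.
  by apply/eqP; move/eqP: Pu; rewrite mulf_eq0 expf_eq0 /= (negPf ur0) subr_eq0.
move/eqP: P'u; rewrite mulf_eq0 (negPf ur0) /= -us.
have -> : 3%:R * u - r - 2%:R * u = u - r by ring.
by rewrite (negPf ur0).
Qed.

(** The non-separable polynomials are the (X - r)^2 (X - r^-2). *)
Lemma card_nonseparable_cubic :
  #|[set t : F * F | ~~ separable_poly (char_cubic t.1 t.2)]| = #|F|.-1.
Proof.
rewrite -(cardsC1 (0 : F)).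
pose f (r : F) := (2%:R * r + r ^- 2, r ^+ 2 + 2%:R * r^-1).
have f_inj : {in [set~ 0] &, injective f}.
  by move=> r u; rewrite !inE => r0 u0 [e1 e2]; apply: double_root_inj.
rewrite -(card_in_imset f_inj); apply: eq_card => -[t1 t2].
rewrite inE /=; apply/idP/imsetP => [/nonseparable_cubic[r r0 [-> ->]]|[r]].
  by exists r; rewrite ?inE.
by rewrite !inE => r0 [-> ->]; apply: nonseparable_cubic_double_root.
Qed.

End Cubic.

Lemma central_type_card (gT : finGroupType) (M : {group gT}) :
  central_type M ->
  exists2 k, #|M| = (k ^ 2)%N & forall x, x \in M -> (x ^+ k)%g = 1%g.
Proof.
case=> _ [eT /isogP[f injf fM]]; exists #|eT|.
  by rewrite -(card_injm injf (subxx M)) fM cardsT card_prod.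
move=> x Mx; apply: (injmP injf); rewrite ?group1 ?groupX // morph1 morphX //.
case: (f x) => y z; have -> : ((y, z) ^+ #|eT|)%g = (y ^+ #|eT|, z ^+ #|eT|)%g.
  by elim: #|eT| => // n IHn; rewrite !expgS IHn.
by rewrite -cardsT !expg_cardG ?inE.
Qed.

Section SL3.
Variables (F : finFieldType) (p : nat).
Hypotheses (p_pr : prime p) (cardF : #|F| = p).
Let cardF1 : #|F| = (p ^ 1)%N.
Proof. by rewrite expn1. Qed.
Local Notation SL := (special_linear_group 3 F).

Definition uni3 (v : F * F * F) : 'M[F]_3 :=
  let: (a, b, c) := v in
  mx_of_rows 3 [:: [:: 1; a; c]; [:: 0; 1; b]; [:: 0; 0; 1]].

Lemma uni3M a b c a' b' c' :
  uni3 (a, b, c) *m uni3 (a', b', c') = uni3 (a + a', b + b', c + c' + a * b').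
Proof. by mx_entries; ring. Qed.

Lemma uni3_unit v : uni3 v \in unitmx.
Proof.
case: v => [[a b] c].
have : uni3 (a, b, c) *m uni3 (- a, - b, a * b - c) = 1%:M by mx_entries; ring.
by case/mulmx1_unit.
Qed.

Definition uni3_GL v : {'GL_3[F]} := GL_of (uni3 v).
Local Notation u := uni3_GL.

Lemma uni3_GLM a b c a' b' c' :
  (u (a, b, c) * u (a', b', c'))%g = u (a + a', b + b', c + c' + a * b').
Proof.
by apply: GL_injE; rewrite GL_MxE !GL_ofE ?uni3_unit // uni3M.
Qed.

Lemma uni3_GL1 : u (0, 0, 0) = 1%g.
Proof. by apply: GL_injE; rewrite GL_ofE ?uni3_unit //; mx_entries. Qed.

Lemma uni3_GLV a b c : (u (a, b, c))^-1%g = u (- a, - b, a * b - c).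
Proof.
apply/eqP; rewrite eq_invg_mul uni3_GLM -uni3_GL1; apply/eqP.
by congr (u (_, _, _)); ring.
Qed.

Lemma uni3_GL_inj : injective u.
Proof.
move=> [[a b] c] [[a' b'] c'] /(congr1 (@GLval 3 F)); rewrite !GL_ofE ?uni3_unit //.
move=> /matrixP E; have := E 0 1; have := E 1 2; have := E 0 2.
by rewrite !mxE /= => -> -> ->.
Qed.

Definition unip3 : {set {'GL_3[F]}} := [set u v | v : F * F * F].

Lemma unip3_group : group_set unip3.
Proof.
apply/group_setP; split=> [|_ _ /imsetP[[[a b] c] _ ->] /imsetP[[[a' b'] c'] _ ->]].
  by apply/imsetP; exists (0, 0, 0); rewrite ?uni3_GL1.
by rewrite uni3_GLM imset_f.
Qed.
Canonical unip3_groupType := Group unip3_group.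

Lemma unip3_Sylow : p.-Sylow('GL_3[F]) unip3.
Proof.
rewrite pHallE subsetT (card_GL_p_part p_pr cardF1) // card_imset.
  by rewrite !card_prod (_ : 'C(3, 2) = 3) // !expnS expn0 muln1 mulnA eqxx.
exact: uni3_GL_inj.
Qed.

Definition mono3 (l : F) : 'M[F]_3 :=
  mx_of_rows 3 [:: [:: 0; 0; l^-1]; [:: 1; 0; 0]; [:: 0; l; 0]].

Lemma mono3_det l : l != 0 -> \det (mono3 l) = 1.
Proof.
move=> l0; rewrite (expand_det_row _ 0) !big_ord_recl big_ord0 /cofactor.
rewrite !det_mx22 !mxE /= !(mul0r, mulr0, add0r, addr0, subr0, mul1r, mulr1).
by rewrite -signr_odd /= mul1r mulVf.
Qed.

Lemma mono3_unit l : l != 0 -> mono3 l \in unitmx.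
Proof. by move=> l0; rewrite unitmxE mono3_det // unitr1. Qed.

(** The first basis vector is cyclic for [mono3 l] *m [uni3 (a, b, c)]. *)
Lemma SL3_cent l a b c : l != 0 -> u (a, b, c) \in SL ->
  (p %| #|'C_SL[GL_of (mono3 l) * u (a, b, c)]%g|)%N
    = ~~ separable_poly (char_cubic (a + l * b) (l * (a * b - c))).
Proof.
move=> l0 Su; set x := (_ * _)%g.
set A := mx_of_rows 3 [:: [:: 0; 0; l^-1]; [:: 1; a; c]; [:: 0; l; l * b]] : 'M[F]_3.
have xE : GLval x = A.
  rewrite GL_MxE !GL_ofE ?uni3_unit ?mono3_unit //.
  by rewrite /A; mx_entries; ring.
pose row3 (y0 y1 y2 : F) : 'rV[F]_3 := \row_j nth 0 [:: y0; y1; y2] j.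
pose e := row3 1 0 0.
have rowA y0 y1 y2 : row3 y0 y1 y2 *m A =
    row3 y1 (y1 * a + y2 * l) (y0 * l^-1 + y1 * c + y2 * (l * b)).
  by rewrite /A; mx_entries; ring.
have e1 : e *m A = row3 0 0 l^-1.
  by rewrite rowA; congr (row3 _ _ _); ring.
have e2 : e *m A ^+ 2 = row3 0 1 b.
  by rewrite expr2 mulmxA e1 rowA; congr (row3 _ _ _); field.
have e3 : e *m A ^+ 3 = row3 1 (a + l * b) (c + b * (l * b)).
  by rewrite exprSr mulmxA e2 rowA; congr (row3 _ _ _); ring.
apply: (@GL_cyclic_cent _ _ _ SL x e).
- exact: p_pr.
- exact: pchar_card p_pr cardF1.
- by rewrite groupM // inE GL_ofE ?mono3_unit // mono3_det.
- rewrite xE; apply: krylov_unit => d dE.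
  have := dE 0; have := dE 1; have := dE 2%:R.
  rewrite !big_ord_recl !big_ord0 /bump /= ?(add1n, addn0) !expr0 !expr1 !mulmx1.
  rewrite e1 e2 !mxE /= !(mulr0, mulr1, add0r, addr0) => d2 d1 d0.
  move: d2; rewrite d1 mul0r addr0 => /eqP; rewrite mulf_eq0 invr_eq0 (negPf l0).
  by rewrite orbF => /eqP d2; case=> [|[|[|i]]].
- exact: monic_char_cubic.
- exact: size_char_cubic.
rewrite xE (@mulmx_horner _ _ 4) ?size_char_cubic //.
rewrite !big_ord_recl big_ord0 /bump /= ?(add1n, addn0) expr0 expr1 mulmx1.
rewrite e1 e2 e3 /char_cubic !(coefB, coefD, coefN, coefCM, coefXn, coefX, coef1) /=.
by apply/rowP=> j; case_ord j; rewrite !mxE /=; field.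
Qed.

(** As M is abelian, the pairs (a, b) of the elements [uni3 (a, b, c)] of M are on
    one line.  If l <> 0 is such that a + l b <> 0 on this line minus the origin,
    then the map to (t1, t2) = (a + l b, l (a b - c)) is injective on M, hence it
    is a bijection to F^2, and [card_nonseparable_cubic] gives p - 1 exceptional
    elements.  Such an l exists except if p = 2 and the line is a = b; but then
    M would contain an element of order 4. *)
Lemma SL3_regular_unip (M : {group {'GL_3[F]}}) :
    M \subset unip3 -> M \subset SL -> abelian M -> #|M| = (p ^ 2)%N ->
    (forall v, v \in M -> (v ^+ p)%g = 1%g) ->
  regular_coset p SL M.
Proof.
move=> sMU sMS cMM cardM expM.
have Mu v : v \in M -> exists a b c, v = u (a, b, c).
  by move=> Mv; have /imsetP[[[a b] c] _ ->] := subsetP sMU v Mv; exists a, b, c.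
have comm a b c a' b' c' : u (a, b, c) \in M -> u (a', b', c') \in M ->
    a * b' = a' * b.
  move=> Mv Mv'; have /centP/(_ _ Mv') := subsetP cMM _ Mv.
  rewrite /commute !uni3_GLM => /uni3_GL_inj[_ _ /eqP].
  by rewrite [c' + c]addrC (inj_eq (addrI _)) => /eqP.
have [a0 [b0 [c0 [Mv0 ab0]]]] : exists a0 b0 c0,
    u (a0, b0, c0) \in M /\ ((a0 != 0) || (b0 != 0)).
  have [/existsP[[[a b] c] /andP[Mv ab]]|] :=
    boolP [exists w : F * F * F, (u w \in M) && ((w.1.1 != 0) || (w.1.2 != 0))].
    by exists a, b, c.
  rewrite negb_exists => /forallP no_ab.
  have sMZ : M \subset [set u (0, 0, c) | c : F].
    apply/subsetP=> v Mv; have [a [b [c defv]]] := Mu v Mv.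
    have := no_ab (a, b, c); rewrite -defv Mv /= negb_or !negbK.
    by move=> /andP[/eqP a0 /eqP b0]; apply/imsetP; exists c; rewrite // defv a0 b0.
  have := leq_trans (subset_leq_card sMZ) (leq_imset_card _ _).
  by rewrite cardM cardF expnS expn1 -[X in (_ <= X)%N]muln1 leq_pmul2l ?prime_gt0 // leqNgt prime_gt1.
(* then a0 + l b0 is one of a0, b0 and 2 a0 *)
pose l := if a0 * b0 == 0 then 1 else a0 / b0.
have l0 : l != 0.
  rewrite /l; case: (a0 * b0 =P 0) => [_|/eqP]; first exact: oner_neq0.
  by rewrite mulf_eq0 negb_or => /andP[a00 b00]; rewrite mulf_neq0 ?invr_eq0.
have two_neq0 : a0 * b0 != 0 -> 2%:R != 0 :> F.
  apply: contraNneq => two0.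
  have p2 : p = 2%N.
    by apply/eqP; rewrite -dvdn_prime2 // (dvdn_pcharf (pchar_card p_pr cardF1)) two0.
  have := expM _ Mv0; rewrite p2 expgS expg1 uni3_GLM -uni3_GL1.
  move/uni3_GL_inj => -[_ _ /eqP].
  by rewrite -mulr2n -mulr_natl two0 mul0r add0r => ->.
have l_inj a b c : u (a, b, c) \in M -> a + l * b = 0 -> a = 0 /\ b = 0.
  move=> Mv abl; have := comm _ _ _ _ _ _ Mv Mv0.
  move: abl; rewrite /l; case: (a0 * b0 =P 0) => [/eqP|/eqP ab0'].
    rewrite mulf_eq0 mul1r => /orP[]/eqP z0 abl; rewrite z0 ?(mul0r, mulr0).
      move/eqP; rewrite mulf_eq0; move: ab0; rewrite z0 eqxx /= => /negPf->.
      by rewrite orbF => /eqP a_0; move: abl; rewrite a_0 add0r.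
    move/esym/eqP; rewrite mulf_eq0; move: ab0; rewrite z0 eqxx orbF => /negPf->.
    by move=> /eqP b_0; move: abl; rewrite b_0 addr0.
  move=> abl e; have /norP[a00 b00] : ~~ ((a0 == 0) || (b0 == 0)) by rewrite -mulf_eq0.
  have aE : a = a0 / b0 * b by apply: (mulIf b00); rewrite e; field.
  have /eqP : 2%:R * (a0 / b0) * b = 0 by rewrite -[RHS]abl [in RHS]aE; ring.
  rewrite !mulf_eq0 invr_eq0 (negPf a00) (negPf b00) (negPf (two_neq0 ab0')) /=.
  by move=> /eqP b_0; rewrite aE b_0 mulr0.
pose f v : F * F := if [pick w : F * F * F | v == u w] is Some (a, b, c)
  then (a + l * b, l * (a * b - c)) else (0, 0).
have fE a b c : f (u (a, b, c)) = (a + l * b, l * (a * b - c)).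
  rewrite /f; case: pickP => [[[a' b'] c'] /eqP/uni3_GL_inj[<- <- <-]//|].
  by move/(_ (a, b, c)); rewrite eqxx.
have f_inj : {in M &, injective f}.
  move=> v v' Mv Mv'; have [a [b [c defv]]] := Mu v Mv.
  have [a' [b' [c' defv']]] := Mu v' Mv'.
  have : (v * v'^-1)%g \in M by rewrite groupM ?groupV.
  rewrite defv defv' !fE uni3_GLV uni3_GLM => /l_inj dab [t1 t2].
  have [] := dab; first by rewrite mulrBr addrACA t1 -opprD subrr.
  move=> /eqP + /eqP; rewrite !subr_eq0 => /eqP ea /eqP eb.
  by move: t2; rewrite ea eb => /(mulfI l0)/addrI/oppr_inj ->.
have fM : f @: M = setT.
  apply/eqP; rewrite eqEcard subsetT cardsT card_prod card_in_imset // cardM cardF.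
  by rewrite expnS expn1 leqnn.
exists (GL_of (mono3 l)); first by rewrite inE GL_ofE ?mono3_unit // mono3_det.
rewrite (_ : #|_| = p.-1); last first.
  rewrite -[in RHS]cardF -(card_nonseparable_cubic p_pr cardF).
  rewrite -(card_in_imset (f := f)); last by move=> v v' /setIdP[Mv _] /setIdP[Mv' _]; apply: f_inj.
  apply: eq_card => t; rewrite [in RHS]inE; apply/imsetP/idP => [[v /setIdP[Mv pv] ->]|nsep].
    have [a [b [c defv]]] := Mu v Mv; move: pv; rewrite defv fE.
    by rewrite SL3_cent // -defv (subsetP sMS).
  have /imsetP[v Mv tf] : t \in f @: M by rewrite fM inE.
  have [a [b [c defv]]] := Mu v Mv; exists v => //; rewrite inE Mv defv.
  by rewrite SL3_cent // -?defv ?(subsetP sMS) //; move: nsep; rewrite tf defv fE.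
have p_gt1 := prime_gt1 p_pr.
by rewrite gtnNdvd // -?subn1 ?subn_gt0 // subn1 ltn_predL prime_gt0.
Qed.

(** The order of M is a square that divides p ^ 3. *)
Lemma SL3_regular (M : {group {'GL_3[F]}}) k :
    M \subset SL -> (p.-group M)%g -> M :!=: 1%g -> abelian M ->
    #|M| = (k ^ 2)%N -> (forall v, v \in M -> (v ^+ k)%g = 1%g) ->
  regular_coset p SL M.
Proof.
move=> sMS pM M1 cMM cardM expM.
have [x _ sMU] := Sylow_subJ unip3_Sylow (subsetT M) pM.
have kp : k = p.
  have : (#|M| %| p ^ 3)%N.
    rewrite -(_ : #|unip3| = p ^ 3)%N -?(cardJg unip3 x) ?cardSg //.
    rewrite cardJg card_imset ?card_prod ?cardF; last exact: uni3_GL_inj.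
    by rewrite !expnS expn0 muln1 mulnA.
  have : (k %| #|M|)%N by rewrite cardM dvdn_exp.
  have [j Mj] := p_natP pM; rewrite Mj => /(dvdn_pfactor _ _ p_pr)[i _ ki].
  rewrite -Mj cardM ki -expnM dvdn_Pexp2l ?prime_gt1 //.
  case: i ki => [|[|[|i]]] ki //.
  by case/eqP: M1; apply/eqP; rewrite trivg_card1 cardM ki.
rewrite {}kp in cardM expM.
apply: (@regular_coset_conj _ _ _ _ x^-1%g) => //; first exact: (@GL_norm_SL F 2).
apply: SL3_regular_unip => /=.
- by rewrite sub_conjgV.
- by rewrite sub_conjgV (normP (@GL_norm_SL F 2 x)).
- by rewrite abelianJ.
- by rewrite cardJg.
move=> v; rewrite mem_conjg invgK => /expM; rewrite -conjXg => /eqP.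
by rewrite conjg_eq1 => /eqP.
Qed.

End SL3.

(** * The Suzuki groups *)

Section Suzuki.
Variables (n : nat) (F : finFieldType).
Hypotheses (n_gt0 : (0 < n)%N) (cardF : #|F| = (2 ^ (2 * n + 1))%N).
Local Notation Sz := (suzuki_group n F).
Local Notation th := (@suzuki_theta n F).

Let char2 : 2%N \in [pchar F].
Proof. exact: pchar_card cardF. Qed.

Let two0 : 2%:R = 0 :> F.
Proof. exact: pcharf0 char2. Qed.

(** [ring] does not know that 2 = 0, so identities in characteristic 2 are proved
    up to an explicit multiple of 2. *)
Lemma char2_eq (x y e : F) : x = y + 2%:R * e -> x = y.
Proof. by rewrite two0 mul0r addr0. Qed.

Lemma pow2_eq1 k (x : F) : x ^+ (2 ^ k) = 1 -> x = 1.
Proof.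
elim: k => [|k IHk]; first by rewrite expn0 expr1.
rewrite expnSr exprM => /eqP; rewrite sqrf_eq1 => /orP[]/eqP xk; apply: IHk => //.
by rewrite xk; apply: (@char2_eq _ _ (- 1)); ring.
Qed.

Lemma thetaM x y : th (x * y) = th x * th y.
Proof. exact: exprMn. Qed.

Lemma thetaD x y : th (x + y) = th x + th y.
Proof.
rewrite /suzuki_theta; elim: n.+1 => [|k IHk]; first by rewrite !expr1.
by rewrite expnSr !exprM IHk sqrrD -mulr_natl two0 mul0r addr0.
Qed.

Lemma theta0 : th 0 = 0.
Proof. by rewrite /suzuki_theta expr0n expn_eq0. Qed.

Lemma theta1 : th 1 = 1.
Proof. exact: expr1n. Qed.

Lemma thetaV x : th x^-1 = (th x)^-1.
Proof. exact: exprVn. Qed.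

Lemma theta_eq0 x : (th x == 0) = (x == 0).
Proof. by rewrite expf_eq0 expn_gt0. Qed.

(** The automorphism theta is a square root of the Frobenius automorphism. *)
Lemma thetaK x : th (th x) = x ^+ 2.
Proof.
rewrite /suzuki_theta -exprM -expnD -[in RHS](expf_card x) cardF -exprM -expnSr.
by congr (_ ^+ (2 ^ _)); rewrite addn1 mul2n -addnn !addSn addnS.
Qed.

Lemma theta_fix x : th x = x -> x = 0 \/ x = 1.
Proof.
move=> thx; have /eqP : x ^+ 2 - x = 0 by rewrite -thetaK !thx subrr.
rewrite expr2 -[X in _ - X]mulr1 -mulrBr mulf_eq0 subr_eq0.
by case/orP=> /eqP; [left|right].
Qed.

(** The exponents 2, 2 + 2 ^ n.+1 and 2 ^ n.+1 are distinct and smaller than q, so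
    a polynomial with these exponents that vanishes on F_q is zero. *)
Lemma theta_poly0 A B C :
    (forall x, A * x ^+ 2 + B * (x ^+ 2 * th x) + C * th x = 0) ->
  B = 0 /\ C = 0.
Proof.
move=> ABC; pose k := (2 ^ n.+1)%N.
have k2 : (2 < k)%N by rewrite /k expnS -{1}[2%N]muln1 ltn_pmul2l // -{1}(expn0 2) ltn_exp2l.
have kq : (2 + k < #|F|)%N.
  rewrite cardF (@leq_trans (2 ^ n.+2)) //.
    by rewrite [in X in (_ < X)%N]expnS mul2n -addnn ltn_add2r.
  by rewrite leq_exp2l // addn1 ltnS mul2n -addnn -addn1 leq_add2l.
pose P : {poly F} := A *: 'X^2 + B *: 'X^(2 + k) + C *: 'X^k.
have szP : (size P <= 3 + k)%N.
  have szX i c : (i < 3 + k)%N -> (size (c *: 'X^i : {poly F}) <= 3 + k)%N.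
    by move=> i_lt; rewrite (leq_trans (size_scale_leq _ _)) // size_polyXn.
  have szD (Q1 Q2 : {poly F}) : (size Q1 <= 3 + k)%N -> (size Q2 <= 3 + k)%N ->
      (size (Q1 + Q2)%R <= 3 + k)%N.
    by move=> s1 s2; rewrite (leq_trans (size_polyD _ _)) // geq_max s1.
  by rewrite !szD // szX // -[X in (X < _)%N]add0n ltn_add2r.
have P0 : P = 0.
  apply/eqP; apply: contraTT (leq_trans szP kq) => P_neq0; rewrite -ltnNge cardE.
  apply: max_poly_roots => //; last exact: enum_uniq.
  apply/allP=> x _; rewrite /root !hornerD !hornerZ !hornerXn exprD.
  by apply/eqP/ABC.
have coefP i : P`_i = A * (i == 2)%:R + B * (i == 2 + k)%:R + C * (i == k)%:R.
  by rewrite !coefD !coefZ !coefXn.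
split.
  have := coefP (2 + k)%N; rewrite P0 coef0 eqxx -[X in _ == X]addn0 eqn_add2l.
  rewrite -[X in (_ + k == X)%N]add0n eqn_add2r (gtn_eqF (ltnW (ltnW k2))) /=.
  by rewrite !mulr0 mulr1 add0r addr0.
have := coefP k; rewrite P0 coef0 eqxx (gtn_eqF k2) -[X in X == _]add0n eqn_add2r.
by rewrite !mulr0 mulr1 !add0r.
Qed.

(** The points (f x y : y : x : 1) together with (1 : 0 : 0 : 0) are the
    Suzuki-Tits ovoid. *)
Definition ovoid_fun x y := x * y + x ^+ 2 * th x + th y.
Local Notation f := ovoid_fun.

(** The translation of the ovoid by [suzuki_u]. *)
Lemma ovoid_fun_add x y a b :
  f (x + a) (y + b + x * th a) = f x y + y * a + x * (a * th a + b) + f a b.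
Proof.
rewrite /f !thetaD thetaM thetaK.
apply: (@char2_eq _ _ (x ^+ 2 * th a + x * a * (th x + th a) + a ^+ 2 * th x)).
ring.
Qed.

(** If x <> 0, then write y = x theta(x) t.  The value is
    x^2 theta(x) (1 + t + theta(t)), and theta(t) = 1 + t implies t^2 = t by
    [thetaK]; but theta fixes 0 and 1. *)
Lemma ovoid_fun_eq0 x y : f x y = 0 -> x = 0 /\ y = 0.
Proof.
have [->|x0] := eqVneq x 0.
  rewrite /f mul0r expr0n /= mul0r !add0r => /eqP.
  by rewrite theta_eq0 => /eqP.
have tx0 : th x != 0 by rewrite theta_eq0.
move=> fxy; have [t yE] : exists t, y = x * th x * t.
  by exists (y / (x * th x)); rewrite mulrC divfK // mulf_neq0.
have tht : th t = 1 + t.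
  apply: (mulfI (_ : x ^+ 2 * th x != 0)); first by rewrite mulf_neq0 ?expf_neq0.
  apply: (@char2_eq _ _ (- (x ^+ 2 * th x * (1 + t)))).
  transitivity (f x y - x ^+ 2 * th x * (1 + t)); last by rewrite fxy; ring.
  by rewrite /f yE !thetaM thetaK; ring.
have tt : t ^+ 2 = t.
  rewrite -thetaK !tht thetaD theta1 tht; apply: (@char2_eq _ _ 1); ring.
have : (1 : F) = 0.
  apply: (@char2_eq _ _ (1 + t - t)); transitivity (th t - t).
    by rewrite tht; ring.
  have /eqP : t * (t - 1) = 0 by rewrite mulrBr mulr1 -expr2 tt subrr.
  rewrite mulf_eq0 subr_eq0 => /orP[]/eqP->; rewrite ?theta0 ?theta1 two0; ring.
by move/eqP; rewrite oner_eq0.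
Qed.

(** The antidiagonal involution exchanges the points (z : y : x : 1) and
    (1 : x : y : z). *)
Lemma ovoid_fun_inv x y : f x y != 0 -> f (y / f x y) (x / f x y) = (f x y)^-1.
Proof.
set z := f x y => z0; have tz0 : th z != 0 by rewrite theta_eq0.
rewrite /f !thetaM !thetaV.
apply: (mulIf (_ : z ^+ 2 * th z != 0)); first by rewrite mulf_neq0 ?expf_neq0.
transitivity (x * y * th z + y ^+ 2 * th y + th x * z ^+ 2); first by field; rewrite z0 tz0.
transitivity (z * th z); last by field.
have -> : th z = th x * th y + x ^+ 2 * th x ^+ 2 + y ^+ 2.
  by rewrite /z /f !thetaD !thetaM !thetaK; ring.
rewrite /z /f.
apply: (@char2_eq _ _ (x ^+ 3 * y * th x ^+ 2 + x * y * th x * th y)).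
ring.
Qed.

Definition row4 (y0 y1 y2 y3 : F) : 'rV[F]_4 := \row_j nth 0 [:: y0; y1; y2; y3] j.
Local Notation w := (@suzuki_anti F).
Local Notation su := (@suzuki_u n F).

Lemma row4E (r : 'rV[F]_4) : r = row4 (r 0 0) (r 0 1) (r 0 2%:R) (r 0 3%:R).
Proof.
apply/rowP=> j; case_ord j; rewrite mxE /=; congr (r 0 _); exact: val_inj.
Qed.

Lemma row4_eq y0 y1 y2 y3 z0 z1 z2 z3 :
  row4 y0 y1 y2 y3 = row4 z0 z1 z2 z3 -> [/\ y0 = z0, y1 = z1, y2 = z2 & y3 = z3].
Proof.
move=> /rowP E; split; [move: (E 0)|move: (E 1)|move: (E 2%:R)|move: (E 3%:R)];
  by rewrite !mxE.
Qed.

Lemma row4Z k y0 y1 y2 y3 : k *: row4 y0 y1 y2 y3 = row4 (k * y0) (k * y1) (k * y2) (k * y3).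
Proof. by apply/rowP=> j; case_ord j; rewrite !mxE. Qed.

Lemma row4_anti y0 y1 y2 y3 : row4 y0 y1 y2 y3 *m w = row4 y3 y2 y1 y0.
Proof. by mx_entries; ring. Qed.

Lemma row4_suzuki_u y0 y1 y2 y3 a b : row4 y0 y1 y2 y3 *m su a b =
  row4 (y0 + y1 * a + y2 * (a * th a + b) + y3 * (a ^+ 2 * th a + a * b + th b))
       (y1 + y2 * th a + y3 * b) (y2 + y3 * a) y3.
Proof. by mx_entries; ring. Qed.

Lemma row4_suzuki_diag y0 y1 y2 y3 a1 a2 : row4 y0 y1 y2 y3 *m suzuki_diag a1 a2 =
  row4 (y0 * a1) (y1 * a2) (y2 * a2^-1) (y3 * a1^-1).
Proof. by mx_entries; ring. Qed.

Lemma anti_unit : w \in unitmx.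
Proof.
have : w *m w = 1%:M by mx_entries; ring.
by case/mulmx1_unit.
Qed.

Lemma suzuki_u_unit a b : su a b \in unitmx.
Proof.
rewrite unitmxE det_trig ?big_ord_recl ?big_ord0 ?mxE /= ?mulr1 ?unitr1 //.
apply/is_trig_mxP=> i j; case_ord i; case_ord j; by rewrite mxE.
Qed.

Definition suzuki_form (r s : 'rV[F]_4) : F := (r *m w *m s^T) 0 0.

Lemma suzuki_formE y0 y1 y2 y3 z0 z1 z2 z3 :
  suzuki_form (row4 y0 y1 y2 y3) (row4 z0 z1 z2 z3)
    = y0 * z3 + y1 * z2 + y2 * z1 + y3 * z0.
Proof.
rewrite /suzuki_form row4_anti ?(mxE, big_ord_recl, big_ord0) /=; ring.
Qed.

(** The nonzero vectors on the lines of the ovoid. *)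
Definition in_cone (r : 'rV[F]_4) : Prop :=
  (exists2 c, c != 0 & r = row4 c 0 0 0) \/
  (exists c x y, c != 0 /\ r = row4 (c * f x y) (c * y) (c * x) c).

(** The symplectic isometries that preserve the ovoid. *)
Definition suzuki_like (A : 'M[F]_4) : Prop :=
  (forall r s, suzuki_form (r *m A) (s *m A) = suzuki_form r s) /\
  (forall r, in_cone r -> in_cone (r *m A)).

Lemma suzuki_like_u a b : suzuki_like (su a b).
Proof.
split=> [r s|_ [[c c0 ->]|[c [x [y [c0 ->]]]]]].
- rewrite (row4E r) (row4E s) !row4_suzuki_u !suzuki_formE.
  apply: (@char2_eq _ _ (a * r 0 1 * s 0 3%:R + th a * r 0 2%:R * s 0 2%:R
    + (a * th a + b) * (r 0 2%:R * s 0 3%:R + r 0 3%:R * s 0 2%:R)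
    + (a * b + (a ^+ 2 * th a + a * b + th b)) * r 0 3%:R * s 0 3%:R
    + a * r 0 3%:R * s 0 1)).
  ring.
- left; exists c => //; rewrite row4_suzuki_u; congr (row4 _ _ _ _); ring.
right; exists c, (x + a), (y + b + x * th a); split=> //.
rewrite row4_suzuki_u ovoid_fun_add; congr (row4 _ _ _ _); rewrite /f; ring.
Qed.

Lemma suzuki_like_diag a1 a2 k : k != 0 -> th a1 = k * th k -> th a2 = k ->
  suzuki_like (suzuki_diag a1 a2).
Proof.
move=> k0 tha1 tha2.
have a20 : a2 != 0 by rewrite -theta_eq0 tha2.
have a10 : a1 != 0 by rewrite -theta_eq0 tha1 mulf_neq0 ?theta_eq0.
split=> [r s|_ [[c c0 ->]|[c [x [y [c0 ->]]]]]].
- rewrite (row4E r) (row4E s) !row4_suzuki_diag !suzuki_formE.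
  by field; rewrite a10 a20.
- left; exists (c * a1); first by rewrite mulf_neq0.
  by rewrite row4_suzuki_diag; congr (row4 _ _ _ _); ring.
right; exists (c * a1^-1), (x * a1 / a2), (y * a1 * a2); split.
  by rewrite mulf_neq0 ?invr_eq0.
have a1sq : a1 ^+ 2 = th k * k ^+ 2 by rewrite -thetaK tha1 thetaM thetaK.
have thk : th k = a2 ^+ 2 by rewrite -tha2 thetaK.
have fE : f (x * a1 / a2) (y * a1 * a2) = a1 ^+ 2 * f x y.
  rewrite /f !thetaM thetaV tha1 tha2 thk.
  transitivity (a1 ^+ 2 * (x * y) + a1 ^+ 2 * (x ^+ 2 * th x) + th y * (k * a2 ^+ 2) * k).
    by field; rewrite a20 k0.
  by rewrite a1sq thk; ring.
rewrite row4_suzuki_diag fE; congr (row4 _ _ _ _); field; by rewrite ?a10 ?a20.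
Qed.

Lemma suzuki_like_anti : suzuki_like w.
Proof.
split=> [r s|_ [[c c0 ->]|[c [x [y [c0 ->]]]]]].
- by rewrite (row4E r) (row4E s) !row4_anti !suzuki_formE; ring.
- right; exists c, 0, 0; split=> //; rewrite row4_anti.
  by congr (row4 _ _ _ _); rewrite ?mulr0 // /f theta0 expr0n /= !(mulr0, mul0r, addr0).
rewrite row4_anti; have [fxy|fxy] := eqVneq (f x y) 0.
  have [-> ->] := ovoid_fun_eq0 fxy; left; exists c => //.
  by rewrite !mulr0 /f theta0 expr0n /= !(mulr0, mul0r, addr0).
right; exists (c * f x y), (y / f x y), (x / f x y).
split; first by rewrite mulf_neq0.
by rewrite ovoid_fun_inv //; congr (row4 _ _ _ _); field.
Qed.

Definition suzuki_likes : {set {'GL_4[F]}} :=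
  [set g : {'GL_4[F]} | `[< suzuki_like (GLval g) >]].

Lemma suzuki_likes_group : group_set suzuki_likes.
Proof.
apply/group_setP; split=> [|g h].
  by rewrite inE; apply/asboolP; split=> [r s|r]; rewrite !mulmx1.
rewrite !inE => /asboolP[gf gc] /asboolP[hf hc]; apply/asboolP; rewrite GL_MxE.
split=> [r s|r rc]; rewrite !mulmxA; first by rewrite hf gf.
exact/hc/gc.
Qed.
Canonical suzuki_likes_groupType := Group suzuki_likes_group.

Lemma suzuki_mem_like g : g \in Sz -> suzuki_like (GLval g).
Proof.
move=> Sg; suff: g \in suzuki_likes by rewrite inE => /asboolP.
move: g Sg; apply/subsetP; rewrite gen_subG; apply/subsetP=> g.
rewrite !inE => /orP[/orP[]|/eqP gE]; last 1 first.
- by apply/asboolP; rewrite gE; apply: suzuki_like_anti.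
- case/existsP=> a /existsP[b /eqP gE]; apply/asboolP; rewrite gE.
  exact: suzuki_like_u.
case/existsP=> a1 /existsP[a2 /existsP[k]].
case/and4P=> k0 /eqP tha1 /eqP tha2 /eqP gE; apply/asboolP; rewrite gE.
exact: suzuki_like_diag tha1 tha2.
Qed.

Definition suzuki_GLu a b : {'GL_4[F]} := GL_of (su a b).
Definition suzuki_GLw : {'GL_4[F]} := GL_of w.
Local Notation uS := suzuki_GLu.
Local Notation wS := suzuki_GLw.

Lemma suzuki_GLuE a b : GLval (uS a b) = su a b.
Proof. exact: GL_ofE (suzuki_u_unit a b). Qed.

Lemma suzuki_GLwE : GLval wS = w.
Proof. exact: GL_ofE anti_unit. Qed.

Lemma suzuki_GLu_mem a b : uS a b \in Sz.
Proof.
apply: mem_gen; rewrite !inE; apply/orP; left; apply/orP; left.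
by apply/existsP; exists a; apply/existsP; exists b; rewrite suzuki_GLuE.
Qed.

Lemma suzuki_GLw_mem : wS \in Sz.
Proof. by apply: mem_gen; rewrite !inE suzuki_GLwE eqxx orbT. Qed.

Lemma suzuki_GLuM a b c d : (uS a b * uS c d)%g = uS (a + c) (b + d + a * th c).
Proof.
apply: GL_injE; rewrite GL_MxE !suzuki_GLuE.
mx_entries; try ring.
- by rewrite thetaD; apply: (@char2_eq _ _ (- (a * th c))); ring.
- by rewrite thetaD; ring.
transitivity (f (a + c) (b + d + a * th c)); last by rewrite /f; ring.
by rewrite ovoid_fun_add /f; ring.
Qed.

Lemma row4_mul (A : 'M[F]_4) y0 y1 y2 y3 : row4 y0 y1 y2 y3 *m A =
  y0 *: (row4 1 0 0 0 *m A) + y1 *: (row4 0 1 0 0 *m A)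
    + y2 *: (row4 0 0 1 0 *m A) + y3 *: (row4 0 0 0 1 *m A).
Proof.
rewrite !scalemxAl -!mulmxDl; congr (_ *m _).
by apply/rowP=> j; case_ord j; rewrite !mxE /=; ring.
Qed.

Lemma row4_mx_eq (A B : 'M[F]_4) :
  (forall y0 y1 y2 y3, row4 y0 y1 y2 y3 *m A = row4 y0 y1 y2 y3 *m B) -> A = B.
Proof.
move=> AB; apply/row_matrixP=> i; rewrite !rowE (row4E (delta_mx _ _)); exact: AB.
Qed.

(** The images of e2 and e3 are orthogonal to e1 and e4, so A acts on the
    coordinates (x, y) of the ovoid by a 2 x 2 matrix that preserves [ovoid_fun].
    On the axes this is an identity between polynomials in one variable, and
    the coefficients of theta(x) and of y^2 theta(y) show that the matrix is
    diagonal. *)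
Lemma suzuki_like_diagonal A c : suzuki_like A ->
    row4 1 0 0 0 *m A = row4 1 0 0 0 ->
    row4 0 0 0 1 *m A = c *: row4 0 0 0 1 ->
  exists p q, [/\ p * q = 1, c = 1,
    row4 0 1 0 0 *m A = row4 0 p 0 0 & row4 0 0 1 0 *m A = row4 0 0 q 0].
Proof.
move=> [Af Ac] A1 A4.
have c1 : c = 1.
  have := Af (row4 1 0 0 0) (row4 0 0 0 1).
  by rewrite A1 A4 row4Z !suzuki_formE !(mulr0, mul0r, mulr1, addr0, add0r, mul1r).
rewrite c1 scale1r in A4.
have mid r : suzuki_form r (row4 1 0 0 0) = 0 -> suzuki_form r (row4 0 0 0 1) = 0 ->
    exists p q, r *m A = row4 0 p q 0.
  rewrite -(Af r (row4 1 0 0 0)) -(Af r (row4 0 0 0 1)) A1 A4.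
  rewrite (row4E (r *m A)) !suzuki_formE !(mulr0, mul0r, mulr1, addr0, add0r, mul1r).
  by move=> -> ->; eexists; eexists; reflexivity.
have [p2 [p3 A2]] : exists p q, row4 0 1 0 0 *m A = row4 0 p q 0.
  by apply: mid; rewrite suzuki_formE; ring.
have [q2 [q3 A3]] : exists p q, row4 0 0 1 0 *m A = row4 0 p q 0.
  by apply: mid; rewrite suzuki_formE; ring.
have fA x y : f (y * p3 + x * q3) (y * p2 + x * q2) = f x y.
  have : in_cone (row4 (f x y) y x 1 *m A).
    apply: Ac; right; exists 1, x, y; split; first exact: oner_neq0.
    by rewrite !mul1r.
  rewrite row4_mul A1 A2 A3 A4 !row4Z.
  have -> : row4 (f x y * 1) (f x y * 0) (f x y * 0) (f x y * 0) +
     row4 (y * 0) (y * p2) (y * p3) (y * 0) + row4 (x * 0) (x * q2) (x * q3) (x * 0)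
     + row4 (1 * 0) (1 * 0) (1 * 0) (1 * 1)
     = row4 (f x y) (y * p2 + x * q2) (y * p3 + x * q3) 1.
    by apply/rowP=> j; case_ord j; rewrite !mxE /=; ring.
  case=> [[k k0 /row4_eq[_ _ _ /eqP]]|[k [x' [y' [k0 /row4_eq[]]]]]].
    by rewrite oner_eq0.
  by move=> + + + k1; rewrite -k1 !mul1r => -> -> ->.
have q20 : q2 = 0.
  have [|_] := @theta_poly0 (q3 * q2) (q3 ^+ 2 * th q3 - 1) (th q2).
    move=> x; have := fA x 0; rewrite /f !mul0r !add0r theta0 mulr0 add0r addr0 !thetaM.
    move/eqP; rewrite -subr_eq0 => /eqP <-; ring.
  by move/eqP; rewrite theta_eq0 => /eqP.
have p30 : p3 = 0.
  have [|+ _] := @theta_poly0 (p3 * p2) (p3 ^+ 2 * th p3) (th p2 - 1).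
    move=> y; have := fA 0 y; rewrite /f !mul0r expr0n /= mul0r !addr0 !add0r !thetaM.
    move/eqP; rewrite -subr_eq0 => /eqP <-; ring.
  by move/eqP; rewrite mulf_eq0 expf_eq0 theta_eq0 /= orbb => /eqP.
exists p2, q3; split=> //; last first.
- by rewrite A3 q20.
- by rewrite A2 p30.
have := Af (row4 0 1 0 0) (row4 0 0 1 0).
by rewrite A2 A3 q20 p30 !suzuki_formE !(mulr0, mul0r, mulr1, addr0, add0r, mul1r).
Qed.

Lemma row4_suzuki_u_fix a b : row4 1 0 0 0 *m su a b = row4 1 0 0 0.
Proof. by rewrite row4_suzuki_u; congr (row4 _ _ _ _); ring. Qed.

(** The point e4 is mapped to a point of the ovoid other than e1, as it is by some
    u(x, y).  So g u(x, y)^-1 is diagonal, with entries 1, p, p^-1 and 1, and p is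
    the eigenvalue of g on <e1, e2> / <e1>.  A root of unity of order a power
    of 2 is equal to 1. *)
Lemma suzuki_stabilizer_unipotent g : g \in Sz -> (2.-elt g)%g ->
  row4 1 0 0 0 *m GLval g = row4 1 0 0 0 -> exists a b, g = uS a b.
Proof.
move=> Sg g2 g1; have [_ gc] := suzuki_mem_like Sg.
have gu : GLval g \in unitmx by exact: GL_unit.
have [c [x [y [c0 g4]]]] : exists c x y, c != 0 /\
    row4 0 0 0 1 *m GLval g = row4 (c * f x y) (c * y) (c * x) c.
  have [|[c c0 g4]|//] := gc (row4 0 0 0 1).
    right; exists 1, 0, 0; split; first exact: oner_neq0.
    by congr (row4 _ _ _ _); rewrite ?mulr0 // /f theta0 expr0n /=; ring.
  have : row4 0 0 0 1 *m GLval g = row4 c 0 0 0 *m GLval g.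
    by rewrite g4 row4_mul g1 row4Z !scale0r !addr0 !mulr0 mulr1.
  move/(congr1 (mulmx^~ (invmx (GLval g)))); rewrite !mulmxK //.
  by move/row4_eq=> [_ _ _ /eqP]; rewrite oner_eq0.
have [g0 Sg0 gE] : exists2 g0, g0 \in Sz & GLval g = GLval g0 *m su x y.
  exists (g * (uS x y)^-1)%g; first by rewrite groupM ?groupV ?suzuki_GLu_mem.
  by rewrite -suzuki_GLuE -GL_MxE mulgKV.
have suV r s : r *m GLval g = s *m su x y -> r *m GLval g0 = s.
  rewrite gE mulmxA => /(congr1 (mulmx^~ (invmx (su x y)))).
  by rewrite !mulmxK ?suzuki_u_unit.
have g01 : row4 1 0 0 0 *m GLval g0 = row4 1 0 0 0.
  by apply: suV; rewrite g1 row4_suzuki_u_fix.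
have g04 : row4 0 0 0 1 *m GLval g0 = c *: row4 0 0 0 1.
  apply: suV; rewrite g4 -scalemxAl row4_suzuki_u row4Z.
  by congr (row4 _ _ _ _); rewrite /f; ring.
have [p [q [pq c1 A2 A3]]] := suzuki_like_diagonal (suzuki_mem_like Sg0) g01 g04.
rewrite c1 scale1r in g04.
have e2X k : exists t, row4 0 1 0 0 *m GLval (g ^+ k)%g = row4 t (p ^+ k) 0 0.
  elim: k => [|k [t IHk]]; first by exists 0; rewrite mulmx1 expr0.
  exists (t + p ^+ k * (p * x)).
  rewrite expgSr GL_MxE mulmxA IHk row4_mul g1 gE !mulmxA A2 row4_suzuki_u !row4Z.
  rewrite !scale0r !addr0; apply/rowP=> j; case_ord j; rewrite !mxE /= ?exprS; ring.
have [k ok] := p_natP g2.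
have p1 : p = 1.
  apply: (@pow2_eq1 k); have [t] := e2X (2 ^ k)%N.
  by rewrite -ok expg_order mulmx1 => /row4_eq[].
exists x, y; apply: GL_injE; rewrite gE suzuki_GLuE -[RHS]mul1mx; congr (_ *m _).
apply: row4_mx_eq => y0 y1 y2 y3; rewrite row4_mul g01 A2 A3 g04 mulmx1.
rewrite p1 mul1r in pq; rewrite p1 pq.
by apply/rowP=> j; case_ord j; rewrite !mxE /=; ring.
Qed.

Definition cone : {set 'rV[F]_4} := [set r | `[< in_cone r >]].

(** The cone has (q - 1) (q ^ 2 + 1) elements and q is even. *)
Lemma odd_cone : odd #|cone|.
Proof.
pose A := [set row4 c 0 0 0 | c in [set~ (0 : F)]].
pose g (t : F * (F * F)) := row4 (t.1 * f t.2.1 t.2.2) (t.1 * t.2.2) (t.1 * t.2.1) t.1.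
pose B := g @: setX [set~ (0 : F)] setT.
have -> : cone = A :|: B.
  apply/setP=> r; rewrite !inE; apply/asboolP/orP.
    case=> [[c c0 ->]|[c [x [y [c0 ->]]]]]; [left|right].
      by apply/imsetP; exists c; rewrite ?inE.
    by apply/imsetP; exists (c, (x, y)); rewrite ?inE ?c0.
  case=> /imsetP[]; first by move=> c; rewrite !inE => c0 ->; left; exists c.
  move=> [c [x y]]; rewrite !inE /= andbT => c0 ->.
  by right; exists c, x, y.
rewrite cardsU (_ : A :&: B = set0) ?cards0 ?subn0; last first.
  apply/setP=> r; rewrite !inE; apply/andP=> -[/imsetP[c _ ->]].
  case/imsetP=> -[d [x y]]; rewrite !inE /= andbT => d0 /row4_eq[_ _ _ /esym/eqP].
  by rewrite (negPf d0).
rewrite !card_in_imset ?cardsX ?cardsC1.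
- rewrite cardsT card_prod -[X in odd X]addnC oddD !oddM.
  have -> : odd #|F| = false by rewrite cardF addn1 expnS oddM.
  have := prime_gt0; rewrite -subn1 oddB ?cardF ?expn_gt0 //.
  by rewrite addn1 expnS oddM.
- move=> [c [x y]] [c' [x' y']]; rewrite !inE /= !andbT => c0 _.
  by move/row4_eq=> [_ /=] + + e; rewrite -e => /(mulfI c0)-> /(mulfI c0)->.
by move=> c c' _ _ /row4_eq[].
Qed.

Definition row_act (r : 'rV[F]_4) (g : {'GL_4[F]}) : 'rV[F]_4 := r *m GLval g.

Lemma row_act_is_action : is_action [set: {'GL_4[F]}] row_act.
Proof.
split=> [g r s|r g h _ _]; last by rewrite /row_act GL_MxE mulmxA.
move/(congr1 (mulmx^~ (invmx (GLval g)))).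
by rewrite /row_act !mulmxK //; apply: GL_unit.
Qed.

Canonical row_action := Action row_act_is_action.

(** The cone has an odd number of elements, so M fixes one of them, and the Suzuki
    group is transitive on the points of the ovoid. *)
Lemma suzuki_conj_unipotent (M : {group {'GL_4[F]}}) : M \subset Sz -> (2.-group M)%g ->
  exists2 g, g \in Sz & forall v, v \in (M :^ g)%g -> exists a b, v = uS a b.
Proof.
move=> sMS M2.
have actM : [acts M, on cone | row_action].
  apply/subsetP=> g Mg; rewrite !inE /=; apply/subsetP=> r; rewrite !inE => /asboolP rc.
  by apply/asboolP; have [_] := suzuki_mem_like (subsetP sMS g Mg); apply.
have [r] : exists r, r \in 'Fix_(cone | row_action)(M).
  apply/set0Pn; rewrite -card_gt0 lt0n; apply: contraL odd_cone => /eqP Fix0.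
  have := pgroup_fix_mod M2 actM; rewrite Fix0 modn2 mod0n.
  by case: (odd _).
rewrite inE => /andP[]; rewrite inE => /asboolP rc /afixP rM.
suff [g [c [Sg c0 rg]]] : exists g c, [/\ g \in Sz, c != 0 & r *m GLval g = row4 c 0 0 0].
  exists g => // _ /imsetP[v Mv ->]; apply: suzuki_stabilizer_unipotent.
  - by rewrite groupJ // (subsetP sMS).
  - by rewrite /p_elt orderJ; apply: mem_p_elt M2 Mv.
  apply: (scalerI c0); rewrite scalemxAl row4Z mulr1 mulr0 -rg conjgE !GL_MxE.
  have gu : GLval g \in unitmx by exact: GL_unit.
  rewrite !mulmxA GL_VxE mulmxK //.
  by have rv : r *m GLval v = r := rM v Mv; rewrite rv.
case: rc => [[c c0 ->]|[c [x [y [c0 ->]]]]].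
  by exists 1%g, c; split=> //; rewrite mulmx1.
exists ((uS x y)^-1 * wS)%g, c; split=> //; first by rewrite groupM ?groupV ?suzuki_GLu_mem ?suzuki_GLw_mem.
have -> : row4 (c * f x y) (c * y) (c * x) c = row4 0 0 0 c *m su x y.
  by rewrite row4_suzuki_u; congr (row4 _ _ _ _); rewrite /f; ring.
rewrite GL_MxE GL_VxE suzuki_GLuE mulmxA mulmxK ?suzuki_u_unit // suzuki_GLwE row4_anti.
by [].
Qed.

Definition char_suzuki (t s : F) : {poly F} :=
  'X^4 + t%:P * 'X^3 + s%:P * 'X^2 + t%:P * 'X + 1.

Lemma char_suzukiE t s :
  char_suzuki t s = 'X^4 + \poly_(i < 4) nth 0 [:: 1; t; s; t] i.
Proof.
rewrite poly_def !big_ord_recl big_ord0 /= expr0 expr1 -!mul_polyC /char_suzuki.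
rewrite /bump /=; ring.
Qed.

Lemma size_char_suzuki t s : size (char_suzuki t s) = 5.
Proof.
by rewrite char_suzukiE size_polyDl size_polyXn // (leq_ltn_trans (size_poly _ _)).
Qed.

Lemma monic_char_suzuki t s : char_suzuki t s \is monic.
Proof.
rewrite char_suzukiE monicE lead_coefDl ?lead_coefXn //.
by rewrite size_polyXn (leq_ltn_trans (size_poly _ _)).
Qed.

(** In characteristic 2 the derivative is t (X - 1)^2, and the value at 1 is s. *)
Lemma separable_char_suzuki t s :
  t != 0 -> s != 0 -> separable_poly (char_suzuki t s).
Proof.
move=> t0 s0; rewrite separable_poly.unlock.
have -> : (char_suzuki t s)^`() = t *: ('X - 1%:P) ^+ 2.
  have p2 : 2%:R = 0 :> {poly F} by rewrite -(rmorph_nat (@polyC F)) two0 rmorph0.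
  rewrite -mul_polyC; transitivity (t%:P * ('X - 1%:P) ^+ 2 +
      2%:R * (2%:R * 'X^3 + t%:P * 'X^2 + s%:P * 'X + t%:P * 'X)).
    by rewrite /char_suzuki !derivE /=; ring.
  by rewrite p2 mul0r addr0.
rewrite coprimepZr // coprimep_expr // coprimep_XsubC /root /char_suzuki.
rewrite !(hornerD, hornerCM, hornerXn, hornerX, hornerC) !expr1n !mulr1.
suff -> : 1 + t + s + t + 1 = s by [].
by apply: (@char2_eq _ _ (t + 1)); ring.
Qed.

(** The last basis vector e4 is cyclic for w u(0, b), with characteristic
    polynomial X^4 + theta(b) X^3 + b^2 X^2 + theta(b) X + 1. *)
Lemma suzuki_cent (b : F) :
  b != 0 -> ~~ (2 %| #|'C_Sz[wS * uS 0%R b]%g|)%N.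
Proof.
move=> b0; set x := (_ * _)%g; pose t := th b.
have t0 : t != 0 by rewrite theta_eq0.
pose A : 'M[F]_4 := mx4_of_rows
  [:: [:: t; b; 0; 1]; [:: b; 0; 1; 0]; [:: 0; 1; 0; 0]; [:: 1; 0; 0; 0]].
have xE : GLval x = A.
  rewrite GL_MxE suzuki_GLwE suzuki_GLuE; rewrite /A /t; mx_entries; rewrite ?theta0; ring.
have rowA y0 y1 y2 y3 : row4 y0 y1 y2 y3 *m A =
    row4 (y0 * t + y1 * b + y3) (y0 * b + y2) y1 y0.
  by rewrite /A; mx_entries; ring.
pose e := row4 0 0 0 1.
have e1 : e *m A = row4 1 0 0 0 by rewrite rowA; congr (row4 _ _ _ _); ring.
have e2 : e *m A ^+ 2 = row4 t b 0 1.
  by rewrite expr2 mulmxA e1 rowA; congr (row4 _ _ _ _); ring.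
have e3 : e *m A ^+ 3 = row4 (t * t + b * b + 1) (t * b) b t.
  by rewrite exprSr mulmxA e2 rowA; congr (row4 _ _ _ _); ring.
have e4 : e *m A ^+ 4 =
    row4 ((t * t + b * b + 1) * t + t * b * b + t) ((t * t + b * b + 1) * b + b)
         (t * b) (t * t + b * b + 1).
  by rewrite exprSr mulmxA e3 rowA.
rewrite (@GL_cyclic_cent _ _ _ Sz x e (char_suzuki t (b ^+ 2))) //.
- by rewrite negbK separable_char_suzuki // expf_neq0.
- by rewrite groupM ?suzuki_GLw_mem ?suzuki_GLu_mem.
- rewrite xE; apply: krylov_unit => d dE.
  have := dE 0; have := dE 1; have := dE 2%:R; have := dE 3%:R.
  rewrite !big_ord_recl !big_ord0 /bump /= ?(add1n, addn0) !expr0 !expr1 !mulmx1.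
  rewrite e1 e2 e3 !mxE /= !(mulr0, mulr1, add0r, addr0) => d3 d2 d1 d0.
  have d3_0 : d 3 = 0 by move/eqP: d2; rewrite mulf_eq0 (negPf b0) orbF => /eqP.
  have d2_0 : d 2%N = 0.
    by move/eqP: d1; rewrite d3_0 mul0r addr0 mulf_eq0 (negPf b0) orbF => /eqP.
  rewrite d3_0 d2_0 !mul0r !addr0 in d0 d3.
  by case=> [|[|[|[|i]]]].
- exact: monic_char_suzuki.
- exact: size_char_suzuki.
rewrite xE (@mulmx_horner _ _ 5) ?size_char_suzuki //.
rewrite !big_ord_recl big_ord0 /bump /= ?(add1n, addn0) expr0 expr1 mulmx1.
rewrite e1 e2 e3 e4 /char_suzuki !(coefD, coefCM, coefXn, coefX, coef1) /=.
apply/rowP=> j; case_ord j; rewrite !mxE /=.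
- by apply: (@char2_eq _ _ (t + t * b ^+ 2 + t * (t * t + b * b + 1))); ring.
- by apply: (@char2_eq _ _ (b ^+ 3 + t * t * b + b)); ring.
- by apply: (@char2_eq _ _ (t * b)); ring.
by apply: (@char2_eq _ _ (1 + b ^+ 2 + t ^+ 2)); ring.
Qed.

(** By [suzuki_cent] the only exceptional element of the coset of w is w, of
    order 2. *)
Lemma suzuki_regular_involutions (M : {group {'GL_4[F]}}) :
  (forall v, v \in M -> exists b, v = uS 0 b) -> regular_coset 2 Sz M.
Proof.
move=> MU; have uS1 : uS 0 0 = 1%g.
  by apply: GL_injE; rewrite suzuki_GLuE; mx_entries; rewrite ?theta0 ?expr0n /=; ring.
exists wS; first exact: suzuki_GLw_mem.
rewrite (_ : [set v in M | _] = [set 1%g]) ?cards1 //.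
apply/setP=> v; rewrite !inE; apply/andP/eqP => [[Mv]|->].
  have [b ->] := MU v Mv; have [->|b0] := eqVneq b 0; first by rewrite uS1.
  by rewrite (negPf (suzuki_cent b0)).
split; first exact: group1.
rewrite mulg1; apply: dvdn_trans (order_dvdG (_ : wS \in 'C_Sz[wS])%g).
  have w2 : (wS ^+ 2)%g = 1%g.
    by apply: GL_injE; rewrite expgS expg1 GL_MxE suzuki_GLwE; mx_entries; ring.
  have w1 : #[wS]%g != 1%N.
    rewrite order_eq1; apply/eqP=> /(congr1 (@GLval 4 F)); rewrite suzuki_GLwE.
    by move/matrixP/(_ 0 0)/eqP; rewrite !mxE /= eq_sym oner_eq0.
  have : (#[wS]%g %| 2)%N by rewrite order_dvdn w2.
  by move/(prime_nt_dvdP (isT : prime 2) w1) => ->.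
by rewrite inE suzuki_GLw_mem cent1id.
Qed.

(** The elements u(a, b) with a <> 0 are not involutions, and two of them commute
    only if they have the same a.  In that case their product is some u(0, c),
    whose square is 1.  So the hypothesis on squares forces a = 0. *)
Lemma suzuki_regular (M : {group {'GL_4[F]}}) :
    M \subset Sz -> (2.-group M)%g -> abelian M ->
    (forall v, v \in M -> (v ^+ 2)%g != 1%g -> exists y z,
      [/\ y \in M, z \in M & [/\ (y ^+ 2)%g != 1%g, (z ^+ 2)%g != 1%g
         & ((y * z) ^+ 2)%g != 1%g]]) ->
  regular_coset 2 Sz M.
Proof.
move=> sMS M2 cMM sqM; have [g Sg MU] := suzuki_conj_unipotent sMS M2.
apply: (@regular_coset_conj _ _ _ _ g) => //; first by rewrite (subsetP (normG _)).
have uS1 : uS 0 0 = 1%g.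
  by apply: GL_injE; rewrite suzuki_GLuE; mx_entries; rewrite ?theta0 ?expr0n /=; ring.
have uS_inj a b c d : uS a b = uS c d -> a = c /\ b = d.
  move/(congr1 (@GLval 4 F)); rewrite !suzuki_GLuE => /matrixP E.
  by have := E 1 0; have := E 3%:R 1; rewrite !mxE.
have sq a b : ((uS a b) ^+ 2 == 1)%g = (a == 0).
  rewrite expgS expg1 suzuki_GLuM -uS1.
  have -> : b + b = 0 by apply: (@char2_eq _ _ b); ring.
  have -> : a + a = 0 by apply: (@char2_eq _ _ a); ring.
  rewrite add0r; apply/eqP/eqP => [/uS_inj[_ /eqP]|->]; last by rewrite mul0r.
  by rewrite mulf_eq0 theta_eq0 orbb => /eqP.
have th_cent a c : a != 0 -> c != 0 -> a * th c = c * th a -> a = c.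
  move=> a0 c0 e; have : th (a / c) = a / c.
    by apply/eqP; rewrite thetaM thetaV eqr_div ?theta_eq0 // mulrC -e mulrC.
  case/theta_fix => /(congr1 ( *%R^~ c)); rewrite divfK // ?mul0r ?mul1r // => a_0.
  by rewrite a_0 eqxx in a0.
apply: suzuki_regular_involutions => v Mv; have [a [b defv]] := MU v Mv.
exists b; rewrite defv; congr (uS _ _); apply/eqP; rewrite -(sq a b) -defv.
move: Mv; rewrite mem_conjg => Mv; apply: contraT => v2.
have [|y [z [My Mz [y2 z2 yz2]]]] := sqM _ Mv.
  by rewrite -conjXg conjg_eq1.
have conj_sq x : ((x ^ g) ^+ 2 == 1)%g = (x ^+ 2 == 1)%g by rewrite -conjXg conjg_eq1.
have [a1 [b1 yg]] := MU (y ^ g)%g (etrans (memJ_conjg _ _ _) My).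
have [a2 [b2 zg]] := MU (z ^ g)%g (etrans (memJ_conjg _ _ _) Mz).
have a10 : a1 != 0 by rewrite -(sq a1 b1) -yg conj_sq.
have a20 : a2 != 0 by rewrite -(sq a2 b2) -zg conj_sq.
have : a1 = a2.
  apply: th_cent => //; have yz : (y ^ g * z ^ g = z ^ g * y ^ g)%g.
    by rewrite -!conjMg (centsP cMM).
  move: yz; rewrite yg zg !suzuki_GLuM => /uS_inj[_ /eqP].
  by rewrite [b2 + b1]addrC (inj_eq (addrI _)) => /eqP.
move=> a12; move: yz2; rewrite -conj_sq conjMg yg zg suzuki_GLuM sq a12.
by rewrite (@char2_eq (a2 + a2) 0 a2) ?eqxx //; ring.
Qed.

End Suzuki.

(** If e ^ 2 <> 1 in E, then take (e, 1) and (1, e) in E x E. *)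
Lemma central_type_square (gT : finGroupType) (M : {group gT}) :
  central_type M -> forall v, v \in M -> (v ^+ 2)%g != 1%g -> exists y z,
      [/\ y \in M, z \in M & [/\ (y ^+ 2)%g != 1%g, (z ^+ 2)%g != 1%g
         & ((y * z) ^+ 2)%g != 1%g]].
Proof.
case=> _ [eT /isogP[f injf fM]] v Mv v2.
have [e e2] : exists e : eT, (e ^+ 2)%g != 1%g.
  have : ((f v) ^+ 2 != 1)%g.
    by apply: contraNneq v2 => fv2; rewrite -(morph_injm_eq1 injf) ?groupX // morphX // fv2.
  case: (f v) => e e' ee'; have [e2|e2] := eqVneq (e ^+ 2)%g 1%g; last by exists e.
  exists e'; apply: contraNneq ee' => e'2.
  by apply/eqP; transitivity ((e ^+ 2)%g, (e' ^+ 2)%g); last by rewrite e2 e'2.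
have fsurj x : exists2 y, y \in M & f y = x.
  have : x \in f @* M by rewrite fM inE.
  by case/morphimP=> y My _ ->; exists y.
have [y My fy] := fsurj (e, 1%g); have [z Mz fz] := fsurj (1%g, e).
have f2 x : x \in M -> ((x ^+ 2)%g == 1%g) = ((f x ^+ 2)%g == 1%g).
  by move=> Mx; rewrite -morphX // morph_injm_eq1 // groupX.
exists y, z; split=> //; split; rewrite f2 ?groupM // ?morphM //= ?fy ?fz.
- by apply: contraNneq e2 => /(congr1 fst) /= e2; apply/eqP; rewrite expgS expg1.
- by apply: contraNneq e2 => /(congr1 snd) /= e2; apply/eqP; rewrite expgS expg1.
apply: contraNneq e2 => /(congr1 fst) /= e2; apply/eqP.
by move: e2; rewrite expgS expg1 !mulg1.
Qed.

(** * Hopf orders of the twists *)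

Local Close Scope group_scope.

Lemma central_type_morphim (gT rT : finGroupType) (G M : {group gT})
    (f : {morphism G >-> rT}) :
  ('injm f)%g -> M \subset G -> central_type M -> central_type (f @* M)%G.
Proof.
move=> injf sMG [cMM [eT isoM]]; split; first exact: morphim_abelian.
exists eT; apply: isog_trans isoM; rewrite isog_sym; exact: sub_isog.
Qed.

Lemma listed_regular_coset (p m : nat) (gT : finGroupType) (M : {group gT}) :
    prime p -> (1 < m)%N -> listed_quasisimple p m gT ->
    M :!=: 1%g -> abelian M -> (p.-group M)%g -> central_type M ->
  regular_coset p [set: gT] M.
Proof.
move=> p_pr m_gt1 listed M1 cMM pM ctM; have m_gt0 := ltnW m_gt1.
have imM (rT : finGroupType) (H : {group rT}) (f : {morphism [set: gT] >-> rT}) :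
    ('injm f)%g -> (f @* [set: gT])%g = H ->
    [/\ (f @* M)%g \subset H, (p.-group (f @* M))%g, (f @* M)%g != 1%g,
        abelian (f @* M)%g & central_type (f @* M)%G].
  move=> injf <-; split; first exact: morphimS.
  - exact: morphim_pgroup.
  - by rewrite morphim_injm_eq1 ?subsetT.
  - exact: morphim_abelian.
  by apply: central_type_morphim; rewrite ?subsetT.
case: listed => [F cardF|F cardF|F cardF|n F p2 m2 cardF] /isogP[f injf fM];
  apply: (regular_coset_isog injf fM); have [sM pM' M1' cM' ctM'] := imM _ _ f injf fM.
- exact: SL2_regular cardF _ _ _ _ _.
- exact: PSL2_regular cardF _ _ _ _ _.
- have [k cardM expM] := central_type_card ctM'.
  exact: (SL3_regular p_pr cardF sM pM' M1' cM' cardM expM).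
move: pM' cardF; rewrite p2 m2 => pM' cardF.
apply: suzuki_regular => //; last exact: central_type_square.
by move: m_gt1; rewrite m2 addn1 ltnS muln_gt0.
Qed.

Theorem theorem4p1 (p m : nat) (gT : finGroupType) (M : {group gT})
    (K : fieldExtType rat) (omega : dual_group K M -> dual_group K M -> K)
    (p_prime : prime p) (m_gt1 : (1 < m)%N)
    (listed_G : listed_quasisimple p m gT)
    (M_nontrivial : M :!=: 1%g) (M_abelian : abelian M)
    (M_pgroup : (p.-group M)%g) (M_central : central_type M)
    (K_large : split_group_algebra K M)
    (omega_cocycle : cocycle2 omega)
    (omega_normalized : normalized_cocycle omega)
    (omega_nondegenerate : nondegenerate_cocycle omega) :
  (forall R : subringClosed K,
     dedekind_domain R -> {subset ring_of_integers K <= R} ->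
     admits_hopf_order (twisted_galg (twist_elt omega)) R ->
     #|M|%:R^-1 \in R) /\
  ~ admits_hopf_order (twisted_galg (twist_elt omega)) (ring_of_integers K).
Proof.
have reg := listed_regular_coset p_prime m_gt1 listed_G M_nontrivial M_abelian
  M_pgroup M_central.
have invM (R : subringClosed K) : integrally_closed R ->
    admits_hopf_order (twisted_galg (twist_elt omega)) R -> #|M|%:R^-1 \in R.
  exact: (regular_coset_inv p_prime M_pgroup reg K_large omega_cocycle
    omega_normalized omega_nondegenerate).
split=> [R dedR OKR|orderOK]; first exact/invM/dedekind_integrally_closed.
have := invM _ (@ring_of_integers_closed K) orderOK => /natr_inv_integral.
by rewrite leqNgt cardG_gt1 M_nontrivial.
Qed.
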